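(* Let $\mathfrak g$ be of type $\mathsf A_r$, $\mathsf D_r$ or $\mathsf E_6$, with diagram involution $\tau$ as in the context, and let ${}^\imath\mathscr Y$ be the associated iYangian. Then ${}^\imath\mathscr Y$ is isomorphic to the unital associative $\mathbb C$-algebra generated by $h_{i,r},b_{i,r}$, for $i\in\mathbb I$ and $0\le r\le 1$, subject to $$[h_{i,r},h_{j,s}]=0,\qquad h_{\tau i,0}=-h_{i,0},$$ $$[h_{i,0},b_{j,r}]=(c_{ij}-c_{\tau i,j})\,b_{j,r},$$ $$[h_{i,1},b_{j,0}]=(c_{ij}+c_{\tau i,j})\,b_{j,1}+\tfrac{c_{ij}-c_{\tau i,j}}{2}\{h_{i,0},b_{j,0}\},$$ $$[b_{i,1},b_{j,0}]-[b_{i,0},b_{j,1}]=\tfrac{c_{ij}}{2}\{b_{i,0},b_{j,0}\}-2\delta_{\tau i,j}h_{j,1}$$ (for all $i,j\in\mathbb I$ and $r,s\in\{0,1\}$), the finite type Serre relations $$[b_{i,0},b_{j,0}]=\delta_{\tau i,j}h_{j,0}\ \text{ if } c_{ij}=0;\qquad \big[b_{i,0},[b_{i,0},b_{\tau i,0}]\big]=4b_{i,0}\ \text{ if } c_{i,\tau i}=-1;$$ $$\big[b_{i,0},[b_{i,0},b_{j,0}]\big]=0\ \text{ if } c_{ij}=-1,\ i\neq\tau i\neq j;\qquad \big[b_{i,0},[b_{i,0},b_{j,0}]\big]=-b_{j,0}\ \text{ if } c_{ij}=-1,\ i=\tau i,$$ and possibly extra relations as follows. (1) If $\mathfrak g$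 is of type $\mathsf A_1$, then one additional relation is required: $$\big[h_{1,1},\big[b_{1,1},[h_{1,1},b_{1,1}]\big]\big]=4[b_{1,1}^2,h_{1,1}].$$ (2) If $\mathfrak g$ is of type $\mathsf A_2$, then two additional relations are required: $$\big[b_{1,1},[b_{1,1},b_{2,0}]\big]+\big[b_{2,1},[b_{2,1},b_{1,0}]\big]-2\{h_{1,0},b_{1,1}\}-2\{h_{2,0},b_{2,1}\}=0,$$ $$\big[[\tilde h_{1,1},b_{1,1}],b_{2,1}\big]-\big[b_{1,0},\big[\tilde h_{1,1},[\tilde h_{1,1},b_{2,1}]\big]\big]+\tfrac12\big[\tilde h_{1,1},\{b_{1,0},b_{2,1}\}\big]=0.$$ (3) No additional relations are required for the other types. Here $\tilde h_{i,1}:=h_{i,1}-\tfrac12h_{i,0}^2$.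
   Context: All algebras are over $\mathbb C$; $\mathbb N=\{0,1,2,\dots\}$; $[x,y]=xy-yx$ and $\{x,y\}=xy+yx$. $\mathfrak g$ is a finite-dimensional simple Lie algebra with simply-laced Cartan matrix $(c_{ij})_{i,j\in\mathbb I}$. $\tau$ is a nontrivial involution of the Dynkin diagram ($\tau^2=\mathrm{id}$, $\tau\neq\mathrm{id}$, $c_{\tau i,\tau j}=c_{ij}$), except that in type $\mathsf A_1$ one takes $\tau=\mathrm{id}$. The (quasi-split) iYangian ${}^\imath\mathscr Y$ associated with $(\mathbb I,\tau)$ is the unital associative $\mathbb C$-algebra generated by $h_{i,r},b_{i,r}$, $i\in\mathbb I$, $r\in\mathbb N$, subject to, for all $i,j\in\mathbb I$ and $r,s\in\mathbb N$: $$[h_{i,r},h_{j,s}]=0,\quad h_{\tau i,0}=-h_{i,0},\quad [h_{i,0},b_{j,r}]=(c_{ij}-c_{\tau i,j})b_{j,r},$$ $$[h_{i,1},b_{j,r}]=(c_{ij}+c_{\tau i,j})b_{j,r+1}+\tfrac{c_{ij}-c_{\tau i,j}}2\{h_{i,0},b_{j,r}\},$$ $$[h_{i,r+2},b_{j,s}]-[h_{i,r},b_{j,s+2}]=\tfrac{c_{ij}-c_{\tau i,j}}2\{h_{i,r+1},b_{j,s}\}+\tfrac{c_{ij}+c_{\tau i,j}}2\{h_{i,r},b_{j,s+1}\}+\tfrac{c_{ij}c_{\tau i,j}}4[h_{i,r},b_{j,s}],$$ $$[b_{i,r+1},b_{j,s}]-[b_{i,r},b_{j,s+1}]=\tfrac{c_{ij}}2\{b_{i,r},b_{j,s}\}-2\delta_{\tau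 i,j}(-1)^rh_{j,r+s+1},$$ together with the finite type Serre relations (the same as the four displayed in the claim). *)

(* Defs.v *)
From HB Require Import structures.
From mathcomp Require Import all_boot all_order all_algebra.
From mathcomp Require Import boolp reals.
From mathcomp Require Import complex.
From mathcomp Require Import monalg.

Set Implicit Arguments.
Unset Strict Implicit.
Unset Printing Implicit Defensive.

Import GRing.Theory.
Local Open Scope ring_scope.

Definition lie (A : pzRingType) (x y : A) : A := x * y - y * x.
Definition anti (A : pzRingType) (x y : A) : A := x * y + y * x.
Notation "⁅ x , y ⁆" := (lie x y)
  (at level 0, x, y at level 200, format "⁅ x ,  y ⁆") : ring_scope.
Notation "⦃ x , y ⦄" := (anti x y)
  (at level 0, x, y at level 200, format "⦃ x ,  y ⦄") : ring_scope.

(** * Associative algebras presented by generators and relations *)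

(* Noncommutative polynomials over K in the variables G, i.e. the monoid
   algebra of the free monoid on G.  Product and scaling are those of monalg,
   locked because failing conversions between two unlocked products are very
   slow. *)
Fact free_alg_key : unit. Proof. exact: tt. Qed.

Definition free_alg (K : fieldType) (G : choiceType) : Type :=
  {malg K[{fmonom G}]}.
HB.instance Definition _ K G := GRing.Zmodule.on (free_alg K G).

Section FreeAlgebra.
Variables (K : fieldType) (G : choiceType).
Local Notation M := {malg K[{fmonom G}]}.
Local Notation FA := (free_alg K G).

Definition free_mul : FA -> FA -> FA := locked_with free_alg_key (@GRing.mul M).
Definition free_scale : K -> FA -> FA :=
  locked_with free_alg_key (@GRing.scale K M).
Definition free_one : FA := (1 : M).
Definition free_gen (g : G) : FA := (<< fmu g >> : M).

Lemma free_mulE (x y : FA) : free_mul x y = (x : M) * (y : M).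
Proof. by rewrite /free_mul unlock. Qed.
Lemma free_scaleE a (x : FA) : free_scale a x = a *: (x : M).
Proof. by rewrite /free_scale unlock. Qed.

Lemma free_mulA : associative free_mul.
Proof. by move=> x y z; rewrite !free_mulE mulrA. Qed.
Lemma free_mul1 : left_id free_one free_mul.
Proof. by move=> x; rewrite free_mulE mul1r. Qed.
Lemma free_mulr1 : right_id free_one free_mul.
Proof. by move=> x; rewrite free_mulE mulr1. Qed.
Lemma free_mulDl : left_distributive free_mul +%R.
Proof. by move=> x y z; rewrite !free_mulE; exact: mulrDl. Qed.
Lemma free_mulDr : right_distributive free_mul +%R.
Proof. by move=> x y z; rewrite !free_mulE; exact: mulrDr. Qed.
Lemma free_one_neq0 : free_one != 0.
Proof. exact: (oner_neq0 M). Qed.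

HB.instance Definition _ := GRing.Zmodule_isNzRing.Build FA
  free_mulA free_mul1 free_mulr1 free_mulDl free_mulDr free_one_neq0.

Lemma free_scaleA a b x : free_scale a (free_scale b x) = free_scale (a * b) x.
Proof. by rewrite !free_scaleE; exact: scalerA. Qed.
Lemma free_scale1 : left_id 1 free_scale.
Proof. by move=> x; rewrite free_scaleE; exact: scale1r. Qed.
Lemma free_scaleDr : right_distributive free_scale +%R.
Proof. by move=> a x y; rewrite !free_scaleE; exact: scalerDr. Qed.
Lemma free_scaleDl x : {morph free_scale^~ x : a b / a + b}.
Proof. by move=> a b; rewrite !free_scaleE; exact: scalerDl. Qed.

HB.instance Definition _ := GRing.Zmodule_isLmodule.Build K FA
  free_scaleA free_scale1 free_scaleDr free_scaleDl.

Lemma free_scaleAl a (x y : FA) : a *: (x * y) = (a *: x) * y.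
Proof.
rewrite -[LHS]/(free_scale a (free_mul x y)).
rewrite -[RHS]/(free_mul (free_scale a x) y).
by rewrite !free_mulE !free_scaleE; exact: scalerAl.
Qed.

HB.instance Definition _ := GRing.Lmodule_isLalgebra.Build K FA free_scaleAl.

Lemma free_scaleAr a (x y : FA) : a *: (x * y) = x * (a *: y).
Proof.
rewrite -[LHS]/(free_scale a (free_mul x y)).
rewrite -[RHS]/(free_mul x (free_scale a y)).
rewrite !free_mulE !free_scaleE -!mul_malgC mulrA.
have -> : (a%:MP : M) * (x : M) = (x : M) * (a%:MP : M).
  rewrite [LHS]fgmulUg [RHS]fgmulgU; apply: eq_bigr => k _.
  by rewrite mulm1 mul1m mulrC.
by rewrite -mulrA.
Qed.

HB.instance Definition _ := GRing.Lalgebra_isAlgebra.Build K FA free_scaleAr.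

(* The constant term, i.e. the algebra morphism killing all generators. *)
Definition cst_term : FA -> K := @mcoeff {fmonom G} K (@mone _).

Lemma cst_term0 : cst_term 0 = 0.
Proof. exact: mcoeff0. Qed.
Lemma cst_term1 : cst_term 1 = 1.
Proof. exact: (mcoeff1g_is_multiplicative {fmonom G} K).2. Qed.
Lemma cst_termD (x y : FA) : cst_term (x + y) = cst_term x + cst_term y.
Proof. exact: mcoeffD. Qed.
Lemma cst_termN (x : FA) : cst_term (- x) = - cst_term x.
Proof. exact: mcoeffN. Qed.
Lemma cst_termM (x y : FA) : cst_term (x * y) = cst_term x * cst_term y.
Proof.
rewrite -[x * y]/(free_mul x y) free_mulE.
exact: (mcoeff1g_is_multiplicative {fmonom G} K).1.
Qed.
Lemma cst_termZ a (x : FA) : cst_term (a *: x) = a * cst_term x.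
Proof. by rewrite -[a *: x]/(free_scale a x) free_scaleE; exact: mcoeffZ. Qed.
Lemma cst_term_gen g : cst_term (free_gen g) = 0.
Proof. by rewrite /cst_term /free_gen mcoeffU1 fm1_eq1. Qed.
Lemma cst_term_lie (x y : FA) : cst_term ⁅x, y⁆ = 0.
Proof. by rewrite /lie cst_termD cst_termN !cst_termM mulrC subrr. Qed.

Lemma cst_term_anti (x y : FA) : cst_term x = 0 -> cst_term ⦃x, y⦄ = 0.
Proof. by move=> x0; rewrite cst_termD !cst_termM /= x0 mul0r mulr0 addr0. Qed.

Lemma cst_term_add (x y : FA) :
  cst_term x = 0 -> cst_term y = 0 -> cst_term (x + y) = 0.
Proof. by move=> x0 y0; rewrite cst_termD x0 y0 addr0. Qed.

Lemma cst_term_opp (x : FA) : cst_term x = 0 -> cst_term (- x) = 0.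
Proof. by move=> x0; rewrite cst_termN x0 oppr0. Qed.

Lemma cst_term_scale a (x : FA) : cst_term x = 0 -> cst_term (a *: x) = 0.
Proof. by move=> x0; rewrite cst_termZ x0 mulr0. Qed.

End FreeAlgebra.

Section Presentation.
Variables (K : fieldType) (G : choiceType).
Local Notation FA := (free_alg K G).

(* A relation [rel u v] stands for the equation u = v. *)
Variable rel : FA -> FA -> Prop.

Inductive in_ideal : FA -> Prop :=
| in_ideal0 : in_ideal 0
| in_idealD x y : in_ideal x -> in_ideal y -> in_ideal (x + y)
| in_ideal_rel a u v b : rel u v -> in_ideal (a * (u - v) * b).

Lemma in_idealM a x b : in_ideal x -> in_ideal (a * x * b).
Proof.
elim=> [|x1 y1 _ IHx _ IHy|a' u v b' uv].
- by rewrite mulr0 mul0r; exact: in_ideal0.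
- by rewrite mulrDr mulrDl; exact: in_idealD.
- by rewrite !mulrA -(mulrA _ b'); exact: in_ideal_rel.
Qed.

Definition ideal_pred : {pred FA} := fun x => `[< in_ideal x >].

Lemma ideal_predP x : reflect (in_ideal x) (x \in ideal_pred).
Proof. exact: asboolP. Qed.

Lemma ideal_zmod_closed : zmod_closed ideal_pred.
Proof.
split=> [|x y /ideal_predP Ix /ideal_predP Iy].
  exact/ideal_predP/in_ideal0.
apply/ideal_predP/in_idealD => //.
by rewrite -[y]mulr1 -mulN1r mulrA; exact: in_idealM.
Qed.

HB.instance Definition _ := GRing.isZmodClosed.Build FA ideal_pred
  ideal_zmod_closed.

Definition pres_alg : Type := Quotient.quot ideal_pred.
HB.instance Definition _ := GRing.Zmodule.on pres_alg.

Definition pres_pi (x : FA) : pres_alg := (\pi_(Quotient.quot ideal_pred) x)%qT.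
Definition pres_repr (x : pres_alg) : FA := generic_quotient.repr x.
Definition pres_gen (g : G) : pres_alg := pres_pi (free_gen K g).

Lemma pres_reprK : cancel pres_repr pres_pi.
Proof. by move=> x; rewrite /pres_pi /pres_repr reprK. Qed.

Lemma pres_pi_eq x y : pres_pi x = pres_pi y <-> in_ideal (x - y).
Proof.
rewrite (rwP (ideal_predP _)) Quotient.idealrBE.
by split => [/eqP|/eqP].
Qed.

Lemma pres_piB : {morph pres_pi : x y / x - y}.
Proof. by move=> x y; rewrite /pres_pi !piE. Qed.

Lemma pres_piD : {morph pres_pi : x y / x + y}.
Proof. by move=> x y; rewrite /pres_pi !piE. Qed.

Definition pres_one : pres_alg := pres_pi 1.
Definition pres_mul : pres_alg -> pres_alg -> pres_alg :=
  locked_with free_alg_key (fun x y => pres_pi (pres_repr x * pres_repr y)).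
Definition pres_scale : K -> pres_alg -> pres_alg :=
  locked_with free_alg_key (fun a x => pres_pi (a *: pres_repr x)).

Lemma in_ideal_repr x : in_ideal (pres_repr (pres_pi x) - x).
Proof. by apply/pres_pi_eq; rewrite pres_reprK. Qed.

Lemma pres_piM x y : pres_pi (x * y) = pres_mul (pres_pi x) (pres_pi y).
Proof.
rewrite /pres_mul unlock; apply/esym/pres_pi_eq.
set x' := pres_repr _; set y' := pres_repr _.
have -> : x' * y' - x * y = 1 * (x' - x) * y' + x * (y' - y) * 1.
  by rewrite mul1r mulr1 mulrBl mulrBr addrA subrK.
by apply: in_idealD; apply: in_idealM; exact: in_ideal_repr.
Qed.

Lemma pres_piZ a x : pres_pi (a *: x) = pres_scale a (pres_pi x).
Proof.
rewrite /pres_scale unlock.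
apply/esym/pres_pi_eq; rewrite -scalerBr -[_ - x]mul1r scalerAl -[_ * _]mulr1.
exact/in_idealM/in_ideal_repr.
Qed.

Lemma pres_mulA : associative pres_mul.
Proof.
by move=> x y z; rewrite -[x]pres_reprK -[y]pres_reprK -[z]pres_reprK
  -!pres_piM mulrA.
Qed.
Lemma pres_mul1 : left_id pres_one pres_mul.
Proof. by move=> x; rewrite -[x]pres_reprK -pres_piM mul1r. Qed.
Lemma pres_mulr1 : right_id pres_one pres_mul.
Proof. by move=> x; rewrite -[x]pres_reprK -pres_piM mulr1. Qed.
Lemma pres_mulDl : left_distributive pres_mul +%R.
Proof.
move=> x y z; rewrite -[x]pres_reprK -[y]pres_reprK -[z]pres_reprK.
by rewrite -!pres_piM -!pres_piD -pres_piM mulrDl.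
Qed.
Lemma pres_mulDr : right_distributive pres_mul +%R.
Proof.
move=> x y z; rewrite -[x]pres_reprK -[y]pres_reprK -[z]pres_reprK.
by rewrite -!pres_piM -!pres_piD -pres_piM mulrDr.
Qed.

HB.instance Definition _ := GRing.Zmodule_isPzRing.Build pres_alg
  pres_mulA pres_mul1 pres_mulr1 pres_mulDl pres_mulDr.

Lemma pres_scaleA a b x : pres_scale a (pres_scale b x) = pres_scale (a * b) x.
Proof. by rewrite -[x]pres_reprK -!pres_piZ scalerA. Qed.
Lemma pres_scale1 : left_id 1 pres_scale.
Proof. by move=> x; rewrite -[x]pres_reprK -pres_piZ scale1r. Qed.
Lemma pres_scaleDr : right_distributive pres_scale +%R.
Proof.
move=> a x y; rewrite -[x]pres_reprK -[y]pres_reprK.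
by rewrite -pres_piD -!pres_piZ -pres_piD scalerDr.
Qed.
Lemma pres_scaleDl x : {morph pres_scale^~ x : a b / a + b}.
Proof.
by move=> a b; rewrite -[x]pres_reprK -!pres_piZ -pres_piD scalerDl.
Qed.

HB.instance Definition _ := GRing.Zmodule_isLmodule.Build K pres_alg
  pres_scaleA pres_scale1 pres_scaleDr pres_scaleDl.

Lemma pres_scaleAl a (x y : pres_alg) : a *: (x * y) = (a *: x) * y.
Proof.
rewrite -[x]pres_reprK -[y]pres_reprK.
rewrite -[LHS]/(pres_scale a (pres_mul _ _)) -[RHS]/(pres_mul (pres_scale a _) _).
by rewrite -pres_piM -!pres_piZ -pres_piM scalerAl.
Qed.
Lemma pres_scaleAr a (x y : pres_alg) : a *: (x * y) = x * (a *: y).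
Proof.
rewrite -[x]pres_reprK -[y]pres_reprK.
rewrite -[LHS]/(pres_scale a (pres_mul _ _)) -[RHS]/(pres_mul _ (pres_scale a _)).
by rewrite -pres_piM -!pres_piZ -pres_piM free_scaleAr.
Qed.

Lemma pres_neq0 :
  (forall u v, rel u v -> cst_term u = cst_term v) -> (1 : pres_alg) != 0.
Proof.
move=> rel0; apply/eqP.
have -> : (0 : pres_alg) = pres_pi 0 by rewrite /pres_pi !piE.
move/pres_pi_eq; rewrite subr0.
suff cst0 (x : FA) : in_ideal x -> cst_term x = 0.
  by move/cst0/eqP; rewrite cst_term1 oner_eq0.
elim=> [|y z _ y0 _ z0|a u v b /rel0 uv].
- exact: cst_term0.
- by rewrite cst_termD y0 z0 addr0.
- by rewrite !cst_termM cst_termD cst_termN uv subrr mulr0 mul0r.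
Qed.

End Presentation.

(** * Simply-laced Dynkin diagrams of types A, D, E6 *)

Inductive dynkin := DynA of nat | DynD of nat | DynE6.

Definition rank (t : dynkin) : nat :=
  match t with DynA r => r | DynD r => r | DynE6 => 6 end.

Definition wf_dynkin (t : dynkin) : bool :=
  match t with DynA r => 1 <= r | DynD r => 4 <= r | DynE6 => true end%N.

(* Vertices are numbered from 0, each edge being listed once:
     A_r :  0 - 1 - ... - (r-1);
     D_r :  0 - 1 - ... - (r-2), and (r-3) - (r-1);
     E_6 :  0 - 2 - 3 - 4 - 5, and 1 - 3. *)
Definition edge (t : dynkin) (i j : nat) : bool :=
  match t with
  | DynA r => j == i.+1
  | DynD r => ((j == i.+1) && (j < r.-1)) || ((i.+3 == r) && (j.+1 == r))
  | DynE6 => (i, j) \in [:: (0, 2); (2, 3); (3, 4); (4, 5); (1, 3)]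
  end%N.

Definition cartan (t : dynkin) : 'M[int]_(rank t) :=
  \matrix_(i, j)
    if i == j then 2 else if edge t i j || edge t j i then -1 else 0.

(* For A_1 the type 'I_1 leaves only tau = id. *)
Definition diagram_involution (t : dynkin) (tau : 'I_(rank t) -> 'I_(rank t)) :
    Prop :=
  [/\ involutive tau,
      forall i j, cartan t (tau i) (tau j) = cartan t i j
    & t <> DynA 1 -> ~ (tau =1 id)].

(** * The iYangian and its finite presentation *)

(* Generators h_{i,r} (left summand) and b_{i,r} (right summand), with r
   ranging over L. *)
Definition iY_gen (t : dynkin) (L : choiceType) : choiceType :=
  ('I_(rank t) * L + 'I_(rank t) * L)%type.

Section IYangian.
Variables (K : fieldType) (t : dynkin) (tau : 'I_(rank t) -> 'I_(rank t)).
Local Notation I := 'I_(rank t).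

Definition cK (i j : I) : K := (cartan t i j)%:~R.

Inductive serre (A : lalgType K) (h0 b0 : I -> A) : A -> A -> Prop :=
| serre_0 i j : cartan t i j = 0 ->
    serre h0 b0 ⁅b0 i, b0 j⁆ ((tau i == j)%:R *: h0 j)
| serre_tau i : cartan t i (tau i) = -1 ->
    serre h0 b0 ⁅b0 i, ⁅b0 i, b0 (tau i)⁆⁆ (4%:R *: b0 i)
| serre_split i j : cartan t i j = -1 -> i != tau i -> tau i != j ->
    serre h0 b0 ⁅b0 i, ⁅b0 i, b0 j⁆⁆ 0
| serre_fixed i j : cartan t i j = -1 -> i = tau i ->
    serre h0 b0 ⁅b0 i, ⁅b0 i, b0 j⁆⁆ (- b0 j).

Definition free_h (L : choiceType) (i : I) (r : L) : free_alg K (iY_gen t L) :=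
  free_gen K (inl (i, r) : iY_gen t L).
Definition free_b (L : choiceType) (i : I) (r : L) : free_alg K (iY_gen t L) :=
  free_gen K (inr (i, r) : iY_gen t L).

Section Full.
Local Notation FA := (free_alg K (iY_gen t nat)).
Local Notation h := (@free_h nat).
Local Notation b := (@free_b nat).

Inductive iY_rel : FA -> FA -> Prop :=
| iY_hh i j r s : iY_rel ⁅h i r, h j s⁆ 0
| iY_h0 i : iY_rel (h (tau i) 0%N) (- h i 0%N)
| iY_h0b i j r :
    iY_rel ⁅h i 0%N, b j r⁆ ((cK i j - cK (tau i) j) *: b j r)
| iY_h1b i j r :
    iY_rel ⁅h i 1%N, b j r⁆
      ((cK i j + cK (tau i) j) *: b j r.+1
       + ((cK i j - cK (tau i) j) / 2%:R) *: ⦃h i 0%N, b j r⦄)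
| iY_hb i j r s :
    iY_rel (⁅h i r.+2, b j s⁆ - ⁅h i r, b j s.+2⁆)
      (((cK i j - cK (tau i) j) / 2%:R) *: ⦃h i r.+1, b j s⦄
       + ((cK i j + cK (tau i) j) / 2%:R) *: ⦃h i r, b j s.+1⦄
       + ((cK i j * cK (tau i) j) / 4%:R) *: ⁅h i r, b j s⁆)
| iY_bb i j r s :
    iY_rel (⁅b i r.+1, b j s⁆ - ⁅b i r, b j s.+1⁆)
      ((cK i j / 2%:R) *: ⦃b i r, b j s⦄
       - (2%:R * (tau i == j)%:R * (-1) ^+ r) *: h j (r + s).+1)
| iY_serre u v : serre (h^~ 0%N) (b^~ 0%N) u v -> iY_rel u v.
End Full.

Section Finite.
Local Notation FA := (free_alg K (iY_gen t 'I_2)).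
Local Notation h := (@free_h 'I_2).
Local Notation b := (@free_b 'I_2).

Definition htilde (i : I) : FA := h i 1 - 2%:R^-1 *: (h i 0) ^+ 2.

Inductive iY01_rel : FA -> FA -> Prop :=
| iY01_hh i j r s : iY01_rel ⁅h i r, h j s⁆ 0
| iY01_h0 i : iY01_rel (h (tau i) 0) (- h i 0)
| iY01_h0b i j r :
    iY01_rel ⁅h i 0, b j r⁆ ((cK i j - cK (tau i) j) *: b j r)
| iY01_h1b i j :
    iY01_rel ⁅h i 1, b j 0⁆
      ((cK i j + cK (tau i) j) *: b j 1
       + ((cK i j - cK (tau i) j) / 2%:R) *: ⦃h i 0, b j 0⦄)
| iY01_bb i j :
    iY01_rel (⁅b i 1, b j 0⁆ - ⁅b i 0, b j 1⁆)
      ((cK i j / 2%:R) *: ⦃b i 0, b j 0⦄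
       - (2%:R * (tau i == j)%:R) *: h j 1)
| iY01_serre u v : serre (h^~ 0) (b^~ 0) u v -> iY01_rel u v
(* In type A_1 the only vertex is i. *)
| iY01_A1 (i : I) : t = DynA 1 ->
    iY01_rel ⁅h i 1, ⁅b i 1, ⁅h i 1, b i 1⁆⁆⁆ (4%:R *: ⁅b i 1 ^+ 2, h i 1⁆)
(* In type A_2 the two vertices are i (numbered 1 in the usual labelling)
   and j (numbered 2). *)
| iY01_A2a (i j : I) : t = DynA 2 -> val i = 0%N -> val j = 1%N ->
    iY01_rel
      (⁅b i 1, ⁅b i 1, b j 0⁆⁆ + ⁅b j 1, ⁅b j 1, b i 0⁆⁆
       - 2%:R *: ⦃h i 0, b i 1⦄ - 2%:R *: ⦃h j 0, b j 1⦄)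
      0
| iY01_A2b (i j : I) : t = DynA 2 -> val i = 0%N -> val j = 1%N ->
    iY01_rel
      (⁅⁅htilde i, b i 1⁆, b j 1⁆
       - ⁅b i 0, ⁅htilde i, ⁅htilde i, b j 1⁆⁆⁆
       + 2%:R^-1 *: ⁅htilde i, ⦃b i 0, b j 1⦄⁆)
      0.
End Finite.

Definition iYangian : Type := pres_alg iY_rel.
Definition iYangian01 : Type := pres_alg iY01_rel.

HB.instance Definition _ := GRing.PzRing.on iYangian.
HB.instance Definition _ := GRing.Lmodule.on iYangian.
HB.instance Definition _ := GRing.PzRing.on iYangian01.
HB.instance Definition _ := GRing.Lmodule.on iYangian01.

Section ConstantTerm.
Variable L : choiceType.
Local Notation FA := (free_alg K (iY_gen t L)).

Lemma cst_term_serre (h0 b0 : I -> FA) u v :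
  (forall i, cst_term (h0 i) = 0) -> (forall i, cst_term (b0 i) = 0) ->
  serre h0 b0 u v -> cst_term u = cst_term v.
Proof.
move=> hh hb; case=> *;
by rewrite cst_term_lie ?cst_termZ ?cst_termN ?cst_term0 ?hh ?hb ?mulr0 ?oppr0.
Qed.
End ConstantTerm.

Local Ltac cst_term_tac g0 :=
  transitivity (0 : K); [|symmetry];
  repeat match goal with
  | |- cst_term 0%R = _ => exact: cst_term0
  | |- cst_term (lie _ _) = _ => exact: cst_term_lie
  | |- cst_term (anti _ _) = _ => apply: cst_term_anti
  | |- cst_term (_ + _)%R = _ => apply: cst_term_add
  | |- cst_term (- _)%R = _ => apply: cst_term_opp
  | |- cst_term (_ *: _)%R = _ => apply: cst_term_scale
  | |- _ => exact: g0
  end.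

Lemma iYangian_neq0 : (1 : iYangian) != 0.
Proof.
have g0 := @cst_term_gen K (iY_gen t nat).
apply: pres_neq0 => u v [].
7: by move=> {}u {}v; apply: cst_term_serre => i; exact: g0.
all: move=> *; cst_term_tac g0.
Qed.

Lemma iYangian01_neq0 : (1 : iYangian01) != 0.
Proof.
have g0 := @cst_term_gen K (iY_gen t 'I_2).
apply: pres_neq0 => u v [].
6: by move=> {}u {}v; apply: cst_term_serre => i; exact: g0.
all: move=> *; cst_term_tac g0.
Qed.

HB.instance Definition _ :=
  GRing.PzSemiRing_isNonZero.Build iYangian iYangian_neq0.
HB.instance Definition _ :=
  GRing.PzSemiRing_isNonZero.Build iYangian01 iYangian01_neq0.
HB.instance Definition _ := GRing.Lmodule_isLalgebra.Build K iYangian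
  (@pres_scaleAl _ _ iY_rel).
HB.instance Definition _ := GRing.Lalgebra_isAlgebra.Build K iYangian
  (@pres_scaleAr _ _ iY_rel).
HB.instance Definition _ := GRing.Lmodule_isLalgebra.Build K iYangian01
  (@pres_scaleAl _ _ iY01_rel).
HB.instance Definition _ := GRing.Lalgebra_isAlgebra.Build K iYangian01
  (@pres_scaleAr _ _ iY01_rel).

Definition iY_h (i : I) (r : nat) : iYangian :=
  pres_gen iY_rel (inl (i, r) : iY_gen t nat).
Definition iY_b (i : I) (r : nat) : iYangian :=
  pres_gen iY_rel (inr (i, r) : iY_gen t nat).
Definition iY01_h (i : I) (r : 'I_2) : iYangian01 :=
  pres_gen iY01_rel (inl (i, r) : iY_gen t 'I_2).
Definition iY01_b (i : I) (r : 'I_2) : iYangian01 :=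
  pres_gen iY01_rel (inr (i, r) : iY_gen t 'I_2).

End IYangian.

(* Main.v *)
From HB Require Import structures.
Require Import Defs.
From mathcomp Require Import all_boot all_order all_algebra.
From mathcomp Require Import ring lra zify.
From mathcomp Require Import boolp reals complex monalg.

Set Implicit Arguments.
Unset Strict Implicit.
Unset Printing Implicit Defensive.

Import Order.TTheory GRing.Theory Num.Theory.
Local Open Scope ring_scope.

(** The elements h_{i,1} - h_{i,0}^2 / 2 act on the b's by shifting the second
    index.  In the finite presentation they are used to define all b_{i,r}, and
    the relation between b_{tau i} and b_i at (0, n) defines h_{i,n+2}.

    Relations between b's of different tau-orbits follow from the case
    r = s = 0, because the shifts attached to the two orbits act on them with a
    nonzero determinant.

    Inside one orbit the relations are proved by induction on the total degree.
    If they hold up to degree N, the next ones can only fail by multiples of one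
    element E, the commutator of h_1 - h_0^2 / 2 with g_{N+1}, where g_0 = 1 and
    g_{r+1} = h_r.  The Newton power sums of the g's act on the b's by polynomials
    in the shift; applying them to the relations between the b's gives
    [g_{a+1}, g_{b+1}] = a l_a E for a + b = N + 1 with explicit scalars l_a, and
    antisymmetry in (a, b) forces E = 0.

    The induction starts once h_1 - h_0^2 / 2 commutes with g_3 (with g_4 if
    tau i = i).  This is obtained from the power sums of a neighbouring orbit.  Such
    an orbit exists unless the type is A_1 or A_2, and there the extra relations
    supply what is missing. *)

(** * Linear combinations of noncommutative equations *)

(** Here l_a = (2 + (-1)^(a+1) d)/(2 + d) with d = c_{i,tau i}. As l_1 = 1 and g_2 - (h_1 - h_0^2/2)
    commutes with all g's, the case a = 1 is a tautology; antisymmetry says something only for a, b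
    >= 2, hence from N = 3 on. For d = 2 the scalar l_a vanishes at even a, so N = 3, where a = b =
    2, is lost too: this is why the starting degree depends on tau i.

    A second gap is the relation of h_{i,2} and h_{i,0} with the b's of the same orbit (n = 1): n =
    0 is the definition of the shift, and commuting b_{tau i} through the relations between two
    b_i's only starts at n = 2. If tau i = i it is empty, as h_{i,0} = h_{i,2} = 0. Otherwise it
    comes from the Serre relation of i and tau i: directly if c_{i,tau i} = 0, and up to one cubic
    identity if c_{i,tau i} = -1. That identity needs a neighbour or, in type A_2, the first extra
    relation. The extra relation of A_1 is [h_{1,1}, h_{1,3}] = 0 in disguise, the second one of A_2
    is the missing commutation with g_3. *)

Section NoncommutativeNormalForm.
Variables (K : comNzRingType) (A : algType K).

Inductive nc_expr :=
| NCvar of nat | NC0 | NC1 | NCadd of nc_expr & nc_expr | NCopp of nc_expr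
| NCmul of nc_expr & nc_expr | NCscale of K & nc_expr.

Fixpoint nc_eval (env : seq A) (e : nc_expr) : A :=
  match e with
  | NCvar n => nth 0 env n
  | NC0 => 0
  | NC1 => 1
  | NCadd e1 e2 => nc_eval env e1 + nc_eval env e2
  | NCopp e1 => - nc_eval env e1
  | NCmul e1 e2 => nc_eval env e1 * nc_eval env e2
  | NCscale k e1 => k *: nc_eval env e1
  end.

Fixpoint nc_word_eqb (u v : seq nat) : bool :=
  match u, v with
  | [::], [::] => true
  | m :: u', n :: v' => Nat.eqb m n && nc_word_eqb u' v'
  | _, _ => false
  end.

Fixpoint nc_insert (k : K) (u : seq nat) (p : seq (K * seq nat)) :=
  match p with
  | [::] => [:: (k, u)]
  | (l, v) :: p' =>
      if nc_word_eqb u v then (k + l, v) :: p' else (l, v) :: nc_insert k u p'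
  end.

Fixpoint nc_add (p q : seq (K * seq nat)) :=
  match p with [::] => q | (k, u) :: p' => nc_insert k u (nc_add p' q) end.

Fixpoint nc_mul1 (k : K) (u : seq nat) (q : seq (K * seq nat)) :=
  match q with
  | [::] => [::] | (l, v) :: q' => (k * l, u ++ v) :: nc_mul1 k u q'
  end.

Fixpoint nc_mul (p q : seq (K * seq nat)) :=
  match p with
  | [::] => [::] | (k, u) :: p' => nc_add (nc_mul1 k u q) (nc_mul p' q)
  end.

Fixpoint nc_norm (e : nc_expr) : seq (K * seq nat) :=
  match e with
  | NCvar n => [:: (1, [:: n])]
  | NC0 => [::]
  | NC1 => [:: (1, [::])]
  | NCadd e1 e2 => nc_add (nc_norm e1) (nc_norm e2)
  | NCopp e1 => nc_mul1 (-1) [::] (nc_norm e1)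
  | NCmul e1 e2 => nc_mul (nc_norm e1) (nc_norm e2)
  | NCscale k e1 => nc_mul1 k [::] (nc_norm e1)
  end.

Definition nc_word (env : seq A) (u : seq nat) : A :=
  \prod_(n <- u) nth 0 env n.
Fixpoint nc_poly (env : seq A) (p : seq (K * seq nat)) : A :=
  match p with [::] => 0 | (k, u) :: p' => k *: nc_word env u + nc_poly env p' end.

Lemma nc_word_eqbP u v : nc_word_eqb u v -> u = v.
Proof.
elim: u v => [|m u IH] [|n v] //= /andP[/PeanoNat.Nat.eqb_eq -> /IH ->//].
Qed.

Lemma nc_insertE env k u p :
  nc_poly env (nc_insert k u p) = k *: nc_word env u + nc_poly env p.
Proof.
elim: p => [|[l v] p IH] //=; case: ifP => [/nc_word_eqbP -> /=|_ /=].
  by rewrite scalerDl addrA.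
by rewrite IH addrCA.
Qed.

Lemma nc_addE env p q :
  nc_poly env (nc_add p q) = nc_poly env p + nc_poly env q.
Proof.
by elim: p => [|[k u] p IH] /=; rewrite ?add0r // nc_insertE IH addrA.
Qed.

Lemma nc_mul1E env k u q :
  nc_poly env (nc_mul1 k u q) = (k *: nc_word env u) * nc_poly env q.
Proof.
elim: q => [|[l v] q IH] /=; rewrite ?mulr0 // IH mulrDr.
by congr (_ + _); rewrite /nc_word big_cat -scalerAl -scalerAr scalerA.
Qed.

Lemma nc_mulE env p q :
  nc_poly env (nc_mul p q) = nc_poly env p * nc_poly env q.
Proof.
by elim: p => [|[k u] p IH] /=; rewrite ?mul0r // nc_addE nc_mul1E IH mulrDl.
Qed.

Lemma nc_normE env e : nc_poly env (nc_norm e) = nc_eval env e.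
Proof.
have nil : nc_word env [::] = 1 by rewrite /nc_word big_nil.
elim: e => [n|||e1 IH1 e2 IH2|e IH|e1 IH1 e2 IH2|k e IH] //=.
- by rewrite /nc_word big_seq1 scale1r addr0.
- by rewrite nil scale1r addr0.
- by rewrite nc_addE IH1 IH2.
- by rewrite nc_mul1E nil IH scaleN1r mulN1r.
- by rewrite nc_mulE IH1 IH2.
- by rewrite nc_mul1E nil IH -scalerAl mul1r.
Qed.

(** A conjunction of equations in [K] and not a boolean test: the coefficients are symbolic, so that
    after [cbv] each of them is a separate goal for [field]. *)
Fixpoint nc_null (p : seq (K * seq nat)) : Prop :=
  match p with [::] => True | (k, _) :: p' => k = 0 /\ nc_null p' end.

Lemma nc_nullE env p : nc_null p -> nc_poly env p = 0.
Proof. by elim: p => [|[k u] p IH] //= [-> /IH ->]; rewrite scale0r addr0. Qed.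

Lemma nc_identity env e : nc_null (nc_norm e) -> nc_eval env e = 0.
Proof. by rewrite -nc_normE => /nc_nullE. Qed.

Lemma eq_of_eq (u v u' v' : A) : u' = v' -> (u - v) - (u' - v') = 0 -> u = v.
Proof. by move=> ->; rewrite subrr subr0 => /eqP; rewrite subr_eq0 => /eqP. Qed.

Lemma eqD (u v u' v' : A) : u = v -> u' = v' -> u + u' = v + v'.
Proof. by move=> -> ->. Qed.
Lemma eqZ (k : K) (u v : A) : u = v -> k *: u = k *: v.
Proof. by move=> ->. Qed.
Lemma eqMl (w u v : A) : u = v -> w * u = w * v.
Proof. by move=> ->. Qed.
Lemma eqMr (w u v : A) : u = v -> u * w = v * w.
Proof. by move=> ->. Qed.
End NoncommutativeNormalForm.

Ltac nc_index x l :=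
  lazymatch l with
  | x :: _ => constr:(0%N)
  | _ :: ?l' => let n := nc_index x l' in constr:(n.+1)
  end.
Ltac nc_atom x l :=
  lazymatch l with
  | context [cons x _] => l
  | _ => constr:(x :: l)
  end.
Ltac nc_atoms e l :=
  lazymatch e with
  | (?x + ?y)%R => let l := nc_atoms x l in nc_atoms y l
  | (- ?x)%R => nc_atoms x l
  | (?x * ?y)%R => let l := nc_atoms x l in nc_atoms y l
  | (_ *: ?x)%R => nc_atoms x l
  | 0%R => l
  | 1%R => l
  | _ => nc_atom e l
  end.
Ltac nc_reify K e l :=
  lazymatch e with
  | (?x + ?y)%R =>
      let x := nc_reify K x l in let y := nc_reify K y l in
      constr:(@NCadd K x y)
  | (- ?x)%R => let x := nc_reify K x l in constr:(@NCopp K x)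
  | (?x * ?y)%R =>
      let x := nc_reify K x l in let y := nc_reify K y l in
      constr:(@NCmul K x y)
  | (?k *: ?x)%R => let x := nc_reify K x l in constr:(@NCscale K k x)
  | 0%R => constr:(@NC0 K)
  | 1%R => constr:(@NC1 K)
  | _ => let n := nc_index e l in constr:(@NCvar K n)
  end.
Ltac nc_zero :=
  lazymatch goal with
  | |- @eq ?T ?e _ =>
    lazymatch type of (fun k => k *: e) with
    | ?K -> _ =>
      let l := nc_atoms e (@nil T) in
      let r := nc_reify K e l in
      refine (@nc_identity _ _ l r _);
      cbv [nc_norm nc_add nc_mul nc_mul1 nc_insert nc_word_eqb nc_null
           Nat.eqb andb cat]
    end
  end.
(* Closes u = v from a linear combination H of known equations: (u - v) minus H
   is expanded into words and [field] checks that all coefficients vanish.  The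
   multipliers in H are certificates found by linear algebra. *)
Ltac nc H :=
  refine (eq_of_eq H _); rewrite /lie /anti ?expr2; nc_zero;
  repeat (split; [by field; do ?(apply/andP; split)|]); exact I.

(** * Commutators as derivations *)

Section Derivations.
Variables (K : numFieldType) (A : algType K).
Implicit Types (t u v : A).

Lemma lieD t u v : ⁅t, u + v⁆ = ⁅t, u⁆ + ⁅t, v⁆.
Proof. by rewrite /lie mulrDl mulrDr opprD addrACA. Qed.
Lemma lieZ t k u : ⁅t, k *: u⁆ = k *: ⁅t, u⁆.
Proof. by rewrite /lie -scalerAl -scalerAr scalerBr. Qed.

Fact lie_is_linear t : linear (lie t).
Proof. by move=> k u v; rewrite lieD lieZ. Qed.
HB.instance Definition _ t :=
  GRing.isLinear.Build K A A *:%R (lie t) (lie_is_linear t).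

Lemma lieN t u : ⁅t, - u⁆ = - ⁅t, u⁆. Proof. exact: raddfN. Qed.
Lemma lieB t u v : ⁅t, u - v⁆ = ⁅t, u⁆ - ⁅t, v⁆. Proof. exact: raddfB. Qed.
Lemma lie0 t : ⁅t, 0⁆ = 0. Proof. exact: raddf0. Qed.
Lemma lieC u v : ⁅u, v⁆ = - ⁅v, u⁆. Proof. by rewrite /lie opprB. Qed.
Lemma lie_self u : ⁅u, u⁆ = 0. Proof. exact: subrr. Qed.
Lemma lieM t u v : ⁅t, u * v⁆ = ⁅t, u⁆ * v + u * ⁅t, v⁆.
Proof. by rewrite /lie mulrBl mulrBr !mulrA addrA subrK. Qed.
Lemma lie_lie t u v : ⁅t, ⁅u, v⁆⁆ = ⁅⁅t, u⁆, v⁆ + ⁅u, ⁅t, v⁆⁆.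
Proof. by rewrite {2 4 5}/lie lieB !lieM opprD [- _ - _]addrC addrACA. Qed.
Lemma lie_anti t u v : ⁅t, ⦃u, v⦄⁆ = ⦃⁅t, u⁆, v⦄ + ⦃u, ⁅t, v⁆⦄.
Proof. by rewrite /anti lieD !lieM [⁅t, v⁆ * u + _]addrC addrACA. Qed.
Lemma lie0_comm u v : ⁅u, v⁆ = 0 <-> u * v = v * u.
Proof. by split=> [/eqP|uv]; [rewrite subr_eq0 => /eqP | rewrite /lie uv subrr]. Qed.

Definition lieE t :=
  (lieD t, lieN t, lieB t, lieZ t, lie_lie t, lie_anti t, lieM t).
End Derivations.

(** * Newton power sums acting by polynomials in the shift *)

Section ShiftAction.
Variables (K : numFieldType) (A : algType K).
Implicit Types (f g : {poly K}) (u v : nat -> A).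

Definition shift_act f u : nat -> A :=
  fun s => \sum_(k < size f) f`_k *: u (s + k)%N.

Lemma shift_act_wide f u s n : (size f <= n)%N ->
  shift_act f u s = \sum_(k < n) f`_k *: u (s + k)%N.
Proof.
move=> le_fn; rewrite /shift_act (big_ord_widen _ (fun k => f`_k *: u (s + k)%N) le_fn).
rewrite big_mkcond; apply: eq_bigr => k _; case: ltnP => // le_fk.
by rewrite nth_default // scale0r.
Qed.

Lemma shift_act3 f u s : (size f <= 3)%N ->
  shift_act f u s = f`_2 *: u s.+2 + f`_1 *: u s.+1 + f`_0 *: u s.
Proof.
move=> sf; rewrite (shift_act_wide _ _ sf) !big_ord_recr big_ord0 /= add0r.
by rewrite addn0 addn1 addn2; nc (erefl (0 : A)).
Qed.

Lemma shift_actD f g u s :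
  shift_act (f + g) u s = shift_act f u s + shift_act g u s.
Proof.
pose n := maxn (size (f + g)%R) (maxn (size f) (size g)).
rewrite !(@shift_act_wide _ _ _ n) ?leq_max ?leqnn ?orbT // -big_split.
by apply: eq_bigr => k _; rewrite coefD scalerDl.
Qed.

Lemma shift_actZ a f u s : shift_act (a *: f) u s = a *: shift_act f u s.
Proof.
rewrite (@shift_act_wide _ _ _ (size f)) ?size_scale_leq // scaler_sumr.
by apply: eq_bigr => k _; rewrite coefZ scalerA.
Qed.

Lemma shift_actN f u s : shift_act (- f) u s = - shift_act f u s.
Proof. by rewrite -scaleN1r shift_actZ scaleN1r. Qed.

Lemma shift_actB f g u s :
  shift_act (f - g) u s = shift_act f u s - shift_act g u s.
Proof. by rewrite shift_actD shift_actN. Qed.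

Lemma shift_actMX f u s : shift_act (f * 'X) u s = shift_act f u s.+1.
Proof.
rewrite (@shift_act_wide _ _ _ (size f).+1); last first.
  by apply: leq_trans (size_polyMleq _ _) _; rewrite size_polyX addn2.
rewrite big_ord_recl coefMX scale0r add0r; apply: eq_bigr => k _.
by rewrite coefMX /= addnS.
Qed.

Lemma shift_actC a u s : shift_act a%:P u s = a *: u s.
Proof.
by rewrite (@shift_act_wide _ _ _ 1) ?size_polyC_leq1 // big_ord1 coefC addn0.
Qed.

Lemma shift_act1 u : shift_act 1 u = u.
Proof. by apply/funext => s; rewrite shift_actC scale1r. Qed.

Lemma shift_actX u s : shift_act 'X u s = u s.+1.
Proof. by rewrite -[X in shift_act X]mul1r shift_actMX shift_act1. Qed.

Lemma shift_actM f g u : shift_act (f * g) u = shift_act f (shift_act g u).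
Proof.
elim/poly_ind: f => [|f a IH]; apply/funext => s.
  by rewrite mul0r /shift_act size_poly0 !big_ord0.
rewrite mulrDl !shift_actD mulrAC !shift_actMX IH.
by rewrite mul_polyC shift_actZ shift_actC.
Qed.

Lemma shift_act_comm f g u :
  shift_act f (shift_act g u) = shift_act g (shift_act f u).
Proof. by rewrite -!shift_actM mulrC. Qed.

Lemma shift_act_fZ f a u s :
  shift_act f (fun r => a *: u r) s = a *: shift_act f u s.
Proof.
rewrite scaler_sumr; apply: eq_bigr => k _.
by rewrite !scalerA mulrC.
Qed.

Lemma shift_act_fB f u v s :
  shift_act f (fun r => u r - v r) s = shift_act f u s - shift_act f v s.
Proof. by rewrite /shift_act -sumrB; apply: eq_bigr => k _; rewrite scalerBr. Qed.

Lemma shift_act_fMl f a u s :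
  shift_act f (fun r => a * u r) s = a * shift_act f u s.
Proof. by rewrite mulr_sumr; apply: eq_bigr => k _; rewrite scalerAr. Qed.

Lemma lie_shift_act t f u s :
  ⁅t, shift_act f u s⁆ = shift_act f (fun r => ⁅t, u r⁆) s.
Proof. by rewrite /shift_act raddf_sum; apply: eq_bigr => k _; rewrite -lieZ. Qed.

Lemma shift_act_sum (I : Type) (r : seq I) (P : pred I) (F : I -> nat -> A) f s :
  shift_act f (fun q => \sum_(i <- r | P i) F i q) s
  = \sum_(i <- r | P i) shift_act f (F i) s.
Proof.
rewrite exchange_big; apply: eq_bigr => k _; exact: scaler_sumr.
Qed.
End ShiftAction.

Section PowerSums.
Variable K : numFieldType.
Implicit Types (c d : K).

(* With X the shift, the relations [hb_step c d] below say that G(z) = \sum g_n z^n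
   satisfies
     (1 - (X + c/2) z) (1 + (X + d/2) z) (G(z) y)
       = (1 - (X - c/2) z) (1 + (X - d/2) z) (y G(z)),
   and [psum c d n] is the coefficient of z^n in z times the logarithmic
   derivative of the second quadratic polynomial divided by the first. *)
Definition psum c d n : {poly K} :=
  ('X + (c / 2)%:P) ^+ n + (- 'X - (d / 2)%:P) ^+ n
  - (('X - (c / 2)%:P) ^+ n + (- 'X + (d / 2)%:P) ^+ n).

Lemma psum_comp c d n : psum d c n = - (psum c d n \Po (- 'X)).
Proof.
rewrite /psum !(raddfB, raddfD) /= !rmorphXn /= !(raddfB, raddfD, raddfN) /=.
by rewrite !comp_polyC !comp_polyX !opprK [LHS]addrC; congr (_ + _); exact: addrC.
Qed.

Lemma coef_comp_polyNX (f : {poly K}) k : (f \Po (- 'X))`_k = (-1) ^+ k * f`_k.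
Proof.
elim/poly_ind: f k => [|f a IH] k; first by rewrite comp_poly0 coef0 mulr0.
rewrite comp_polyD comp_polyM comp_polyX comp_polyC !coefD !coefC.
rewrite mulrN coefN !coefMX; case: k => [|k] /=; rewrite ?IH.
  by rewrite expr0 oppr0 mul1r.
by rewrite !addr0 exprS mulN1r mulNr.
Qed.

(** Passing from b_i to b_{tau i} exchanges c and d. By [psum_comp] this is X -> -X with an overall
    sign, the source of the alternating signs in [ybr_psum_action]. *)
Lemma psum_swap c d n k : (psum d c n)`_k = - ((-1) ^+ k * (psum c d n)`_k).
Proof. by rewrite psum_comp coefN coef_comp_polyNX. Qed.

Lemma XaddC_exp a n : exists2 r : {poly K}, (size r <= n)%N &
  ('X + a%:P) ^+ n.+1 = 'X^(n.+1) + (n.+1%:R * a) *: 'X^n + r.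
Proof.
elim: n => [|n [r sr IH]].
  exists 0; rewrite ?size_poly0 // !expr1 expr0 mul1r addr0.
  by rewrite -mul_polyC mulr1.
exists (r * 'X + (n.+1%:R * a ^+ 2) *: 'X^n + a *: r).
  apply: leq_trans (size_polyD _ _) _; rewrite geq_max; apply/andP; split.
    apply: leq_trans (size_polyD _ _) _; rewrite geq_max; apply/andP; split.
      by apply: leq_trans (size_polyMleq _ _) _; rewrite size_polyX addn2.
    by apply: leq_trans (size_scale_leq _ _) _; rewrite size_polyXn.
  by apply: leq_trans (size_scale_leq _ _) _; apply: leq_trans sr _.
have -> : n.+2%:R = 1 + n.+1%:R :> K by rewrite -(natrD _ 1).
move: IH; set m := n.+1%:R => IH.
by rewrite exprS IH -!mul_polyC !polyCM !polyCD polyC1 !exprS; ring.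
Qed.

Lemma psum_half c n : exists2 r : {poly K}, (size r <= n)%N &
  ('X + (c / 2)%:P) ^+ n.+1 - ('X - (c / 2)%:P) ^+ n.+1
  = (n.+1%:R * c) *: 'X^n + r.
Proof.
have [r1 s1 E1] := XaddC_exp (c / 2) n; have [r2 s2 E2] := XaddC_exp (- (c / 2)) n.
exists (r1 - r2).
  by apply: leq_trans (size_polyD _ _) _; rewrite size_polyN geq_max s1.
rewrite -[- (c / 2)%:P]polyCN E1 E2.
have -> : n.+1%:R * c = n.+1%:R * (c / 2) - n.+1%:R * (- (c / 2)) by field.
by rewrite scalerBl; ring.
Qed.

(** The top powers of X cancel between the two terms with c and between the two terms with d, so the
    degree drops by one. The sign comes from the factors -X in the terms with d; for c = d and an
    odd index the leading coefficient is therefore zero. *)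
Lemma psumS c d n : exists2 r : {poly K}, (size r <= n)%N &
  psum c d n.+1 = (n.+1%:R * (c + (-1) ^+ n.+1 * d)) *: 'X^n + r.
Proof.
have [r1 s1 E1] := psum_half c n; have [r2 s2 E2] := psum_half d n.
exists (r1 + (-1) ^+ n.+1 *: r2).
  apply: leq_trans (size_polyD _ _) _; rewrite geq_max s1.
  exact: leq_trans (size_scale_leq _ _) _.
have -> : psum c d n.+1 =
  (('X + (c / 2)%:P) ^+ n.+1 - ('X - (c / 2)%:P) ^+ n.+1)
  + (-1) ^+ n.+1 *: (('X + (d / 2)%:P) ^+ n.+1 - ('X - (d / 2)%:P) ^+ n.+1).
  rewrite /psum -opprD (_ : - 'X + (d / 2)%:P = - ('X - (d / 2)%:P)); last first.
    by rewrite opprB addrC.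
  rewrite -mul_polyC rmorphXn /= polyCN polyC1.
  rewrite (exprNn ('X + (d / 2)%:P)) (exprNn ('X - (d / 2)%:P)).
  by rewrite opprD addrACA mulrBr.
rewrite E1 E2 scalerDr scalerA mulrDr scalerDl.
have -> : n.+1%:R * ((-1) ^+ n.+1 * d) = (-1) ^+ n.+1 * (n.+1%:R * d) by ring.
by ring.
Qed.

Lemma size_psum c d n : (size (psum c d n) <= n)%N.
Proof.
case: n => [|n]; first by rewrite /psum !expr0 subrr size_poly0.
have [r sr ->] := psumS c d n; apply: leq_trans (size_polyD _ _) _.
rewrite geq_max (leq_trans sr) // andbT.
by apply: leq_trans (size_scale_leq _ _) _; rewrite size_polyXn.
Qed.

Lemma psum_lead c d n :
  (psum c d n.+1)`_n = n.+1%:R * (c + (-1) ^+ n.+1 * d).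
Proof.
have [r sr ->] := psumS c d n.
by rewrite coefD coefZ coefXn eqxx mulr1 (nth_default _ sr) addr0.
Qed.
End PowerSums.

(** * Newton's identities without commutativity *)

Section Newton.
Variables (K : numFieldType) (A : algType K).
Implicit Types (g p : nat -> A).

(** The coefficients of z G'(z) = P(z) G(z). The side on which p stands matters, since the g's are
    not yet known to commute. *)
Definition newton g p := p 0%N = 0 /\
  forall n, n%:R *: g n = \sum_(k < n.+1) p k * g (n - k)%N.

(** Each value depends on all earlier ones, so the recursion carries the whole prefix. *)
Fixpoint newton_seq g n : seq A :=
  if n is m.+1 then
    let s := newton_seq g m in
    rcons s (m%:R *: g m - \sum_(k < m) s`_k * g (m - k)%N)
  else [::].

Lemma newton_exists g : g 0%N = 1 -> exists p, newton g p.
Proof.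
move=> g0; have sz n : size (newton_seq g n) = n.
  by elim: n => //= n IH; rewrite size_rcons IH.
have st m n : (n < m)%N -> (newton_seq g m)`_n = (newton_seq g n.+1)`_n.
  elim: m => // m IH; rewrite ltnS leq_eqVlt => /predU1P[->//|nm].
  by rewrite /= nth_rcons sz nm IH.
exists (fun n => (newton_seq g n.+1)`_n); split=> [|n].
  by rewrite /= big_ord0 scale0r subrr.
rewrite big_ord_recr /= subnn g0 mulr1 nth_rcons sz ltnn eqxx.
rewrite [X in X + _](eq_bigr (fun k : 'I_n => (newton_seq g n)`_k * g (n - k)%N)).
  by rewrite addrC subrK.
by move=> k _; rewrite -[LHS]/((newton_seq g k.+1)`_k * _) -(st n).
Qed.

Lemma newtonE g p n : g 0%N = 1 -> newton g p ->
  p n = n%:R *: g n - \sum_(k < n) p k * g (n - k)%N.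
Proof.
by move=> g0 [_ ->]; rewrite big_ord_recr /= subnn g0 mulr1 addrAC subrr add0r.
Qed.

(** Up to n g_n, the element p_n is a sum of products of terms of lower index, all of which commute
    with z by induction; the summand k = 0 is absent because p_0 = 0. *)
Lemma newton_comm g p n z : g 0%N = 1 -> newton g p ->
  (forall m, (m < n)%N -> ⁅z, g m⁆ = 0) -> ⁅z, p n⁆ = n%:R *: ⁅z, g n⁆.
Proof.
move=> g0 gp; elim/ltn_ind: n => n IH zg.
rewrite (newtonE n g0 gp) lieB lieZ raddf_sum big1 ?subr0 // => k _ /=.
rewrite lieM IH // => [|m mk]; last by apply: zg; apply: ltn_trans mk _.
rewrite (zg k) // scaler0 mul0r add0r.
case: (posnP k) => [k0|k_gt0]; first by rewrite k0 gp.1 mul0r.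
by rewrite zg ?mulr0 //; have := ltn_ord k; lia.
Qed.
End Newton.

(** * The action of the power sums on the b's *)

Section Primitive.
Variables (K : numFieldType) (A : algType K).
Local Notation mseq := (nat -> nat -> A).

(* Coefficients of (1 - d z - q z^2) G(z), where q acts through the shift of the
   second index. *)
Definition quad_mul (d : K) (q : {poly K}) (G : mseq) : mseq := fun n s =>
  match n with
  | 0%N => G 0%N s
  | 1%N => G 1%N s - d *: G 0%N s
  | m.+2 => G m.+2 s - d *: G m.+1 s - shift_act q (G m) s
  end.

(** Multiplying by the series with coefficients [F k] commutes with multiplying by 1 - d z - q z^2,
    because the maps [F k] are linear and hence commute with the shift. It is applied to left and
    right multiplication by the p's. *)
Lemma quad_mul_conv d q (F : nat -> A -> A) G n s :
  (forall k u v, F k (u + v) = F k u + F k v) ->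
  (forall k a u, F k (a *: u) = a *: F k u) ->
  \sum_(k < n.+1) F k (quad_mul d q G (n - k)%N s)
  = quad_mul d q (fun m r => \sum_(k < m.+1) F k (G (m - k)%N r)) n s.
Proof.
move=> FD FZ; have FB k u v : F k (u - v) = F k u - F k v.
  by rewrite -scaleN1r FD FZ scaleN1r.
case: n => [|[|n]] /=; first by rewrite !big_ord1.
  by rewrite !big_ord_recr !big_ord0 /= !add0r FB FZ addrAC.
have lin k u r : F k (shift_act q u r) = shift_act q (fun m => F k (u m)) r.
  have F0 : F k 0 = 0 by rewrite -[X in F k X](scale0r (0 : A)) FZ scale0r.
  rewrite /shift_act (big_morph (F k) (FD k) F0).
  by apply: eq_bigr => i _; rewrite FZ.
rewrite shift_act_sum scaler_sumr !(big_ord_recr n.+2) !(big_ord_recr n.+1) /=.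
rewrite !subnn /= (_ : n.+2 - n.+1 = 1)%N; last by lia.
rewrite FB FZ.
set S1 := \sum_(i < n.+1) F i (quad_mul _ _ _ _ _).
have -> : S1 = \sum_(i < n.+1) F i (G (n.+2 - i)%N s)
   - \sum_(i < n.+1) d *: F i (G (n.+1 - i)%N s)
   - \sum_(i < n.+1) shift_act q (fun r => F i (G (n - i)%N r)) s.
  rewrite -!sumrB; apply: eq_bigr => k _; have lk := ltn_ord k.
  rewrite (_ : n.+2 - k = (n - k).+2)%N; last by lia.
  rewrite (_ : n.+1 - k = (n - k).+1)%N; last by lia.
  by rewrite /= !FB FZ lin.
set a := \sum_(i < n.+1) _; set b := \sum_(i < n.+1) _; set e := \sum_(i < n.+1) _.
set x := F n.+1 _; set y := d *: _; set z := F n.+2 _.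
by rewrite opprD; nc (erefl (0 : A)).
Qed.

(** The hypotheses say 1 - d z - q z^2 = (1 - al z)(1 - be z). Multiplying by the geometric series
    of al z leaves (1 - be z) G(z). *)
Lemma quad_mul_geom d q (al be : {poly K}) (G : mseq) n s :
  al + be = d%:P -> al * be = - q ->
  \sum_(k < n.+1) shift_act (al ^+ k) (quad_mul d q G (n - k)%N) s
  = G n s - (if n is m.+1 then shift_act be (G m) s else 0).
Proof.
move=> sum_ab prod_ab; elim: n s => [|n IH] s.
  by rewrite big_ord1 expr0 shift_act1 subr0.
rewrite big_ord_recl expr0 shift_act1 subn0.
have -> : \sum_(i < n.+1) shift_act (al ^+ lift ord0 i)
            (quad_mul d q G (n.+1 - lift ord0 i)%N) s
   = shift_act al (fun r => \sum_(k < n.+1)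
                      shift_act (al ^+ k) (quad_mul d q G (n - k)%N) r) s.
  rewrite shift_act_sum; apply: eq_bigr => k _.
  by rewrite /= /bump /= add1n subSS exprS shift_actM.
rewrite (_ : (fun r => _) = fun r => G n r
            - (if n is m.+1 then shift_act be (G m) r else 0)); last first.
  by apply/funext => r; rewrite IH.
have dE u r : d *: u r = shift_act al u r + shift_act be u r.
  by rewrite -shift_actD sum_ab shift_actC.
have -> : shift_act al (fun r => G n r
     - (if n is m.+1 then shift_act be (G m) r else 0)) s
   = shift_act al (G n) s
     - (if n is m.+1 then shift_act al (shift_act be (G m)) s else 0).
  case: n {IH} => [|n]; last exact: shift_act_fB.
  by rewrite subr0; congr (shift_act _ _ _); apply/funext => r; rewrite subr0.
case: n {IH} => [|n] /=.
  by rewrite dE subr0 opprD addrA addrAC subrK.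
rewrite dE -shift_actM prod_ab shift_actN opprK.
nc (erefl (0 : A)).
Qed.

Variables (c d : K) (N : nat) (g p y : nat -> A).

(* With g 0 = 1 and g r.+1 = h_r, the relations between h_1 and the b's are the
   case n = 0 of those between h_{n+1}, h_{n-1} and the b's. *)
Definition hb_step n := forall s,
  ⁅g n.+2, y s⁆ - ⁅g n, y s.+2⁆ =
  ((c - d) / 2%:R) *: ⦃g n.+1, y s⦄ + ((c + d) / 2%:R) *: ⦃g n, y s.+1⦄
  + ((c * d) / 4%:R) *: ⁅g n, y s⁆.

Hypothesis g0 : g 0%N = 1.
Hypothesis gp : newton g p.
Hypothesis gC : forall a b, (a + b <= N)%N -> ⁅g a, g b⁆ = 0.
Hypothesis gy1 : (0 < N)%N -> forall s, ⁅g 1%N, y s⁆ = (c - d) *: y s.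
Hypothesis gy : forall n, (n.+2 <= N)%N -> hb_step n.

Let q : {poly K} := ('X + (c / 2)%:P) * ('X + (d / 2)%:P).
Let q' : {poly K} := ('X - (c / 2)%:P) * ('X - (d / 2)%:P).
Let GL : mseq := fun n s => g n * y s.
Let GR : mseq := fun n s => y s * g n.
Let dl : K := (c - d) / 2%:R.

Let q_act (u : nat -> A) s : shift_act q u s =
  u s.+2 + ((c + d) / 2%:R) *: u s.+1 + ((c * d) / 4%:R) *: u s.
Proof.
have -> : q = 'X * 'X + ((c + d) / 2) *: 'X + ((c * d) / 4)%:P.
  rewrite /q -mul_polyC (_ : (c + d) / 2 = c / 2 + d / 2); last by field.
  rewrite (_ : (c * d) / 4 = (c / 2) * (d / 2)); last by field.
  by rewrite polyCD polyCM; ring.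
by rewrite !shift_actD shift_actZ shift_actM !shift_actX shift_actC.
Qed.

Let q'_act (u : nat -> A) s : shift_act q' u s =
  u s.+2 - ((c + d) / 2%:R) *: u s.+1 + ((c * d) / 4%:R) *: u s.
Proof.
have -> : q' = 'X * 'X - ((c + d) / 2) *: 'X + ((c * d) / 4)%:P.
  rewrite /q' -mul_polyC (_ : (c + d) / 2 = c / 2 + d / 2); last by field.
  rewrite (_ : (c * d) / 4 = (c / 2) * (d / 2)); last by field.
  by rewrite polyCD polyCM; ring.
by rewrite !shift_actD shift_actN shift_actZ shift_actM !shift_actX shift_actC.
Qed.

Let quad_LR n s : (n <= N)%N -> quad_mul dl q GL n s = quad_mul (- dl) q' GR n s.
Proof.
case: n => [|[|n]] nN /=.
- by rewrite /GL /GR g0 mulr1 mul1r.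
- have := gy1 nN s; rewrite /GL /GR g0 /dl => E.
  by nc E.
- have E := gy nN s; rewrite q_act q'_act /GL /GR /dl.
  by nc E.
Qed.

(** A logarithmic derivative: G acts on y by a ratio of two quadratics in z, so P acts by the
    difference of their logarithmic derivatives. Let U = V be the two sides of the quadratic
    relation. The sum over k of [p_k, U_{n-k}] and the sum of the predicted values are computed
    independently; they agree, their terms with k < n agree by induction, and the term k = n is the
    claim because U_0 = y. *)
Lemma newton_action n s : (n <= N)%N -> ⁅p n, y s⁆ = shift_act (psum c d n) y s.
Proof.
elim/ltn_ind: n s => n IH s nN.
have pg k m : (k + m <= N)%N -> ⁅g m, p k⁆ = 0.
  move=> kmN; rewrite (newton_comm g0 gp); first by rewrite gC ?scaler0 //; lia.
  by move=> j jk; rewrite gC //; lia.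
have actG k j r : (k < n)%N -> (k + j <= N)%N ->
    ⁅p k, GL j r⁆ = shift_act (psum c d k) (GL j) r.
  move=> kn kjN; rewrite lieM lieC pg // oppr0 mul0r add0r IH //; last by lia.
  by rewrite -shift_act_fMl.
pose U := quad_mul dl q GL; pose V := quad_mul (- dl) q' GR.
have actU k j : (k < n)%N -> (k + j <= N)%N ->
    ⁅p k, U j s⁆ = shift_act (psum c d k) (U j) s.
  move=> kn; rewrite /U; case: j => [|[|j]] kjN /=.
  - exact: actG.
  - rewrite lieB lieZ !actG //; last by lia.
    by rewrite -shift_act_fZ -shift_act_fB.
  - rewrite !lieB lieZ !actG //; try lia.
    have -> : ⁅p k, shift_act q (GL j) s⁆ =
              shift_act (psum c d k) (shift_act q (GL j)) s.
      rewrite shift_act_comm lie_shift_act.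
      by congr (shift_act _ _ _); apply/funext => r; rewrite actG //; lia.
    by rewrite -shift_act_fZ -!shift_act_fB.
have UV j r : (j <= N)%N -> U j r = V j r by exact: quad_LR.
(* U is used for the products p U and V for the products U p. Moving p past the g's, which is
   allowed up to degree N, makes Newton's identity apply on both sides. *)
have lieS : \sum_(k < n.+1) ⁅p k, U (n - k)%N s⁆ =
   quad_mul dl q (fun m r => m%:R *: GL m r) n s
   - quad_mul (- dl) q' (fun m r => m%:R *: GR m r) n s.
  rewrite [RHS](_ : _ =
    quad_mul dl q (fun m r => \sum_(k < m.+1) p k * GL (m - k)%N r) n s
    - quad_mul (- dl) q' (fun m r => \sum_(k < m.+1) GR (m - k)%N r * p k) n s).
    rewrite -(@quad_mul_conv dl q (fun k u => p k * u)); first last.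
    - by move=> *; rewrite scalerAr.
    - by move=> *; rewrite mulrDr.
    rewrite -(@quad_mul_conv (- dl) q' (fun k u => u * p k)); first last.
    - by move=> *; rewrite scalerAl.
    - by move=> *; rewrite mulrDl.
    rewrite -sumrB; apply: eq_bigr => k _.
    by rewrite -[quad_mul (- dl) _ _]/V -UV //; lia.
  have newtL m r : m%:R *: GL m r = \sum_(k < m.+1) p k * GL (m - k)%N r.
    rewrite /GL scalerAl gp.2 mulr_suml.
    by apply: eq_bigr => k _; rewrite mulrA.
  have newtR m r : (m <= n)%N ->
      m%:R *: GR m r = \sum_(k < m.+1) GR (m - k)%N r * p k.
    move=> mn; rewrite /GR scalerAr gp.2 mulr_sumr; apply: eq_bigr => k _.
    rewrite -mulrA; congr (_ * _); apply/esym/lie0_comm/pg.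
    by have := ltn_ord k; lia.
  congr (_ - _).
    by congr (quad_mul _ _ _ _ _); apply/funext => m; apply/funext => r.
  case: n {IH actG actU} nN newtR => [|[|n]] nN newtR /=; rewrite !newtR //.
  congr (_ - _ - shift_act _ _ _); apply/funext => r; apply: newtR; lia.
have alE : ('X + (c / 2)%:P) + (- 'X - (d / 2)%:P) = dl%:P.
  rewrite /dl (_ : (c - d) / 2 = c / 2 - d / 2); last by field.
  by rewrite polyCB; ring.
have beE : ('X - (c / 2)%:P) + (- 'X + (d / 2)%:P) = (- dl)%:P.
  rewrite /dl (_ : - ((c - d) / 2) = d / 2 - c / 2); last by field.
  by rewrite polyCB; ring.
(* [psum] splits into four geometric series, one for each root of the two quadratics; each leaves
   the complementary linear factor. *)
have actS : \sum_(k < n.+1) shift_act (psum c d k) (U (n - k)%N) s =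
   (GL n s + GL n s - (if n is m.+1 then dl *: GL m s else 0))
   - (GR n s + GR n s - (if n is m.+1 then (- dl) *: GR m s else 0)).
  have -> : \sum_(k < n.+1) shift_act (psum c d k) (U (n - k)%N) s =
    (\sum_(k < n.+1) shift_act (('X + (c / 2)%:P) ^+ k) (U (n - k)%N) s
     + \sum_(k < n.+1) shift_act ((- 'X - (d / 2)%:P) ^+ k) (U (n - k)%N) s)
   - (\sum_(k < n.+1) shift_act (('X - (c / 2)%:P) ^+ k) (V (n - k)%N) s
     + \sum_(k < n.+1) shift_act ((- 'X + (d / 2)%:P) ^+ k) (V (n - k)%N) s).
    rewrite -!big_split -sumrB; apply: eq_bigr => k _ /=.
    rewrite (_ : V (n - k)%N = U (n - k)%N).
      by rewrite /psum !(shift_actB, shift_actD).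
    by apply/funext => r; rewrite UV //; lia.
  rewrite /U /V (@quad_mul_geom dl q _ _ _ _ _ alE); last by rewrite /q; ring.
  rewrite (@quad_mul_geom (- dl) q' _ _ _ _ _ beE); last by rewrite /q'; ring.
  rewrite (@quad_mul_geom dl q (- 'X - (d / 2)%:P) ('X + (c / 2)%:P)); first last.
  - by rewrite /q; ring.
  - by rewrite addrC alE.
  rewrite (@quad_mul_geom (- dl) q' (- 'X + (d / 2)%:P) ('X - (c / 2)%:P)); first last.
  - by rewrite /q'; ring.
  - by rewrite addrC beE.
  have E1 (u : nat -> A) r : shift_act ('X + (c / 2)%:P) u r
      + shift_act (- 'X - (d / 2)%:P) u r = dl *: u r.
    by rewrite -shift_actD alE shift_actC.
  have E2 (u : nat -> A) r : shift_act ('X - (c / 2)%:P) u r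
      + shift_act (- 'X + (d / 2)%:P) u r = (- dl) *: u r.
    by rewrite -shift_actD beE shift_actC.
  case: (n) => [|m]; first by rewrite !subr0.
  by nc (eqD (eqZ (-1) (E1 (GL m) s)) (E2 (GR m) s)).
have UVn := UV n s nN; rewrite /U /V in UVn.
have y0 : U 0%N = y.
  by apply/funext => r; rewrite /U /= /GL g0 mul1r.
rewrite big_ord_recr subnn y0 in lieS.
rewrite big_ord_recr subnn y0 in actS.
have eqS : \sum_(k < n) shift_act (psum c d k) (U (n - k)%N) s
         = \sum_(k < n) ⁅p k, U (n - k)%N s⁆.
  by apply: eq_bigr => k _; rewrite actU //; have := ltn_ord k; lia.
rewrite {}eqS in actS; move: (\sum_(k < n) _) lieS actS => Z.
(* The weights n, n-1, n-2 in [lieS] minus the weights 2, 1, 0 in [actS] leave n - 2 times the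
   relation U_n = V_n: hence the multipliers -2, -1 and m. *)
case: (n) UVn => [|[|m]] UVn; rewrite /= in UVn *; rewrite ?shift_act_fZ => lieS actS.
- by nc (eqD (eqD lieS (eqZ (-1) actS)) (eqZ (-2) UVn)).
- by nc (eqD (eqD lieS (eqZ (-1) actS)) (eqZ (-1) UVn)).
- by nc (eqD (eqD lieS (eqZ (-1) actS)) (eqZ m%:R UVn)).
Qed.
End Primitive.

(** * Relations inside one orbit *)

Section YangianBracket.
Variables (K : numFieldType) (A : algType K).
Implicit Types (x w y g : nat -> A).

Definition ybr (k : K) w x r s : A :=
  ⁅w r.+1, x s⁆ - ⁅w r, x s.+1⁆ - k *: ⦃w r, x s⦄.

Lemma ybr_sym k x w r s : ybr k x w s r = ybr k w x r s.
Proof. rewrite /ybr; nc (erefl (0 : A)). Qed.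

Lemma lie_ybr_shift k t l m w x r s :
  (forall r, ⁅t, w r⁆ = l *: w r.+1) -> (forall r, ⁅t, x r⁆ = m *: x r.+1) ->
  ⁅t, ybr k w x r s⁆ = l *: ybr k w x r.+1 s + m *: ybr k w x r s.+1.
Proof.
move=> tw tx; rewrite /ybr !(lieE t) !tw !tx; nc (erefl (0 : A)).
Qed.

Lemma lie_ybr0 u k w x r s :
  (forall r, ⁅u, w r⁆ = 0) -> (forall r, ⁅u, x r⁆ = 0) -> ⁅u, ybr k w x r s⁆ = 0.
Proof. by move=> uw ux; rewrite /ybr !(lieE u) !uw !ux; nc (erefl (0 : A)). Qed.

Lemma ybr_action k p (f f' : {poly K}) n w x r s :
  (size f <= n)%N -> (size f' <= n)%N ->
  (forall s, ⁅p, x s⁆ = shift_act f x s) ->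
  (forall s, ⁅p, w s⁆ = shift_act f' w s) ->
  ⁅p, ybr k w x r s⁆ =
  \sum_(j < n) (f`_j *: ybr k w x r (s + j)%N + f'`_j *: ybr k w x (r + j)%N s).
Proof.
move=> sf sf' px pw.
have wx a b : ⁅p, w a * x b⁆ =
    \sum_(j < n) (f`_j *: (w a * x (b + j)%N) + f'`_j *: (w (a + j)%N * x b)).
  rewrite lieM px pw (shift_act_wide _ _ sf) (shift_act_wide _ _ sf').
  rewrite mulr_suml mulr_sumr -big_split; apply: eq_bigr => j _ /=.
  by nc (erefl (0 : A)).
have xw a b : ⁅p, x b * w a⁆ =
    \sum_(j < n) (f`_j *: (x (b + j)%N * w a) + f'`_j *: (x b * w (a + j)%N)).
  rewrite lieM px pw (shift_act_wide _ _ sf) (shift_act_wide _ _ sf').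
  rewrite mulr_suml mulr_sumr -big_split; apply: eq_bigr => j _ /=.
  by nc (erefl (0 : A)).
rewrite (_ : ybr k w x r s = w r.+1 * x s - x s * w r.+1
  - (w r * x s.+1 - x s.+1 * w r) - k *: (w r * x s + x s * w r)) //.
rewrite !(lieB, lieZ, lieD) !(wx, xw).
rewrite scalerDr !scaler_sumr -!sumrB -big_split -sumrB; apply: eq_bigr => j _ /=.
by rewrite /ybr !addSn; nc (erefl (0 : A)).
Qed.

Lemma ybr_psum_action k p c d n w x r s :
  (forall s, ⁅p, x s⁆ = shift_act (psum c d n) x s) ->
  (forall s, ⁅p, w s⁆ = shift_act (psum d c n) w s) ->
  ⁅p, ybr k w x r s⁆ = \sum_(j < n) (psum c d n)`_j *:
    (ybr k w x r (s + j)%N - (-1) ^+ j *: ybr k w x (r + j)%N s).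
Proof.
move=> px pw; rewrite (ybr_action _ _ _ (size_psum c d n) (size_psum d c n) px pw).
by apply: eq_bigr => j _; rewrite (psum_swap c d); nc (erefl (0 : A)).
Qed.
End YangianBracket.

(** * Propagation of the relations inside one orbit *)

Section RankOneData.
Variables (K : numFieldType) (A : algType K) (d : K) (x w g : nat -> A) (t : A).

(** The orbit of a vertex i with x = b_i, w = b_{tau i} and d = c_{i,tau i}. The field [ro_X0] holds
    by construction, as it is the relation that defines g_{n+2}; w = x is allowed. *)
Record rank_one_data := RankOneData {
  ro_g0 : g 0%N = 1;
  ro_g1x : forall s, ⁅g 1%N, x s⁆ = (2%:R - d) *: x s;
  ro_g1w : forall s, ⁅g 1%N, w s⁆ = (d - 2%:R) *: w s;
  ro_t : t = g 2%N - 2%:R^-1 *: (g 1%N * g 1%N);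
  ro_tx : forall s, ⁅t, x s⁆ = (2%:R + d) *: x s.+1;
  ro_tw : forall s, ⁅t, w s⁆ = (2%:R + d) *: w s.+1;
  ro_X0 : forall n,
    ybr (d / 2%:R) w x 0 n + (2%:R * (-1) ^+ 0) *: g (0 + n)%N.+2 = 0;
  ro_d2 : 2%:R + d != 0
}.
End RankOneData.

Section RankOne.
Variables (K : numFieldType) (A : algType K).
Variables (d : K) (x w g : nat -> A) (t : A).
Let kp : K := d / 2%:R.
Let X r s := ybr kp w x r s + (2%:R * (-1) ^+ r) *: g (r + s).+2.

(* Commuting w through both letters of the relations between two x's: only the
   h-terms coming from X survive. *)
Lemma cyclic_identity r (e0 e1 : A) :
  (forall a j, (a < 2)%N -> (j < 2)%N -> X (r + a) j = 0) ->
  ybr 1 x x 0 0 = e0 -> ybr 1 x x 1 0 = 0 -> ybr 1 x x 1 1 = e1 ->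
  (4%:R * (-1) ^+ r) *:
    (⁅g r.+4, x 0%N⁆ - ⁅g r.+2, x 2%N⁆ - ((2%:R - d) / 2%:R) *: ⦃g r.+3, x 0%N⦄
     - ((2%:R + d) / 2%:R) *: ⦃g r.+2, x 1%N⦄
     - ((2%:R * d) / 4%:R) *: ⁅g r.+2, x 0%N⁆)
  = ⁅w r.+2, e0⁆ - d *: ⦃w r.+1, e0⦄ + ⁅w r, e1⁆ + (d ^+ 2 / 4%:R) *: ⁅w r, e0⁆.
Proof.
move=> Xr XX00 XX10 XX11; have XX01 := XX10; rewrite ybr_sym in XX01.
have XR00 := Xr 0%N 0%N isT isT; have XR01 := Xr 0%N 1%N isT isT.
have XR10 := Xr 1%N 0%N isT isT; have XR11 := Xr 1%N 1%N isT isT.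
rewrite /X /ybr /kp in XX00 XX01 XX10 XX11 XR00 XR01 XR10 XR11 *.
rewrite ?addn1 ?addn0 ?addn1 ?exprS in XR00 XR01 XR10 XR11.
nc (eqD ((eqD ((eqD ((eqD ((eqD (eqZ (1) (eqMl (w r.+2) XX00))
 ((eqD (eqZ (-1) (eqMl (w r.+1) XX01))
 (eqZ (-2 * (d / 2)) (eqMl (w r.+1) XX00))))))
 ((eqD (eqZ (-1) (eqMl (w r.+1) XX10))
 ((eqD (eqZ (1) (eqMl (w r) XX11))
 (eqZ (1 * (d / 2)) (eqMl (w r) XX10))))))))
 ((eqD ((eqD (eqZ (1 * (d / 2)) (eqMl (w r) XX01))
 ((eqD (eqZ (1 * (d / 2) ^+ 2) (eqMl (w r) XX00))
 (eqZ (1) (eqMr (x 1%N) XR10))))))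
 ((eqD (eqZ (-1) (eqMr (x 0%N) XR11))
 ((eqD (eqZ (1) (eqMr (x 0%N) XR10))
 (eqZ (-1) (eqMr (x 2%N) XR00))))))))))
 ((eqD ((eqD ((eqD (eqZ (1) (eqMr (x 1%N) XR01))
 ((eqD (eqZ (-1 - 1 * (d / 2)) (eqMr (x 1%N) XR00))
 (eqZ (1 * (d / 2)) (eqMr (x 0%N) XR01))))))
 ((eqD (eqZ (-1 * (d / 2)) (eqMr (x 0%N) XR00))
 ((eqD (eqZ (-1) (eqMl (x 1%N) XR10))
 (eqZ (1) (eqMl (x 0%N) XR11))))))))
 ((eqD ((eqD (eqZ (1) (eqMl (x 0%N) XR10))
 ((eqD (eqZ (1) (eqMl (x 2%N) XR00))
 (eqZ (-1) (eqMl (x 1%N) XR01))))))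
 ((eqD (eqZ (-1 - 1 * (d / 2)) (eqMl (x 1%N) XR00))
 ((eqD (eqZ (1 * (d / 2)) (eqMl (x 0%N) XR01))
 (eqZ (1 * (d / 2)) (eqMl (x 0%N) XR00))))))))))))
 ((eqD ((eqD ((eqD ((eqD (eqZ (-1) (eqMr (w r.+2) XX00))
 ((eqD (eqZ (1) (eqMr (w r.+1) XX01))
 (eqZ (-2 * (d / 2)) (eqMr (w r.+1) XX00))))))
 ((eqD (eqZ (1) (eqMr (w r.+1) XX10))
 ((eqD (eqZ (-1) (eqMr (w r) XX11))
 (eqZ (1 * (d / 2)) (eqMr (w r) XX10))))))))
 ((eqD ((eqD (eqZ (1 * (d / 2)) (eqMr (w r) XX01))
 ((eqD (eqZ (-1 * (d / 2) ^+ 2) (eqMr (w r) XX00))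
 (eqZ (- (1)) (eqMr (x 0%N) XR11))))))
 ((eqD (eqZ (- (-1)) (eqMr (x 1%N) XR10))
 ((eqD (eqZ (- (-1)) (eqMr (x 0%N) XR10))
 (eqZ (- (-1)) (eqMr (x 1%N) XR01))))))))))
 ((eqD ((eqD ((eqD (eqZ (- (1)) (eqMr (x 2%N) XR00))
 ((eqD (eqZ (- (1 + 1 * (d / 2))) (eqMr (x 1%N) XR00))
 (eqZ (- (-1 * (d / 2))) (eqMr (x 0%N) XR01))))))
 ((eqD (eqZ (- (1 * (d / 2))) (eqMr (x 0%N) XR00))
 ((eqD (eqZ (1) (eqMl (x 0%N) XR11))
 (eqZ (-1) (eqMl (x 1%N) XR10))))))))
 ((eqD ((eqD (eqZ (1) (eqMl (x 0%N) XR10))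
 ((eqD (eqZ (-1) (eqMl (x 1%N) XR01))
 (eqZ (1) (eqMl (x 2%N) XR00))))))
 ((eqD (eqZ (-1 - 1 * (d / 2)) (eqMl (x 1%N) XR00))
 ((eqD (eqZ (1 * (d / 2)) (eqMl (x 0%N) XR01))
 (eqZ (1 * (d / 2)) (eqMl (x 0%N) XR00))))))))))))).
Qed.

Lemma hb_step_shift n : 2%:R + d != 0 ->
  (forall s, ⁅t, x s⁆ = (2%:R + d) *: x s.+1) ->
  (forall m, (n <= m <= n.+2)%N -> ⁅t, g m⁆ = 0) ->
  (⁅g n.+2, x 0%N⁆ - ⁅g n, x 2%N⁆ - ((2%:R - d) / 2%:R) *: ⦃g n.+1, x 0%N⦄
     - ((2%:R + d) / 2%:R) *: ⦃g n, x 1%N⦄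
     - ((2%:R * d) / 4%:R) *: ⁅g n, x 0%N⁆) = 0 -> hb_step 2%:R d g x n.
Proof.
move=> d2 tx tg E0 s; apply/eqP; rewrite -subr_eq0; apply/eqP.
elim: s => [|s IH]; first by nc E0.
have E := congr1 (lie t) IH.
rewrite lie0 !(lieE t) !tx !tg ?leqnn ?leqnSn // in E; try lia.
nc (eqZ (2%:R + d)^-1 E).
Qed.

Hypothesis D : rank_one_data d x w g t.
Let g0 := ro_g0 D.
Let g1x := ro_g1x D.
Let g1w := ro_g1w D.
Let tE := ro_t D.
Let tx := ro_tx D.
Let tw := ro_tw D.
Let X0 n : X 0 n = 0 := ro_X0 D n.
Let d2 := ro_d2 D.

Definition bb_upto N := forall r s, (r + s < N)%N -> X r s = 0.
Definition hh_upto N := forall a b, (a + b <= N)%N -> ⁅g a, g b⁆ = 0.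
Definition hb_upto N := forall n, (n.+2 <= N)%N ->
  hb_step 2%:R d g x n /\ hb_step d 2%:R g w n.

(** g_1 acts on x and w by opposite scalars, so it commutes with every product of one x and one w,
    in particular with the expression of g_{n+2} in [ro_X0]. *)
Lemma lie_g1 n : ⁅g 1%N, g n⁆ = 0.
Proof.
case: n => [|[|n]]; [by rewrite g0 /lie mulr1 mul1r subrr | exact: lie_self |].
have E := congr1 (lie (g 1%N)) (X0 n).
rewrite /X /ybr !(lieE (g 1%N)) lie0 !g1x !g1w in E.
by rewrite add0n expr0 in E; nc (eqZ (1 / 2%:R) E).
Qed.

Lemma lie_t_g n : ⁅t, g n⁆ = ⁅g 2%N, g n⁆.
Proof. rewrite tE; nc (eqD (eqZ (- (1 / 2%:R)) (eqMl (g 1%N) (lie_g1 n)))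
  (eqZ (- (1 / 2%:R)) (eqMr (g 1%N) (lie_g1 n)))). Qed.

(** The bracket of t with X r s = 0 in degree N - 1 gives (2 + d)(X_{r+1,s} + X_{r,s+1}) = -2 (-1)^r
    [t, g_{N+1}]. Starting from X_{0,N} = 0, the signs alternate and every step adds the same
    amount, whence the factor r. *)
Lemma row_defect N r : bb_upto N -> (0 < N)%N -> (r <= N)%N ->
  X r (N - r) = (2%:R * r%:R * (-1) ^+ r / (2%:R + d)) *: ⁅t, g N.+1⁆.
Proof.
move=> bbN N0; elim: r => [|r IH] rN; first by rewrite X0 mulr0 !mul0r scale0r.
have rs : (r + (N - r.+1) < N)%N by lia.
have := IH (ltnW rN); rewrite -subnSK // => {}IH.
have E := congr1 (lie t) (bbN _ _ rs).
rewrite lie0 /X lieD lieZ (lie_ybr_shift _ _ _ tw tx) in E.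
rewrite (_ : (r + (N - r.+1)).+2 = N.+1) in E; last by lia.
rewrite /X (_ : (r + (N - r.+1).+1).+2 = N.+2) in IH; last by lia.
rewrite /X (_ : (r.+1 + (N - r.+1)).+2 = N.+2); last by lia.
rewrite exprS -natr1.
have := d2 => d2'; nc (eqD (eqZ (2%:R + d)^-1 E) (eqZ (-1) IH)).
Qed.

Lemma bb_upto_succ N : bb_upto N -> (0 < N)%N -> ⁅t, g N.+1⁆ = 0 -> bb_upto N.+1.
Proof.
move=> bbN N0 tN r s; rewrite ltnS leq_eqVlt => /predU1P[rsN|]; last exact: bbN.
have -> : s = (N - r)%N by lia.
by rewrite row_defect ?tN ?scaler0 //; lia.
Qed.

(** p_{a+1} is applied to the relation at (0, N - a). Only the top coefficient of [psum], at X^a,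
    reaches total degree N; there it meets the entry (a, N - a) of [row_defect]. The factor a comes
    from the latter, the factor 2 + (-1)^(a+1) d from [psum_lead]. *)
Lemma lie_gg_defect N a : bb_upto N -> hh_upto N.+2 -> hb_upto N ->
  (0 < a)%N -> (a < N)%N ->
  ⁅g a.+1, g (N - a).+2⁆ =
  (a%:R * (2%:R + (-1) ^+ a.+1 * d) / (2%:R + d)) *: ⁅t, g N.+1⁆.
Proof.
move=> bbN hhN hbN a0 aN; have [p gp] := newton_exists g0.
have hh' b c : (b + c <= N)%N -> ⁅g b, g c⁆ = 0 by move=> bc; apply: hhN; lia.
have px s : ⁅p a.+1, x s⁆ = shift_act (psum 2%:R d a.+1) x s.
  by apply: (newton_action g0 gp hh') => // n nN; have [] := hbN n nN.
have pw s : ⁅p a.+1, w s⁆ = shift_act (psum d 2%:R a.+1) w s.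
  by apply: (newton_action g0 gp hh') => // n nN; have [] := hbN n nN.
have E := ybr_psum_action kp 0 (N - a) px pw.
have ybrE r s : ybr kp w x r s = X r s - (2%:R * (-1) ^+ r) *: g (r + s).+2.
  by rewrite /X addrK.
rewrite !ybrE X0 sub0r add0n lieN lieZ expr0 mulr1 in E.
rewrite lieC (newton_comm g0 gp) in E; last by move=> m ma; apply: hhN; lia.
(* For j < a both relations are known; their g-terms carry (-1)^j twice and cancel. *)
rewrite big_ord_recr /= big1 ?add0r in E; last first.
  move=> j _; rewrite !ybrE X0 bbN; last by have := ltn_ord j; lia.
  rewrite !add0n expr0 mulr1 !sub0r scalerN opprK scalerA.
  rewrite mulrCA -exprMn mulrNN mulr1 expr1n mulr1 addnC [(j + _)%N]addnC.
  by rewrite addrC subrr scaler0.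
rewrite !ybrE X0 add0n psum_lead expr0 mulr1 sub0r (subnK (ltnW aN)) in E.
rewrite (subnKC (ltnW aN)) row_defect ?(ltn_trans a0) ?add0n // in E; last exact: ltnW.
have a1 : a.+1%:R != 0 :> K by rewrite pnatr_eq0.
rewrite exprS; rewrite exprS in E; have d2' := d2; move: (a.+1%:R) a1 E => q q0 E.
rewrite -signr_odd in E *; case: (odd a) E => /=; rewrite ?expr1 ?expr0 => E.
  nc (eqZ (- (1 / (2%:R * q))) E).
nc (eqZ (- (1 / (2%:R * q))) E).
Qed.

Lemma hh_upto_succ N : (1 < N)%N -> bb_upto N -> hh_upto N.+2 -> hb_upto N ->
  ⁅t, g N.+1⁆ = 0 -> hh_upto N.+3.
Proof.
move=> N1 bbN hhN hbN tN a b; rewrite leq_eqVlt => /predU1P[ab|]; last exact: hhN.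
have defect c : (0 < c)%N -> (c < N)%N -> ⁅g c.+1, g (N - c).+2⁆ = 0.
  by move=> c0 cN; rewrite lie_gg_defect ?tN ?scaler0.
case: a ab => [|[|a]] ab; first by rewrite g0 /lie mulr1 mul1r subrr.
  exact: lie_g1.
case: b ab => [|[|b]] ab; first by rewrite g0 /lie mulr1 mul1r subrr.
  by rewrite lieC lie_g1 oppr0.
have [aN|Na] := ltnP a.+1 N.
  have -> : b.+2 = (N - a.+1).+2 by lia.
  exact: defect.
have [-> ->] : (a = N.-1 /\ b = 0)%N by lia.
rewrite lieC (_ : N.-1.+2 = (N - 1).+2); last by lia.
by rewrite defect ?oppr0.
Qed.

End RankOne.

Section RankOneInduction.
Variables (K : numFieldType) (A : algType K) (d : K) (x w g : nat -> A) (t : A).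
Local Notation X r s :=
  (ybr (d / 2%:R) w x r s + (2%:R * (-1) ^+ r) *: g (r + s).+2).

(** The sequence g of the vertex tau i in terms of that of i, as h_{tau i,r} = (-1)^(r+1) h_{i,r};
    proved for the actual sequences in [hseq_tau3] and [hseq_tau]. *)
Definition sgn_seq (g : nat -> A) n : A := (-1) ^+ n *: g n.

Lemma hb_step_sgn c e y n :
  hb_step c e (sgn_seq g) y n <-> hb_step e c g y n.
Proof.
split=> E s; have {}E := E s; rewrite /sgn_seq !exprS in E *;
  have := signr_odd K n; case: (odd n) => /esym sn; rewrite sn ?expr0 ?expr1 in E *.
- nc (eqZ (-1) E).
- nc E.
- nc (eqZ (-1) E).
- nc E.
Qed.

Definition cyclic_rhs d (w : nat -> A) (e0 e1 : A) r : A :=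
  ⁅w r.+2, e0⁆ - d *: ⦃w r.+1, e0⦄ + ⁅w r, e1⁆ + (d ^+ 2 / 4%:R) *: ⁅w r, e0⁆.

(** If tau i differs from i, the entries of [ybr 1 x x] vanish and the condition is clear. If x = w
    they are multiples of g_2 and g_4, and the condition is itself a relation between the g's and
    x. *)
Definition cyclic_closed d (x w : nat -> A) := ybr 1 x x 1 0 = 0 /\
  forall r, cyclic_rhs d w (ybr 1 x x 0 0) (ybr 1 x x 1 1) r = 0.

Hypothesis D : rank_one_data d x w g t.
Hypotheses (cyc_x : cyclic_closed d x w) (cyc_w : cyclic_closed d w x).

Local Notation bb N := (bb_upto d x w g N).
Local Notation hh N := (hh_upto g N).
Local Notation hb N := (hb_upto d x w g N).

(** [cyclic_identity] gives the relation with n = r + 2 at s = 0, and [hb_step_shift] spreads it to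
    all s. The new value n = N - 1 has to be at least 2, which forces N >= 3. The relation for w is
    the same one with x and w exchanged and g replaced by [sgn_seq g]. *)
Lemma hb_upto_succ N : (2 < N)%N -> bb N -> hh N.+3 -> hb N -> hb N.+1.
Proof.
move=> N2 bbN hhN hbN n; rewrite ltnS leq_eqVlt => /predU1P[nN|]; last exact: hbN.
have tg m : (m <= N.+1)%N -> ⁅t, g m⁆ = 0.
  by move=> mN; rewrite (lie_t_g D); apply: hhN; lia.
have [r nE] : exists r, n = r.+2 by exists (n - 2)%N; lia.
have s_neq0 : 4%:R * (-1) ^+ r != 0 :> K.
  by rewrite mulf_neq0 ?signr_eq0 ?pnatr_eq0.
subst n; split.
  apply: (hb_step_shift (ro_d2 D) (ro_tx D)).
    by move=> m /andP[_ ?]; apply: tg; lia.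
  apply: (scalerI s_neq0); rewrite scaler0.
  case: cyc_x => x10 /(_ r) <-; apply: cyclic_identity => // a j *.
  by apply: bbN; lia.
apply/hb_step_sgn; apply: (hb_step_shift (ro_d2 D) (ro_tw D)).
  by move=> m /andP[_ ?]; rewrite lieZ tg ?scaler0 //; lia.
apply: (scalerI s_neq0); rewrite scaler0.
case: cyc_w => x10 /(_ r) <-; apply: cyclic_identity => // a j *.
have E : X j (r + a)%N = 0 by apply: bbN; lia.
rewrite ybr_sym -[RHS]E /sgn_seq scalerA; congr (_ + _ *: _); last by congr g; lia.
rewrite -mulrA -exprD; congr (_ * _); rewrite -signr_odd -[RHS]signr_odd.
by congr ((-1) ^+ nat_of_bool _); lia.
Qed.

Lemma rank_one_step N : (2 < N)%N ->
  (exists a b, [/\ (a + b = N.+1)%N, (1 < a)%N, (1 < b)%N &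
     a%:R * (2%:R + (-1) ^+ a.+1 * d) + b%:R * (2%:R + (-1) ^+ b.+1 * d) != 0]) ->
  bb N -> hh N.+2 -> hb N -> [/\ bb N.+1, hh N.+3 & hb N.+1].
Proof.
move=> N2 [a [b [ab a1 b1 nz]]] bbN hhN hbN.
have tN : ⁅t, g N.+1⁆ = 0.
  have d2 := ro_d2 D.
  have a0 : (0 < a)%N by lia. have aN : (a < N)%N by lia.
  have b0 : (0 < b)%N by lia. have bN : (b < N)%N by lia.
  have Ea := lie_gg_defect D bbN hhN hbN a0 aN.
  have Eb := lie_gg_defect D bbN hhN hbN b0 bN.
  rewrite (_ : (N - a).+2 = b.+1) in Ea; last by lia.
  rewrite (_ : (N - b).+2 = a.+1) in Eb; last by lia.
  rewrite lieC Ea in Eb; apply: (scalerI nz); rewrite scaler0.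
  by nc (eqZ (- (2%:R + d)) Eb).
have N0 : (0 < N)%N by lia.
have bbN' : bb N.+1 by exact: (bb_upto_succ D).
have hhN' : hh N.+3 by apply: (hh_upto_succ D) => //; lia.
by split=> //; apply: hb_upto_succ.
Qed.

Lemma rank_one_all N0 : (2 < N0)%N ->
  (forall N, (N0 <= N)%N ->
   exists a b, [/\ (a + b = N.+1)%N, (1 < a)%N, (1 < b)%N &
     a%:R * (2%:R + (-1) ^+ a.+1 * d) + b%:R * (2%:R + (-1) ^+ b.+1 * d) != 0]) ->
  bb N0 -> hh N0.+2 -> hb N0 ->
  [/\ forall r s, X r s = 0, forall a b, ⁅g a, g b⁆ = 0 &
      forall n, hb_step 2%:R d g x n /\ hb_step d 2%:R g w n].
Proof.
move=> N2 arith bb0 hh0 hb0.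
have all N : (N0 <= N)%N -> [/\ bb N, hh N.+2 & hb N].
  elim: N => [|N IH]; first by rewrite leqn0 => /eqP N00; rewrite N00 in N2.
  rewrite leq_eqVlt => /predU1P[<-//|N0N].
  by have [? ? ?] := IH N0N; apply: rank_one_step => //; [lia | exact: arith].
split=> [r s|a b|n].
- by have [+ _ _] := all (N0 + (r + s).+1)%N (leq_addr _ _); apply; lia.
- by have [_ + _] := all (N0 + (a + b))%N (leq_addr _ _); apply; lia.
- by have [_ _] := all (N0 + n.+2)%N (leq_addr _ _); apply; lia.
Qed.
End RankOneInduction.

(** * Start of the induction for tau i different from i *)

Section RankOneBase.
Variables (K : numFieldType) (A : algType K) (d : K) (x w g : nat -> A) (t : A).
Hypothesis D : rank_one_data d x w g t.
Local Notation X r s :=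
  (ybr (d / 2%:R) w x r s + (2%:R * (-1) ^+ r) *: g (r + s).+2).
Let g0 := ro_g0 D.
Let g1x := ro_g1x D.
Let g1w := ro_g1w D.
Let tE := ro_t D.
Let tx := ro_tx D.
Let tw := ro_tw D.
Let d2 := ro_d2 D.

Lemma hb_step0 : hb_step 2%:R d g x 0 /\ hb_step d 2%:R g w 0.
Proof.
split=> s.
  have E := tx s; have F := g1x s; rewrite g0; rewrite tE in E.
  nc (eqD E (eqD (eqZ (1 / 2) (eqMl (g 1%N) F)) (eqZ (1 / 2) (eqMr (g 1%N) F)))).
have E := tw s; have F := g1w s; rewrite g0; rewrite tE in E.
nc (eqD E (eqD (eqZ (1 / 2) (eqMl (g 1%N) F)) (eqZ (1 / 2) (eqMr (g 1%N) F)))).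
Qed.

Lemma bb_upto2 : bb_upto d x w g 2.
Proof.
have tg2 : ⁅t, g 2⁆ = 0 by rewrite (lie_t_g D) lie_self.
apply: (bb_upto_succ D) => // r s; case: r s => [|r] [|s] // _.
exact: ro_X0 D 0%N.
Qed.

(** t makes the entries of a given total degree alternate in sign. Symmetry then settles degree 1
    but says nothing in even degrees, so a derivation p with a nonzero X^2 term is needed: it yields
    twice the entry (0, n + 2). *)
Lemma ybr_all (y : nat -> A) (m : K) (p : A) (a b e : K) : m != 0 -> a != 0 ->
  (forall s, ⁅t, y s⁆ = m *: y s.+1) ->
  (forall s, ⁅p, y s⁆ = a *: y s.+2 + b *: y s.+1 + e *: y s) ->
  ybr 1 y y 0 0 = 0 -> forall r s, ybr 1 y y r s = 0.
Proof.
move=> m0 a0 ty py y00 r s.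
have [n rs] : exists n, (r + s = n)%N by exists (r + s)%N.
elim/ltn_ind: n r s rs => n IH r s rs.
case: n IH rs => [|n] IH rs; first by case: r s rs => [|r] [|s].
have step u v : (u + v = n)%N -> ybr 1 y y u.+1 v + ybr 1 y y u v.+1 = 0.
  move=> uv; have E := congr1 (lie t) (IH n (leqnn _) u v uv).
  by rewrite lie0 (lie_ybr_shift _ _ _ ty ty) in E; nc (eqZ (m^-1) E).
have row u v : (u + v = n.+1)%N -> ybr 1 y y u v = (-1) ^+ u *: ybr 1 y y 0 n.+1.
  elim: u v => [|u IHu] v uv; first by rewrite scale1r -uv.
  have E := step u v ltac:(lia); have F := IHu v.+1 ltac:(lia).
  by rewrite exprS; nc (eqD E (eqZ (-1) F)).
suff z : ybr 1 y y 0 n.+1 = 0 by rewrite row // z scaler0.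
case: n IH {rs step} row => [|n] IH row.
  have E := row 1%N 0%N erefl; rewrite (ybr_sym _ y y 0) in E.
  by nc (eqZ (1 / 2) E).
have pE : ⁅p, ybr 1 y y 0 n⁆ =
  a *: ybr 1 y y 0 n.+2 + b *: ybr 1 y y 0 n.+1 + e *: ybr 1 y y 0 n
  + (a *: ybr 1 y y 2 n + b *: ybr 1 y y 1 n + e *: ybr 1 y y 0 n).
  by rewrite /ybr !(lieE p) !py; nc (erefl (0 : A)).
rewrite (IH n _ 0%N n) // (IH n.+1 _ 0%N n.+1) // (IH n.+1 _ 1%N n) // in pE.
rewrite lie0 (row 2%N) // in pE.
rewrite (_ : (-1) ^+ 2 = 1) in pE; last by ring.
by nc (eqZ (- (1 / (2%:R * a))) pE).
Qed.

Definition hb_rel c e (h : nat -> A) (y : nat -> A) n : A :=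
  ⁅h n.+2, y 0%N⁆ - ⁅h n, y 2%N⁆ - ((c - e) / 2%:R) *: ⦃h n.+1, y 0%N⦄
     - ((c + e) / 2%:R) *: ⦃h n, y 1%N⦄ - ((c * e) / 4%:R) *: ⁅h n, y 0%N⁆.

Section NonSplit.
Hypotheses (d2' : 2%:R - d != 0) (tg3 : ⁅t, g 3⁆ = 0).
Hypotheses (xx0 : ybr 1 x x 0 0 = 0) (ww0 : ybr 1 w w 0 0 = 0).
Hypothesis hbx : hb_rel 2%:R d g x 1 = 0.
Hypothesis hbw : hb_rel 2%:R d (sgn_seq g) w 1 = 0.

Lemma hb_upto3 : hb_upto d x w g 3.
Proof.
have tg m : (1 <= m <= 3)%N -> ⁅t, g m⁆ = 0.
  case: m => [|[|[|[|]]]] //= _; rewrite (lie_t_g D) ?lie_self //.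
  by rewrite lieC (lie_g1 D) oppr0.
move=> [|[|]] // _; first exact: hb_step0.
split; first exact: hb_step_shift tx tg hbx.
apply/hb_step_sgn; apply: hb_step_shift tw _ hbw => // m m3.
by rewrite lieZ tg ?scaler0.
Qed.

Lemma hh_upto5 : hh_upto g 5.
Proof.
have g23 : ⁅g 2, g 3⁆ = 0 by rewrite -(lie_t_g D).
have g1 := lie_g1 D.
have gz m : ⁅g 0%N, g m⁆ = 0 by rewrite g0 /lie mul1r mulr1 subrr.
move=> [|[|[|[|[|[|]]]]]] [|[|[|[|[|[|]]]]]] //= _; rewrite ?lie_self //;
  by rewrite lieC ?g1 ?gz ?g23 oppr0.
Qed.

(** p_3 serves as the second derivation of [ybr_all]: its X^2 coefficient is 3(2 - d) on x and 3(d -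
    2) on w. *)
Lemma nonsplit_ybr : (forall r s, ybr 1 x x r s = 0) /\
  (forall r s, ybr 1 w w r s = 0).
Proof.
have [p gp] := newton_exists g0.
have hh b c : (b + c <= 3)%N -> ⁅g b, g c⁆ = 0 by move=> ?; apply: hh_upto5; lia.
have px s : ⁅p 3%N, x s⁆ = shift_act (psum 2%:R d 3) x s.
  by apply: (newton_action g0 gp hh) => // n nN; have [] := hb_upto3 nN.
have pw s : ⁅p 3%N, w s⁆ = shift_act (psum d 2%:R 3) w s.
  by apply: (newton_action g0 gp hh) => // n nN; have [] := hb_upto3 nN.
have f2 (c e : K) : (psum c e 3)`_2 = 3%:R * (c - e) by rewrite psum_lead; ring.
split.
  apply: (@ybr_all x (2%:R + d) (p 3%N) (psum 2%:R d 3)`_2 (psum 2%:R d 3)`_1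
            (psum 2%:R d 3)`_0) => // [|s]; last by rewrite px shift_act3 ?size_psum.
  by rewrite f2 mulf_neq0 ?pnatr_eq0.
apply: (@ybr_all w (2%:R + d) (p 3%N) (psum d 2%:R 3)`_2 (psum d 2%:R 3)`_1
          (psum d 2%:R 3)`_0) => // [|s]; last by rewrite pw shift_act3 ?size_psum.
by rewrite f2 mulf_neq0 ?pnatr_eq0 // -opprB oppr_eq0.
Qed.

Lemma nonsplit_rank_one : d = 0 \/ d = -1 ->
  [/\ forall r s, X r s = 0, forall a b, ⁅g a, g b⁆ = 0 &
      forall n, hb_step 2%:R d g x n /\ hb_step d 2%:R g w n].
Proof.
move=> dE; have [xx ww] := nonsplit_ybr.
have cyc (u v : nat -> A) : (forall r s, ybr 1 u u r s = 0) -> cyclic_closed d u v.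
  move=> uu; split=> // r; rewrite !uu /cyclic_rhs /anti !lie0 mul0r mulr0.
  by rewrite !(addr0, scaler0, subr0).
apply: (rank_one_all D (cyc x w xx) (cyc w x ww) (isT : (2 < 3)%N)) => //.
(* Both summands are positive: the sum is 4 + 2(N - 1) for d = 0, and 6 plus N - 1 or 3(N - 1) for d
   = -1. *)
- move=> N N3; exists 2%N, N.-1; split; try lia.
  rewrite -signr_odd -(signr_odd _ N.-1.+1).
  have [k -> k0] : exists2 k, 2%:R * (2%:R + (-1) ^+ odd 3 * d)
      + N.-1%:R * (2%:R + (-1) ^+ odd N.-1.+1 * d) = k%:R & k != 0%N.
    case: dE => ->; first by exists (4 + 2 * N.-1)%N; [rewrite natrD natrM; ring|].
    case: (odd N.-1.+1); first by exists (6 + 3 * N.-1)%N; [rewrite natrD natrM; ring|].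
    by exists (6 + N.-1)%N; [rewrite natrD; ring|].
  by rewrite pnatr_eq0.
- apply: (bb_upto_succ D) => //; exact: bb_upto2.
- exact: hh_upto5.
- exact: hb_upto3.
Qed.
End NonSplit.
End RankOneBase.

(** * Vertices fixed by tau *)

Section SplitNode.
Variables (K : numFieldType) (A : algType K) (x g : nat -> A).
Hypothesis D : rank_one_data 2%:R x x g (g 2%N).
Hypothesis g1 : g 1%N = 0.
Local Notation X r s :=
  (ybr (2%:R / 2%:R) x x r s + (2%:R * (-1) ^+ r) *: g (r + s).+2).

(** For w = x the entries (0, 1) and (1, 0) of [ybr] coincide, whereas g_3 enters the two relations
    with opposite signs. *)
Lemma split_g3 : g 3 = 0.
Proof.
have E := bb_upto2 D (isT : (0 + 1 < 2)%N); have F := bb_upto2 D (isT : (1 + 0 < 2)%N).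
rewrite ybr_sym expr1 addn0 in F; rewrite expr0 add0n in E.
by nc (eqD (eqZ (1 / 4%:R) E) (eqZ (- (1 / 4%:R)) F)).
Qed.

Lemma split_bb_upto3 : bb_upto 2%:R x x g 3.
Proof.
by apply: (bb_upto_succ D) => //; [exact: bb_upto2 D | rewrite split_g3 lie0].
Qed.

Lemma split_hb_upto3 : hb_upto 2%:R x x g 3.
Proof.
move=> [|[|n]] // _; first exact: hb_step0 D.
by split=> s; rewrite split_g3 g1; nc (erefl (0 : A)).
Qed.

Lemma split_ybr : [/\ ybr 1 x x 0 0 = - (2%:R *: g 2%N), ybr 1 x x 1 0 = 0 &
                     ybr 1 x x 1 1 = 2%:R *: g 4%N].
Proof.
have E0 := split_bb_upto3 (isT : (0 + 0 < 3)%N).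
have E1 := split_bb_upto3 (isT : (1 + 0 < 3)%N).
have E2 := split_bb_upto3 (isT : (1 + 1 < 3)%N).
rewrite divff ?pnatr_eq0 // ?expr0 ?expr1 ?addn0 ?addn1 in E0 E1 E2.
rewrite split_g3 in E1; rewrite /ybr in E0 E1 E2 *.
by split; [nc E0 | nc E1 | nc E2].
Qed.

Hypothesis g24 : ⁅g 2, g 4⁆ = 0.

Lemma split_hb_upto4 : hb_upto 2%:R x x g 4.
Proof.
move=> [|[|[|n]]] // _; try exact: split_hb_upto3.
have hb2 : hb_step 2%:R 2%:R g x 2; last by [].
apply: (hb_step_shift (ro_d2 D) (ro_tx D)).
  by case=> [|[|[|[|[|]]]]] // _; rewrite ?split_g3 ?lie0 // lie_self.
have [x00 x10 x11] := split_ybr.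
have E := @cyclic_identity _ _ 2%:R x x g 0 _ _ _ x00 x10 x11.
have {}E := E (fun a j a2 j2 => @split_bb_upto3 a j ltac:(lia)).
rewrite expr0 in E.
(* Both sides of the cyclic identity contain the relation sought: the left side is 4 times it, the
   right side, with e0 = -2 g_2 and e1 = 2 g_4, is -2 times it. Hence 6 times it vanishes. *)
by nc (eqZ (1 / 6%:R) E).
Qed.

Lemma split_rank_one :
  [/\ forall r s, X r s = 0, forall a b, ⁅g a, g b⁆ = 0 &
      forall n, hb_step 2%:R 2%:R g x n].
Proof.
have [x00 x10 x11] := split_ybr.
have cyc : cyclic_closed 2%:R x x.
  (* [cyclic_rhs] is -2 times the relation n = 2 at index r. *)
  split=> // r; have := (split_hb_upto4 (isT : (4 <= 4)%N)).1 r.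
  rewrite /cyclic_rhs split_g3 x00 x11 => E.
  by nc (eqZ (- 2%:R) E).
suff [bb hh hb] : [/\ forall r s, X r s = 0, forall a b, ⁅g a, g b⁆ = 0 &
      forall n, hb_step 2%:R 2%:R g x n /\ hb_step 2%:R 2%:R g x n].
  by split=> // n; have [] := hb n.
apply: (rank_one_all D cyc cyc (isT : (2 < 4)%N)) => //.
(* For d = 2 the scalar of a is 0 for even a and 4a for odd a, so one of a, b must be odd: (2, N -
   1) for even N and (3, N - 2) for odd N. For N = 3 only (2, 2) would be left. *)
- move=> N N4; have [k [Nk | Nk]] : exists k, N = k.*2 \/ N = k.*2.+1.
  + by exists N./2; have := odd_double_half N; case: odd => /=; lia.
  + exists 2%N, N.-1; split; try lia.
    rewrite -signr_odd (_ : N.-1.+1 = k.*2); last by lia.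
    rewrite -(signr_odd _ k.*2) odd_double.
    have -> : 2%:R * (2%:R + (-1) ^+ odd 3 * 2%:R)
      + N.-1%:R * (2%:R + (-1) ^+ false * 2%:R) = (4 * N.-1)%:R :> K.
      by rewrite natrM; ring.
    by rewrite pnatr_eq0; lia.
  + exists 3%N, (N - 2)%N; split; try lia.
    rewrite -signr_odd (_ : (N - 2).+1 = k.*2); last by lia.
    rewrite -(signr_odd _ k.*2) odd_double.
    have -> : 3%:R * (2%:R + (-1) ^+ odd 4 * 2%:R)
      + (N - 2)%:R * (2%:R + (-1) ^+ false * 2%:R) = (12 + 4 * (N - 2))%:R :> K.
      by rewrite natrD natrM; ring.
    by rewrite pnatr_eq0.
- by apply: (bb_upto_succ D) => //; exact: split_bb_upto3.
- have gz m : ⁅g 0%N, g m⁆ = 0 by rewrite (ro_g0 D) /lie mul1r mulr1 subrr.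
  move=> [|[|[|[|[|[|[|]]]]]]] [|[|[|[|[|[|[|]]]]]]] //= _;
    rewrite ?lie_self ?g1 ?split_g3 ?lie0 ?gz ?g24 //;
    by rewrite lieC ?lie0 ?gz ?g24 oppr0.
- exact: split_hb_upto4.
Qed.
End SplitNode.

(** * The relation n = 1 from the Serre relation of i and tau i *)

Section DisjointPair.
Variables (K : numFieldType) (A : algType K) (x w g : nat -> A).

(** The bracket of w_0 with the relation at (1, 0) between two x's: each [w_0, x_s] is replaced by
    g_{s+1}. *)
Lemma hb_rel_disjoint :
  ⁅w 0%N, x 0%N⁆ = g 1%N -> ⁅w 0%N, x 1%N⁆ = g 2%N -> ⁅w 0%N, x 2%N⁆ = g 3%N ->
  ybr 1 x x 1 0 = 0 -> hb_rel 2%:R 0 g x 1 = 0.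
Proof.
move=> z0 z1 z2 x10; rewrite /ybr in x10; rewrite /hb_rel -z2.
nc (eqD (eqD (eqMl (w 0%N) x10) (eqZ (-1) (eqMr (w 0%N) x10)))
  (eqD (eqD (eqD (eqZ (-1) (eqMl (x 2%N) z0)) (eqMr (x 2%N) z0))
        (eqD (eqMr (x 1%N) z0) (eqMl (x 1%N) z0)))
   (eqD (eqMr (x 0%N) z1) (eqMl (x 0%N) z1)))).
Qed.
End DisjointPair.

Section LinkedPair.
Variables (K : numFieldType) (A : algType K) (x w g : nat -> A).

Hypothesis X00 : ybr (-1 / 2%:R) w x 0 0 = - 2%:R *: g 2%N.
Hypothesis X01 : ybr (-1 / 2%:R) w x 0 1 = - 2%:R *: g 3%N.
Hypothesis X10 : ybr (-1 / 2%:R) w x 1 0 = 2%:R *: g 3%N.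
Hypotheses (Y00 : ybr 1 x x 0 0 = 0) (Y01 : ybr 1 x x 0 1 = 0).
Hypothesis g1x : forall s, ⁅g 1%N, x s⁆ = 3%:R *: x s.
Hypothesis g2x : forall s, ⁅g 2%N, x s⁆ = x s.+1 + (3%:R / 2%:R) *: ⦃g 1%N, x s⦄.
Hypothesis sx : ⁅x 0%N, ⁅x 0%N, w 0%N⁆⁆ = 4%:R *: x 0%N.
Variable t : A.
Hypothesis tx : forall s, ⁅t, x s⁆ = x s.+1.
Hypothesis tw : forall s, ⁅t, w s⁆ = w s.+1.

Lemma linked_serre1 : ⁅x 1%N, ⁅x 0%N, w 0%N⁆⁆ + ⁅x 0%N, ⁅x 1%N, w 0%N⁆⁆
  + ⁅x 0%N, ⁅x 0%N, w 1%N⁆⁆ = 4%:R *: x 1%N.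
Proof. by have E := congr1 (lie t) sx; rewrite !(lieE t) !tx !tw in E; nc E. Qed.

Lemma linked_serre2 :
  ⁅x 2%N, ⁅x 0%N, w 0%N⁆⁆ + ⁅x 0%N, ⁅x 2%N, w 0%N⁆⁆ + ⁅x 0%N, ⁅x 0%N, w 2%N⁆⁆
  + 2%:R *: (⁅x 1%N, ⁅x 1%N, w 0%N⁆⁆ + ⁅x 1%N, ⁅x 0%N, w 1%N⁆⁆
             + ⁅x 0%N, ⁅x 1%N, w 1%N⁆⁆) = 4%:R *: x 2%N.
Proof.
have E := congr1 (lie t) linked_serre1; rewrite !(lieE t) !tx !tw in E; nc E.
Qed.
Let DDsx := linked_serre2.

(** After all shifts of the Serre relation by t have been used, one cubic expression remains. The
    relation n = 1 is thus equivalent to [x_1, [x_1, w_0]] = 2 {g_1, x_1}, and it is used in both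
    directions. *)
Lemma hb_rel_linked : hb_rel 2%:R (-1) g x 1 =
  - (3%:R / 2%:R) *: (⁅x 1%N, ⁅x 1%N, w 0%N⁆⁆ - 2%:R *: ⦃g 1%N, x 1%N⦄).
Proof.
have [wx00 wx01 wx10] := And3 X00 X01 X10; have [xx00 xx01] := conj Y00 Y01.
have [h0x0 h0x2 h1x1] := And3 (g1x 0%N) (g1x 2%N) (g2x 1%N).
rewrite /ybr /hb_rel in wx00 wx01 wx10 xx00 xx01 *.
nc (eqD (eqD (eqD (eqD (eqZ (- (1 / 1)) h0x2)
  (eqZ (7 / 3) h1x1))
  (eqD (eqZ (7 / 6) (eqMl (x 1%N) wx00))
  (eqZ (5 / 12) (eqMr (w 1%N) xx00))))
  (eqD (eqD (eqZ (- (3 / 8)) (eqMr (w 0%N) xx00))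
  (eqZ (- (1 / 6)) (eqMr (x 0%N) wx10)))
  (eqD (eqZ (- (7 / 6)) (eqMr (x 1%N) wx00))
  (eqD (eqZ (- (3 / 4)) (eqMr (x 0%N) wx00))
  (eqZ (1 / 6) (eqMl (x 0%N) wx10))))))
  (eqD (eqD (eqD (eqZ (- (3 / 4)) (eqMl (x 0%N) wx00))
  (eqZ (1 / 6) DDsx))
  (eqD (eqZ (- (1 / 6)) (eqMr (w 0%N) xx01))
  (eqD (eqZ (1 / 3) (eqMr (x 0%N) wx01))
  (eqZ (- (1 / 3)) (eqMl (x 0%N) wx01)))))
  (eqD (eqD (eqZ (- (3 / 8)) sx)
  (eqZ (1 / 2) h0x0))
  (eqD (eqZ (- (5 / 12)) (eqMl (w 1%N) xx00))
  (eqD (eqZ (1 / 6) (eqMl (w 0%N) xx01))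
  (eqZ (- (3 / 8)) (eqMl (w 0%N) xx00))))))).
Qed.

(** Bracketing the Serre relation twice with t only gives the combination [linked_serre2]. The
    second-order parts of p on x and w have opposite signs, so p gives a combination in which the
    w_2 term has the other sign. *)
Lemma linked_serre_shift p (f0 f1 f2 : K) : f2 != 0 ->
  (forall s, ⁅p, x s⁆ = f2 *: x s.+2 + f1 *: x s.+1 + f0 *: x s) ->
  (forall s, ⁅p, w s⁆ = - f2 *: w s.+2 + f1 *: w s.+1 - f0 *: w s) ->
  ⁅x 1%N, ⁅x 1%N, w 0%N⁆⁆ = 2%:R *: ⦃g 1%N, x 1%N⦄.
Proof.
move=> f2_neq0 px pw.
have E3 : ⁅x 2%N, ⁅x 0%N, w 0%N⁆⁆ + ⁅x 0%N, ⁅x 2%N, w 0%N⁆⁆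
    - ⁅x 0%N, ⁅x 0%N, w 2%N⁆⁆ = 4%:R *: x 2%N.
  have E := congr1 (lie p) sx; rewrite !(lieE p) !px !pw in E.
  by nc (eqZ f2^-1 (eqD E (eqD (eqZ (- f1) linked_serre1) (eqZ (- f0) sx)))).
have [wx00 wx01 wx10] := And3 X00 X01 X10.
have [xx00 xx01] := conj Y00 Y01; have h1x1 := g2x 1%N.
rewrite /ybr in wx00 wx01 wx10 xx00 xx01 *.
nc (eqD (eqD (eqD (eqZ (2 / 3) (eqMl (x 1%N) wx00))
  (eqD (eqZ (1 / 6) (eqMr (w 1%N) xx00))
  (eqZ (- (2 / 3)) (eqMr (x 0%N) wx10))))
  (eqD (eqZ (- (2 / 3)) (eqMr (x 1%N) wx00))
  (eqD (eqZ (- (1 / 2)) E3)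
  (eqZ (1 / 3) (eqMr (w 0%N) xx01)))))
  (eqD (eqD (eqZ (- (2 / 3)) (eqMr (x 0%N) wx01))
  (eqD (eqZ (4 / 3) h1x1)
  (eqZ (2 / 3) (eqMl (x 0%N) wx01))))
  (eqD (eqD (eqZ (2 / 3) (eqMl (x 0%N) wx10))
  (eqZ (1 / 6) DDsx))
  (eqD (eqZ (- (1 / 6)) (eqMl (w 1%N) xx00))
  (eqZ (- (1 / 3)) (eqMl (w 0%N) xx01)))))).
Qed.
End LinkedPair.

Definition adj (t : dynkin) (i j : nat) := edge t i j || edge t j i.

(** * Orbits of the diagram involution *)

Section DynkinGraph.
Local Open Scope nat_scope.

Lemma edge6_cases i j : edge DynE6 i j ->
  i = 0 /\ j = 2 \/ i = 2 /\ j = 3 \/ i = 3 /\ j = 4 \/ i = 4 /\ j = 5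
  \/ i = 1 /\ j = 3.
Proof. by rewrite /= !inE !xpair_eqE; lia. Qed.

Lemma no_triangle t i j k : adj t i j -> adj t j k -> adj t i k -> False.
Proof.
rewrite /adj; case: t => [r|r|].
- by rewrite /=; lia.
- by rewrite /=; lia.
- by move=> /orP[] /edge6_cases E1 /orP[] /edge6_cases E2 /orP[] /edge6_cases E3; lia.
Qed.

Lemma no_square t i j k l : i != k -> j != l ->
  adj t i j -> adj t j k -> adj t k l -> adj t l i -> False.
Proof.
rewrite /adj; case: t => [r|r|].
- by rewrite /=; lia.
- by rewrite /=; lia.
- move=> ik jl /orP[] /edge6_cases E1 /orP[] /edge6_cases E2.
  all: by move=> /orP[] /edge6_cases E3 /orP[] /edge6_cases E4; lia.
Qed.

Lemma adj_neq t i j : adj t i j -> i != j.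
Proof.
rewrite /adj; case: t => [r|r|]; [by rewrite /=; lia | by rewrite /=; lia |].
by move=> /orP[] /edge6_cases E1; lia.
Qed.

Lemma adj_exists t i : wf_dynkin t -> t <> DynA 1 -> i < rank t ->
  exists2 k, k < rank t & adj t i k.
Proof.
rewrite /adj; case: t => [r|r|] /= wf nt ir.
- have r2 : 1 < r by case: r wf nt {ir} => [|[]].
  case: (ltnP i.+1 r) => ?; first by exists i.+1 => //; lia.
  by exists i.-1; lia.
- case: (leqP i (r - 3)) => ?; first by exists i.+1; lia.
  by exists (r - 3); lia.
- by case: i ir => [|[|[|[|[|[|]]]]]] // _;
    [exists 2 | exists 3 | exists 3 | exists 2 | exists 3 | exists 4].
Qed.

(** Needed when the neighbour found for i is tau i itself: this edge must continue at one of its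
    ends. *)
Lemma adj_third t i k : wf_dynkin t -> t <> DynA 2 -> i < rank t -> k < rank t ->
  adj t i k ->
  exists m, [/\ m < rank t, m != i, m != k & adj t i m || adj t k m].
Proof.
move=> wf nt; rewrite {1}/adj; wlog ik : i k / edge t i k => [IH ir kr|ir kr _].
  case/orP=> ik; first by apply: IH; rewrite ?ik.
  by have [|m [mr mi mk]] := IH k i ik kr ir; [rewrite ik | exists m; rewrite orbC].
case: t wf nt ik ir kr => [r|r|] wf nt ik ir kr.
- have r2 : r <> 2 by move=> r2; apply: nt; rewrite r2.
  have {}ik : k = i.+1 by apply/eqP.
  rewrite /= in wf ir kr; subst k; case: i ir kr => [|i] ir kr.
    by exists 2; rewrite /adj /=; split; lia.
  by exists i; rewrite /adj /=; split; lia.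
- rewrite /= in wf ir kr; case/orP: ik => /andP[/eqP E1 E2].
    case: i E1 ir => [|i] E1 ir; subst k.
      by exists 2; rewrite /adj /=; split; lia.
    by exists i; rewrite /adj /= eqxx; split; lia.
  by exists i.+1; rewrite /adj /= eqxx; split; lia.
- have [[-> ->]|[[-> ->]|[[-> ->]|[[-> ->]|[-> ->]]]]] := edge6_cases ik.
  + by exists 3.
  + by exists 0.
  + by exists 2.
  + by exists 3.
  + by exists 2.
Qed.
End DynkinGraph.

Section CartanEntries.
Variables (t : dynkin) (tau : 'I_(rank t) -> 'I_(rank t)).
Hypotheses (wf : wf_dynkin t) (ht : diagram_involution tau).
Local Notation c := (cartan t).

Lemma tauK : involutive tau. Proof. by case: ht. Qed.
Lemma cartan_tau i j : c (tau i) (tau j) = c i j. Proof. by case: ht. Qed.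

Lemma cartanE i j : c i j = if i == j then 2 else if adj t i j then -1 else 0.
Proof. by rewrite mxE. Qed.

Lemma cartan_diag i : c i i = 2. Proof. by rewrite cartanE eqxx. Qed.

Lemma cartan_sym i j : c i j = c j i.
Proof. by rewrite !cartanE eq_sym /adj orbC. Qed.

Lemma cartan_tauC i j : c (tau i) j = c i (tau j).
Proof. by rewrite -cartan_tau tauK. Qed.

Lemma cartan_adj i j : (c i j == -1) = adj t i j.
Proof.
rewrite cartanE; case: (eqVneq i j) => [->|_]; last by case: adj.
by case E: (adj t j j) => //; have := adj_neq E; rewrite eqxx.
Qed.

Lemma cartan_off i j : i != j -> c i j = 0 \/ c i j = -1.
Proof. by rewrite cartanE => /negbTE->; case: adj; [right | left]. Qed.

Lemma tau_cases i : [\/ tau i = i /\ c i (tau i) = 2,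
  tau i != i /\ c i (tau i) = 0 | tau i != i /\ c i (tau i) = -1].
Proof.
case: (eqVneq (tau i) i) => [ti|ti]; first by constructor 1; rewrite ti cartan_diag.
have [ci|ci] := cartan_off ti; rewrite cartan_sym in ci.
  by constructor 2.
by constructor 3.
Qed.

Lemma cross_cases i j : j != i -> j != tau i ->
  [\/ c i j = 0 /\ c (tau i) j = 0,
     c i j = -1 /\ c (tau i) j = 0,
     c i j = 0 /\ c (tau i) j = -1
   | c i j = -1 /\ c (tau i) j = -1].
Proof.
rewrite eq_sym => ij; rewrite eq_sym => tij.
by have [->|->] := cartan_off ij; have [->|->] := cartan_off tij;
  [constructor 1 | constructor 3 | constructor 2 | constructor 4].
Qed.

(* Any other combination would produce a triangle or a square in the tree. *)
Lemma cross_both i j : j != i -> j != tau i -> c i j = -1 -> c (tau i) j = -1 ->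
  [\/ c i (tau i) = 2 /\ c j (tau j) = 2, c i (tau i) = 2 /\ c j (tau j) = 0
   | c i (tau i) = 0 /\ c j (tau j) = 2].
Proof.
move=> ji jti /eqP; rewrite cartan_adj => ij /eqP; rewrite cartan_adj => tij.
have ji_adj : adj t j i by rewrite /adj orbC.
have jti_adj : adj t j (tau i) by rewrite /adj orbC.
have itj : adj t i (tau j) by rewrite -cartan_adj -cartan_tauC cartan_adj.
have noA : c i (tau i) <> -1.
  by move/eqP; rewrite cartan_adj => E; apply: (no_triangle ij jti_adj).
have noA' : c j (tau j) <> -1.
  by move/eqP; rewrite cartan_adj => E; apply: (no_triangle ji_adj itj).
have [[ti ci]|[ti ci]|[_ /noA//]] := tau_cases i;
  have [[tj cj]|[tj cj]|[_ /noA'//]] := tau_cases j.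
- by constructor 1.
- by constructor 2.
- by constructor 3.
exfalso; apply: (@no_square t i j (tau i) (tau j)) => //.
- by rewrite val_eqE eq_sym.
- by rewrite val_eqE eq_sym.
- by rewrite -cartan_adj cartan_tau cartan_adj.
- by rewrite /adj orbC.
Qed.

(** Neither vertex is fixed, because c_{ij} differs from c_{tau i,j} = c_{i,tau j}. If both orbits
    were linked, then i, tau i, tau j, j would form a square. *)
Lemma cross_single i j : j != i -> j != tau i -> c i j = -1 -> c (tau i) j = 0 ->
  [/\ tau i != i, tau j != j &
     [\/ c i (tau i) = 0 /\ c j (tau j) = 0, c i (tau i) = 0 /\ c j (tau j) = -1
      | c i (tau i) = -1 /\ c j (tau j) = 0]].
Proof.
move=> ji jti cij ctij.
have ti : tau i != i by apply/eqP => E; rewrite E cij in ctij.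
have tj : tau j != j by apply/eqP => E; rewrite cartan_tauC E cij in ctij.
split=> //.
have [[/eqP/negP//]|[_ ci]|[_ ci]] := tau_cases i;
  have [[/eqP/negP//]|[_ cj]|[_ cj]] := tau_cases j;
  rewrite ?(negbTE ti, negbTE tj) //.
- by constructor 1.
- by constructor 2.
- by constructor 3.
exfalso; apply: (@no_square t i (tau i) (tau j) j).
- by rewrite val_eqE -(inj_eq (inv_inj tauK)) tauK eq_sym.
- by rewrite val_eqE eq_sym.
- by rewrite -cartan_adj ci.
- by rewrite -cartan_adj cartan_tau cij.
- by rewrite -cartan_adj cartan_sym cj.
- by rewrite -cartan_adj cartan_sym cij.
Qed.

(** If the third vertex is adjacent to tau i rather than to i, its image under tau is adjacent to
    i. *)
Lemma neighbour_exists : t <> DynA 1 -> t <> DynA 2 -> forall i,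
  exists j, [/\ j != i, j != tau i & c i j = -1].
Proof.
move=> t1 t2 i; have [k kr ik] := adj_exists wf t1 (ltn_ord i).
have [kt|kt] := eqVneq (Ordinal kr) (tau i); last first.
  exists (Ordinal kr); split=> //; first by rewrite -val_eqE eq_sym (adj_neq ik).
  by apply/eqP; rewrite cartan_adj.
have ck : k = tau i by rewrite -kt.
rewrite ck in ik.
have [m [mr mi mk]] := adj_third wf t2 (ltn_ord i) (ltn_ord (tau i)) ik.
pose m' := Ordinal mr; case/orP => am.
  by exists m'; split=> //; apply/eqP; rewrite cartan_adj.
exists (tau m'); split.
- by rewrite -(inj_eq (inv_inj tauK)) tauK -val_eqE.
- by rewrite (inj_eq (inv_inj tauK)) -val_eqE.
- by apply/eqP; rewrite -cartan_tauC cartan_adj.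
Qed.
End CartanEntries.

(** * Relations between two orbits *)

Section ShiftPair.
Variables (K : numFieldType) (A : algType K) (Z : nat -> nat -> A) (t1 t2 : A).
Variables (a11 a12 a21 a22 : K).
Hypothesis t1Z : forall r s, ⁅t1, Z r s⁆ = a11 *: Z r.+1 s + a12 *: Z r s.+1.
Hypothesis t2Z : forall r s, ⁅t2, Z r s⁆ = a21 *: Z r.+1 s + a22 *: Z r s.+1.
Hypothesis det : a11 * a22 - a12 * a21 != 0.

Lemma shift_pair_null : Z 0%N 0%N = 0 -> forall r s, Z r s = 0.
Proof.
move=> Z0; have step r s : Z r s = 0 -> Z r.+1 s = 0 /\ Z r s.+1 = 0.
  move=> z; have := t1Z r s; have := t2Z r s; rewrite z !lie0 => E2 E1.
  split; apply: (scalerI det); rewrite scaler0.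
    by nc (eqD (eqZ (- a22) E1) (eqZ a12 E2)).
  by nc (eqD (eqZ a21 E1) (eqZ (- a11) E2)).
elim=> [|r IH] s; last by have [] := step r s (IH s).
by elim: s => // s IH; have [] := step 0%N s IH.
Qed.
End ShiftPair.

Section CrossHB.
Variables (K : numFieldType) (A : algType K) (d c e : K) (x w g y : nat -> A).
Local Notation X r s :=
  (ybr (d / 2%:R) w x r s + (2%:R * (-1) ^+ r) *: g (r + s).+2).
Hypothesis xy : forall r s, ybr (c / 2%:R) x y r s = 0.
Hypothesis wy : forall r s, ybr (e / 2%:R) w y r s = 0.

(* Commuting y through both letters of the relation X, which expresses h. *)
Lemma cross_hb_step m :
  (forall a b, (a < 2)%N -> (b < 2)%N -> X a (m + b) = 0) ->
  hb_step c e g y m.+2.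
Proof.
move=> Xm s; have Ex00 := xy m s; have Ex01 := xy m s.+1.
have Ex10 := xy m.+1 s; have Ex11 := xy m.+1 s.+1.
have Ew00 := wy 0%N s; have Ew01 := wy 0%N s.+1.
have Ew10 := wy 1%N s; have Ew11 := wy 1%N s.+1.
have Q00 := Xm 0%N 0%N isT isT; have Q01 := Xm 0%N 1%N isT isT.
have Q10 := Xm 1%N 0%N isT isT; have Q11 := Xm 1%N 1%N isT isT.
rewrite ?expr0 ?expr1 ?add0n ?add1n ?addn0 ?addn1 in Q00 Q01 Q10 Q11.
rewrite /ybr in Ex00 Ex01 Ex10 Ex11 Ew00 Ew01 Ew10 Ew11 Q00 Q01 Q10 Q11.
nc (eqZ (1 / 2%:R) (eqD (eqD (eqD (eqD (eqD (eqZ (1) (eqMl (w 2%N) Ex00))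
  (eqD (eqZ (-1) (eqMl (w 1%N) Ex01))
  (eqZ (-1 * (e / 2) - 1 * (d / 2)) (eqMl (w 1%N) Ex00))))
  (eqD (eqZ (-1) (eqMl (w 1%N) Ex10))
  (eqD (eqZ (1) (eqMl (w 0%N) Ex11))
  (eqZ (1 * (e / 2)) (eqMl (w 0%N) Ex10)))))
  (eqD (eqD (eqZ (1 * (d / 2)) (eqMl (w 0%N) Ex01))
  (eqD (eqZ (1 * (d / 2) * (e / 2)) (eqMl (w 0%N) Ex00))
  (eqZ (1) (eqMr (x m.+1) Ew10))))
  (eqD (eqZ (-1) (eqMr (x m) Ew11))
  (eqD (eqZ (1 * (c / 2)) (eqMr (x m) Ew10))
  (eqZ (-1) (eqMr (x m.+2) Ew00))))))
  (eqD (eqD (eqD (eqZ (1) (eqMr (x m.+1) Ew01))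
  (eqD (eqZ (-1 * (c / 2) - 1 * (d / 2)) (eqMr (x m.+1) Ew00))
  (eqZ (1 * (d / 2)) (eqMr (x m) Ew01))))
  (eqD (eqZ (-1 * (d / 2) * (c / 2)) (eqMr (x m) Ew00))
  (eqD (eqZ (-1) (eqMl (x m.+1) Ew10))
  (eqZ (1) (eqMl (x m) Ew11)))))
  (eqD (eqD (eqZ (1 * (c / 2)) (eqMl (x m) Ew10))
  (eqD (eqZ (1) (eqMl (x m.+2) Ew00))
  (eqZ (-1) (eqMl (x m.+1) Ew01))))
  (eqD (eqZ (-1 * (c / 2) - 1 * (d / 2)) (eqMl (x m.+1) Ew00))
  (eqD (eqZ (1 * (d / 2)) (eqMl (x m) Ew01))
  (eqZ (1 * (d / 2) * (c / 2)) (eqMl (x m) Ew00)))))))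
  (eqD (eqD (eqD (eqD (eqZ (-1) (eqMr (w 2%N) Ex00))
  (eqD (eqZ (1) (eqMr (w 1%N) Ex01))
  (eqZ (-1 * (e / 2) - 1 * (d / 2)) (eqMr (w 1%N) Ex00))))
  (eqD (eqZ (1) (eqMr (w 1%N) Ex10))
  (eqD (eqZ (-1) (eqMr (w 0%N) Ex11))
  (eqZ (1 * (e / 2)) (eqMr (w 0%N) Ex10)))))
  (eqD (eqD (eqZ (1 * (d / 2)) (eqMr (w 0%N) Ex01))
  (eqD (eqZ (-1 * (d / 2) * (e / 2)) (eqMr (w 0%N) Ex00))
  (eqZ (-1) (eqMr (y s) Q11))))
  (eqD (eqZ (1) (eqMr (y s.+1) Q10))
  (eqD (eqZ (1 * (c / 2)) (eqMr (y s) Q10))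
  (eqZ (1) (eqMr (y s.+1) Q01))))))
  (eqD (eqD (eqD (eqZ (-1) (eqMr (y s.+2) Q00))
  (eqD (eqZ (-1 * (e / 2) - 1 * (c / 2)) (eqMr (y s.+1) Q00))
  (eqZ (1 * (e / 2)) (eqMr (y s) Q01))))
  (eqD (eqZ (-1 * (c / 2) * (e / 2)) (eqMr (y s) Q00))
  (eqD (eqZ (1) (eqMl (y s) Q11))
  (eqZ (-1) (eqMl (y s.+1) Q10)))))
  (eqD (eqD (eqZ (1 * (c / 2)) (eqMl (y s) Q10))
  (eqD (eqZ (-1) (eqMl (y s.+1) Q01))
  (eqZ (1) (eqMl (y s.+2) Q00))))
  (eqD (eqZ (-1 * (e / 2) - 1 * (c / 2)) (eqMl (y s.+1) Q00))
  (eqD (eqZ (1 * (e / 2)) (eqMl (y s) Q01))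
  (eqZ (1 * (c / 2) * (e / 2)) (eqMl (y s) Q00))))))))).
Qed.

(** This would be m = -1 in [cross_hb_step]. As w commutes with y, two relations suffice to give the
    first-order identity [g_3, y_s] - [g_2, y_{s+1}] = (c/2) {g_2, y_s}; the relation n = 0 at s + 1
    and the action of g_1 turn it into the claim. *)
Lemma cross_hb_step1_right : e = 0 -> (forall r s, ⁅w r, y s⁆ = 0) ->
  (forall s, ⁅g 1%N, y s⁆ = c *: y s) -> g 0%N = 1 -> hb_step c 0 g y 0 ->
  X 0%N 0%N = 0 -> X 0%N 1%N = 0 -> hb_step c 0 g y 1.
Proof.
move=> e0 Cw g1y g0 hb0 Q00 Q01 s; have E1 := g1y s.+2; have E2 := hb0 s.+1.
rewrite g0 in E2.
have Ex00 := xy 0%N s; have Ex10 := xy 1%N s.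
have Cw00 := Cw 0%N s; have Cw01 := Cw 0%N s.+1.
have Cw10 := Cw 1%N s; have Cw11 := Cw 1%N s.+1.
rewrite ?expr0 ?expr1 ?add0n ?add1n ?addn0 ?addn1 in Q00 Q01.
rewrite /ybr in Ex00 Ex10 Q00 Q01.
nc (eqD (eqD E2 (eqZ (-1) E1)) (eqZ (- (1 / 2%:R)) (eqD (eqD (eqD (eqD (eqZ (1) (eqMl (w 1%N) Ex00))
  (eqD (eqZ (-1) (eqMl (w 0%N) Ex10))
  (eqZ (-1 * (d / 2)) (eqMl (w 0%N) Ex00))))
  (eqD (eqD (eqZ (1) (eqMr (x 1%N) Cw10))
  (eqZ (-1) (eqMr (x 0%N) Cw11)))
  (eqD (eqZ (1 * (c / 2)) (eqMr (x 0%N) Cw10))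
  (eqZ (-1) (eqMr (x 2%N) Cw00)))))
  (eqD (eqD (eqZ (1) (eqMr (x 1%N) Cw01))
  (eqD (eqZ (-1 * (c / 2) - 1 * (d / 2)) (eqMr (x 1%N) Cw00))
  (eqZ (1 * (d / 2)) (eqMr (x 0%N) Cw01))))
  (eqD (eqD (eqZ (-1 * (d / 2) * (c / 2)) (eqMr (x 0%N) Cw00))
  (eqZ (-1) (eqMl (x 1%N) Cw10)))
  (eqD (eqZ (1) (eqMl (x 0%N) Cw11))
  (eqZ (1 * (c / 2)) (eqMl (x 0%N) Cw10))))))
  (eqD (eqD (eqD (eqZ (1) (eqMl (x 2%N) Cw00))
  (eqD (eqZ (-1) (eqMl (x 1%N) Cw01))
  (eqZ (-1 * (c / 2) - 1 * (d / 2)) (eqMl (x 1%N) Cw00))))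
  (eqD (eqD (eqZ (1 * (d / 2)) (eqMl (x 0%N) Cw01))
  (eqZ (1 * (d / 2) * (c / 2)) (eqMl (x 0%N) Cw00)))
  (eqD (eqZ (-1) (eqMr (w 1%N) Ex00))
  (eqZ (1) (eqMr (w 0%N) Ex10)))))
  (eqD (eqD (eqZ (-1 * (d / 2)) (eqMr (w 0%N) Ex00))
  (eqD (eqZ (-1) (eqMr (y s) Q01))
  (eqZ (1) (eqMr (y s.+1) Q00))))
  (eqD (eqD (eqZ (1 * (c / 2)) (eqMr (y s) Q00))
  (eqZ (1) (eqMl (y s) Q01)))
  (eqD (eqZ (-1) (eqMl (y s.+1) Q00))
  (eqZ (1 * (c / 2)) (eqMl (y s) Q00))))))))).
Qed.

(** For c_{i,tau i} = 0 plain commutators already produce the g's, one index lower than the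
    relations X do; this replaces the case m = -1 of [cross_hb_step]. *)
Lemma cross_hb_step1_disjoint :
  ⁅w 0%N, x 0%N⁆ = g 1%N -> ⁅w 0%N, x 1%N⁆ = g 2%N ->
  ⁅w 1%N, x 0%N⁆ = - g 2%N -> ⁅w 1%N, x 1%N⁆ = - g 3%N ->
  hb_step c e g y 1.
Proof.
move=> Q00 Q01 Q10 Q11 s; have Ex00 := xy 0%N s; have Ex01 := xy 0%N s.+1.
have Ew00 := wy 0%N s; have Ew01 := wy 0%N s.+1.
rewrite /ybr in Ex00 Ex01 Ew00 Ew01.
nc (eqZ (-1) (eqD (eqD (eqD (eqD (eqZ (1) (eqMl (w 1%N) Ex00))
  (eqD (eqZ (-1) (eqMl (w 0%N) Ex01))
  (eqZ (-1 * (e / 2)) (eqMl (w 0%N) Ex00))))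
  (eqD (eqD (eqZ (1) (eqMr (x 1%N) Ew00))
  (eqZ (-1) (eqMr (x 0%N) Ew01)))
  (eqD (eqZ (1 * (c / 2)) (eqMr (x 0%N) Ew00))
  (eqZ (-1) (eqMl (x 1%N) Ew00)))))
  (eqD (eqD (eqZ (1) (eqMl (x 0%N) Ew01))
  (eqD (eqZ (1 * (c / 2)) (eqMl (x 0%N) Ew00))
  (eqZ (-1) (eqMr (w 1%N) Ex00))))
  (eqD (eqD (eqZ (1) (eqMr (w 0%N) Ex01))
  (eqZ (-1 * (e / 2)) (eqMr (w 0%N) Ex00)))
  (eqD (eqZ (-1) (eqMr (y s) Q11))
  (eqZ (1) (eqMr (y s.+1) Q10))))))
  (eqD (eqD (eqD (eqZ (1 * (c / 2)) (eqMr (y s) Q10))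
  (eqD (eqZ (1) (eqMr (y s.+1) Q01))
  (eqZ (-1) (eqMr (y s.+2) Q00))))
  (eqD (eqD (eqZ (-1 * (e / 2) - 1 * (c / 2)) (eqMr (y s.+1) Q00))
  (eqZ (1 * (e / 2)) (eqMr (y s) Q01)))
  (eqD (eqZ (-1 * (c / 2) * (e / 2)) (eqMr (y s) Q00))
  (eqZ (1) (eqMl (y s) Q11)))))
  (eqD (eqD (eqZ (-1) (eqMl (y s.+1) Q10))
  (eqD (eqZ (1 * (c / 2)) (eqMl (y s) Q10))
  (eqZ (-1) (eqMl (y s.+1) Q01))))
  (eqD (eqD (eqZ (1) (eqMl (y s.+2) Q00))
  (eqZ (-1 * (e / 2) - 1 * (c / 2)) (eqMl (y s.+1) Q00)))
  (eqD (eqZ (1 * (e / 2)) (eqMl (y s) Q01))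
  (eqZ (1 * (c / 2) * (e / 2)) (eqMl (y s) Q00)))))))).
Qed.
End CrossHB.

(** * All relations in an algebra satisfying the finite presentation *)

Section FinitePresentation.
Variables (K : numFieldType) (A : algType K) (t : dynkin).
Local Notation I := 'I_(rank t).
Variable tau : I -> I.
Hypothesis dtau : diagram_involution tau.
Local Notation c := (@cK K t).

Section Model.
Variables (h b : I -> 'I_2 -> A).
Definition ht1 i := h i 1 - 2%:R^-1 *: (h i 0) ^+ 2.

(* R is equality in an algebra satisfying the relations, and [f u = f v] when they
   are transported along a morphism f. *)
Record iY01_relations (R : A -> A -> Prop) : Prop := {
  m_hh : forall i j r s, R ⁅h i r, h j s⁆ 0;
  m_h0 : forall i, R (h (tau i) 0) (- h i 0);
  m_h0b : forall i j r, R ⁅h i 0, b j r⁆ ((c i j - c (tau i) j) *: b j r);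
  m_h1b : forall i j, R ⁅h i 1, b j 0⁆
    ((c i j + c (tau i) j) *: b j 1
     + ((c i j - c (tau i) j) / 2%:R) *: ⦃h i 0, b j 0⦄);
  m_bb : forall i j, R (⁅b i 1, b j 0⁆ - ⁅b i 0, b j 1⁆)
    ((c i j / 2%:R) *: ⦃b i 0, b j 0⦄ - (2%:R * (tau i == j)%:R) *: h j 1);
  m_serre : forall u v, serre tau (h^~ 0) (b^~ 0) u v -> R u v;
  m_A1 : forall i, t = DynA 1 ->
    R ⁅h i 1, ⁅b i 1, ⁅h i 1, b i 1⁆⁆⁆ (4%:R *: ⁅b i 1 ^+ 2, h i 1⁆);
  m_A2a : forall i j : I, t = DynA 2 -> val i = 0%N -> val j = 1%N ->
    R (⁅b i 1, ⁅b i 1, b j 0⁆⁆ + ⁅b j 1, ⁅b j 1, b i 0⁆⁆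
       - 2%:R *: ⦃h i 0, b i 1⦄ - 2%:R *: ⦃h j 0, b j 1⦄) 0;
  m_A2b : forall i j : I, t = DynA 2 -> val i = 0%N -> val j = 1%N ->
    R (⁅⁅ht1 i, b i 1⁆, b j 1⁆ - ⁅b i 0, ⁅ht1 i, ⁅ht1 i, b j 1⁆⁆⁆
       + 2%:R^-1 *: ⁅ht1 i, ⦃b i 0, b j 1⦄⁆) 0 }.
Definition iY01_model := iY01_relations eq.
End Model.

Variables (h b : I -> 'I_2 -> A).
Hypothesis M : iY01_model h b.
Local Notation ht := (ht1 h).

Definition twist i : K := c i (tau i).
Definition lam i : K := 2%:R + twist i.

Fixpoint bseq i n : A :=
  if n is m.+1 then (lam i)^-1 *: ⁅ht i, bseq i m⁆ else b i 0.

(* hseq i 0 = 1 and hseq i r.+1 = h_{i,r}. *)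
Definition hseq i n : A := match n with
  | 0%N => 1
  | 1%N => h i 0
  | m.+2 => - 2%:R^-1 *: ybr (twist i / 2%:R) (bseq (tau i)) (bseq i) 0 m
  end.

Lemma hseqSS i n : hseq i n.+2 =
  - 2%:R^-1 *: ybr (twist i / 2%:R) (bseq (tau i)) (bseq i) 0 n.
Proof. by []. Qed.

Lemma cK_diag i : c i i = 2%:R. Proof. by rewrite /cK cartan_diag. Qed.
Lemma cK_sym i j : c i j = c j i. Proof. by rewrite /cK cartan_sym. Qed.
Lemma cK_tau i j : c (tau i) (tau j) = c i j. Proof. by rewrite /cK (cartan_tau dtau). Qed.
Lemma cK_tauC i j : c (tau i) j = c i (tau j). Proof. by rewrite /cK (cartan_tauC dtau). Qed.
Let tK := tauK dtau.

Lemma twist_tau i : twist (tau i) = twist i.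
Proof. by rewrite /twist tK cK_sym. Qed.

Lemma twist_cases i : [\/ tau i = i /\ twist i = 2%:R,
  tau i != i /\ twist i = 0 | tau i != i /\ twist i = -1].
Proof.
rewrite /twist /cK; have [[? ->]|[? ->]|[? ->]] := tau_cases tau i.
- by constructor 1.
- by constructor 2.
- by constructor 3.
Qed.

Lemma lam_neq0 i : lam i != 0.
Proof.
rewrite /lam; have [[_ ->]|[_ ->]|[_ ->]] := twist_cases i.
- by rewrite -natrD pnatr_eq0.
- by rewrite addr0 pnatr_eq0.
- by rewrite -(natrB _ (isT : (1 <= 2)%N)) pnatr_eq0.
Qed.

Definition across i j : K := c i j + c (tau i) j.
Lemma across_diag i : across i i = lam i.
Proof. by rewrite /across cK_diag cK_tauC. Qed.
Lemma across_sym i j : across i j = across j i.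
Proof. by rewrite /across (cK_tauC j) (cK_sym j (tau i)) (cK_sym j i). Qed.

Lemma across_tau i j : across i (tau j) = across i j.
Proof. by rewrite /across -cK_tauC cK_tau addrC. Qed.

Lemma ht_comm i j : ⁅ht i, ht j⁆ = 0.
Proof.
have hh := m_hh M; have H u v : ⁅u, v⁆ = 0 -> ⁅u, v ^+ 2⁆ = 0 :> A.
  by move=> uv; rewrite expr2 lieM uv mul0r mulr0 addr0.
have E k r : ⁅h k r, ht j⁆ = 0 by rewrite lieB lieZ H ?hh ?scaler0 ?subrr.
rewrite lieC lieB lieZ H; last by rewrite lieC E oppr0.
by rewrite lieC E scaler0 !oppr0 addr0 oppr0.
Qed.

Lemma ht_h i j r : ⁅ht i, h j r⁆ = 0.
Proof.
by rewrite lieC lieB lieZ expr2 lieM !(m_hh M) mul0r mulr0 addr0 scaler0 subrr oppr0.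
Qed.

(** h_{i,0} acts on b_j by a scalar, so the bracket with h_{i,0}^2/2 is exactly the anticommutator
    term of [m_h1b]. *)
Lemma ht_b0 i j : ⁅ht i, b j 0⁆ = across i j *: b j 1.
Proof.
rewrite /across; have E := m_h1b M i j; have F := m_h0b M i j 0; rewrite /ht1.
nc (eqD E (eqD (eqZ (- (1 / 2)) (eqMl (h i 0) F)) (eqZ (- (1 / 2)) (eqMr (h i 0) F)))).
Qed.

Lemma bseq0 i : bseq i 0 = b i 0. Proof. by []. Qed.

Lemma bseq1 i : bseq i 1 = b i 1.
Proof. by rewrite /= ht_b0 across_diag scalerA mulVf ?scale1r // lam_neq0. Qed.

(** [bseq j] is generated from b_{j,0} by [ht j], which commutes with [ht i]; the factor at index 0
    therefore persists. *)
Lemma ht_bseq i j n : ⁅ht i, bseq j n⁆ = across i j *: bseq j n.+1.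
Proof.
elim: n => [|n IH]; first by rewrite bseq1; exact: ht_b0.
rewrite /= lieZ lie_lie ht_comm /lie mul0r mulr0 subrr add0r -!/(lie _ _).
by rewrite IH lieZ !scalerA mulrC.
Qed.

Lemma h0_bseq i j n : ⁅h i 0, bseq j n⁆ = (c i j - c (tau i) j) *: bseq j n.
Proof.
elim: n => [|n IH]; first exact: (m_h0b M).
have E : ⁅h i 0, ht j⁆ = 0 by rewrite lieC ht_h oppr0.
by rewrite /= lieZ lie_lie E {1}/lie mul0r mulr0 subrr add0r IH lieZ !scalerA mulrC.
Qed.

Lemma hseq2 i : hseq i 2 = h i 1.
Proof.
rewrite /= /ybr !bseq1 /=; have E := m_bb M (tau i) i.
rewrite tK eqxx mulr1 cK_tauC -/(twist i) in E.
by nc (eqZ (- (1 / 2)) E).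
Qed.

Lemma rank_one_hseq i :
  rank_one_data (twist i) (bseq i) (bseq (tau i)) (hseq i) (ht i).
Proof.
split=> //.
- by move=> s; rewrite h0_bseq cK_diag cK_tauC.
- by move=> s; rewrite h0_bseq cK_diag.
- by rewrite hseq2 /ht1 expr2.
- by move=> s; rewrite ht_bseq across_diag.
- by move=> s; rewrite ht_bseq /across cK_diag addrC.
- by move=> n; rewrite /= add0n expr0; nc (erefl (0 : A)).
- exact: lam_neq0.
Qed.

Local Notation RO i := (rank_one_hseq i).
Local Notation bbu i n := (bb_upto (twist i) (bseq i) (bseq (tau i)) (hseq i) n).

Lemma split_tau i : twist i = 2%:R -> tau i = i.
Proof.
have n2 m : (m%:R = - 1 :> K) -> False.
  by move/eqP; rewrite -addr_eq0 -(natrD _ m 1) pnatr_eq0 addn1.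
have [[//]|[_ ->]|[_ ->]] := twist_cases i.
  by move/eqP; rewrite eq_sym pnatr_eq0.
by move=> /esym/n2.
Qed.

Lemma cK_cross i j : j != i -> j != tau i ->
  [\/ c i j = 0 /\ c (tau i) j = 0,
     [/\ c i j = -1, c (tau i) j = 0 & twist i = 0 /\ twist j = 0 \/
       twist i = 0 /\ twist j = -1 \/ twist i = -1 /\ twist j = 0],
     [/\ c i j = 0, c (tau i) j = -1 & twist i = 0 /\ twist j = 0 \/
       twist i = 0 /\ twist j = -1 \/ twist i = -1 /\ twist j = 0]
   | [/\ c i j = -1, c (tau i) j = -1 & twist i = 2%:R /\ twist j = 2%:R \/
       twist i = 2%:R /\ twist j = 0 \/ twist i = 0 /\ twist j = 2%:R]].
Proof.
move=> ji jti; have := cross_cases (tau := tau) ji jti; rewrite /cK /twist /cK.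
case=> [[-> ->]|[cij ctij]|[cij ctij]|[cij ctij]].
- by constructor 1.
- constructor 2; rewrite cij ctij; split=> //.
  by have [_ _ [[-> ->]|[-> ->]|[-> ->]]] := cross_single dtau ji jti cij ctij; tauto.
- constructor 3; rewrite cij ctij; split=> //.
  have jti' : j != tau (tau i) by rewrite tK.
  rewrite -(tK i) in cij; have := cross_single dtau jti jti' ctij cij.
  rewrite tK (cartan_sym (tau i)).
  by case=> _ _ [[-> ->]|[-> ->]|[-> ->]]; tauto.
- constructor 4; rewrite cij ctij; split=> //.
  by have [[-> ->]|[-> ->]|[-> ->]] := cross_both dtau ji jti cij ctij; tauto.
Qed.

Lemma det_neq0 i j : j != i -> j != tau i ->
  across i i * across j j - across i j * across j i != 0.
Proof.
move=> ji jti; rewrite (across_sym j) !(across_diag) /lam /across.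
(* The determinants are 3, 1, 1 if j is joined to one of i, tau i, and 12, 4, 4 if it is joined to
   both; [nz] takes the value minus one. *)
have nz (k : K) m : k = m.+1%:R -> k != 0 by move=> ->; rewrite pnatr_eq0.
have [[-> ->]|[-> -> E]|[-> -> E]|[-> -> E]] := cK_cross ji jti.
- rewrite addr0 mul0r subr0; exact: mulf_neq0 (lam_neq0 i) (lam_neq0 j).
- case: E => [[-> ->]|[[-> ->]|[-> ->]]];
    [apply: (@nz _ 2) | apply: (@nz _ 0) | apply: (@nz _ 0)]; ring.
- case: E => [[-> ->]|[[-> ->]|[-> ->]]];
    [apply: (@nz _ 2) | apply: (@nz _ 0) | apply: (@nz _ 0)]; ring.
- case: E => [[-> ->]|[[-> ->]|[-> ->]]];
    [apply: (@nz _ 11) | apply: (@nz _ 3) | apply: (@nz _ 3)]; ring.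
Qed.

Lemma serre_zero i j : c i j = 0 -> ⁅b i 0, b j 0⁆ = (tau i == j)%:R *: h j 0.
Proof.
move=> cij; apply: (m_serre M); apply: (serre_0 tau (h^~ 0) (b^~ 0)).
by apply/eqP; rewrite -(intr_eq0 K) -/(cK K i j) cij.
Qed.

Lemma ybr_cross i j : j != i -> j != tau i ->
  forall r s, ybr (c i j / 2%:R) (bseq i) (bseq j) r s = 0.
Proof.
move=> ji jti; apply: (@shift_pair_null _ _ _ (ht i) (ht j) _ _ _ _ _ _ (det_neq0 ji jti)).
- by move=> r s; apply: lie_ybr_shift => n; rewrite (ht_bseq).
- by move=> r s; apply: lie_ybr_shift => n; rewrite (ht_bseq).
have E := m_bb M i j; rewrite eq_sym (negbTE jti) in E.
rewrite mulr0 scale0r in E.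
by rewrite /ybr !(bseq1) !bseq0; nc E.
Qed.

Lemma lie_cross i j : j != i -> j != tau i -> c i j = 0 ->
  forall r s, ⁅bseq i r, bseq j s⁆ = 0.
Proof.
move=> ji jti cij.
apply: (@shift_pair_null _ _ _ (ht i) (ht j) _ _ _ _ _ _ (det_neq0 ji jti)).
- by move=> r s; rewrite lie_lie !(ht_bseq); nc (erefl (0 : A)).
- by move=> r s; rewrite lie_lie !(ht_bseq); nc (erefl (0 : A)).
by rewrite !bseq0 serre_zero // eq_sym (negbTE jti) scale0r.
Qed.

(** [ht i] kills h_{i,0} and h_{i,1}. Bracketing it with the Serre relation gives the sum of the two
    commutators of the next degree, and the relation at (0, 0), which has no anticommutator term
    here, gives their difference. The next degree is similar. *)
Lemma disjoint_lie i : twist i = 0 ->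
  [/\ ⁅bseq (tau i) 0, bseq i 0⁆ = hseq i 1, ⁅bseq (tau i) 0, bseq i 1⁆ = hseq i 2,
      ⁅bseq (tau i) 1, bseq i 0⁆ = - hseq i 2,
      ⁅bseq (tau i) 0, bseq i 2⁆ = hseq i 3 &
      ⁅bseq (tau i) 1, bseq i 1⁆ = - hseq i 3 /\
      ⁅bseq (tau i) 2, bseq i 0⁆ = hseq i 3].
Proof.
move=> ti; have D := RO i; rewrite ti in D; have l2 : lam i = 2%:R by rewrite /lam ti addr0.
have z0 : ⁅bseq (tau i) 0, bseq i 0⁆ = hseq i 1.
  by rewrite !bseq0 serre_zero ?tK ?eqxx ?scale1r // cK_sym.
have tg1 : ⁅ht i, hseq i 1⁆ = 0 by rewrite (lie_t_g D) lieC (lie_g1 D) oppr0.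
have tg2 : ⁅ht i, hseq i 2⁆ = 0 by rewrite (lie_t_g D) lie_self.
have Q0 := ro_X0 D 0; have Q1 := ro_X0 D 1.
rewrite /ybr ?add0n ?expr0 in Q0 Q1.
have tx := ro_tx D; have tw := ro_tw D; rewrite addr0 in tx tw.
have E1 := congr1 (lie (ht i)) z0; rewrite lie_lie !tx !tw tg1 in E1.
have z1 : ⁅bseq (tau i) 0, bseq i 1⁆ = hseq i 2.
  by nc (eqD (eqZ (1 / 4%:R) E1) (eqZ (- (1 / 2%:R)) Q0)).
have z1' : ⁅bseq (tau i) 1, bseq i 0⁆ = - hseq i 2.
  by nc (eqD (eqZ (1 / 4%:R) E1) (eqZ (1 / 2%:R) Q0)).
have E2 := congr1 (lie (ht i)) z1; rewrite lie_lie !tx !tw tg2 in E2.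
have E3 := congr1 (lie (ht i)) z1'; rewrite lie_lie !tx !tw lieN tg2 in E3.
have z2 : ⁅bseq (tau i) 0, bseq i 2⁆ = hseq i 3.
  by nc (eqD (eqZ (1 / 4%:R) E2) (eqZ (- (1 / 2%:R)) Q1)).
have z2' : ⁅bseq (tau i) 1, bseq i 1⁆ = - hseq i 3.
  by nc (eqD (eqZ (1 / 4%:R) E2) (eqZ (1 / 2%:R) Q1)).
split=> //; split=> //.
by nc (eqD (eqZ (1 / 2%:R) E3) (eqZ (-1) z2')).
Qed.

Lemma hb_any0 i j : hb_step (c i j) (c (tau i) j) (hseq i) (bseq j) 0.
Proof.
move=> s; have E := ht_bseq i j s; have F := h0_bseq i j s.
rewrite /ht1 expr2 /across -(hseq2) in E.
rewrite [hseq i 0]/= [hseq i 1]/=.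
nc (eqD E (eqD (eqZ (1 / 2) (eqMl (h i 0) F)) (eqZ (1 / 2) (eqMr (h i 0) F)))).
Qed.

Lemma split_data i : twist i = 2%:R ->
  [/\ hseq i 1 = 0, ht i = hseq i 2 &
      rank_one_data 2%:R (bseq i) (bseq i) (hseq i) (hseq i 2)].
Proof.
move=> ti; have tii := split_tau ti; have D := RO i; rewrite ti tii in D.
have g1 : hseq i 1 = 0.
  have := m_h0 M i; rewrite tii => /eqP; rewrite -addr_eq0 -mulr2n -scaler_nat.
  by rewrite scaler_eq0 pnatr_eq0 => /eqP.
have htE : ht i = hseq i 2 by rewrite (ro_t D) g1 mul0r scaler0 subr0.
by rewrite htE in D.
Qed.

Lemma hb_cross1 i j : j != i -> j != tau i ->
  hb_step (c i j) (c (tau i) j) (hseq i) (bseq j) 1.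
Proof.
move=> ji jti; have jtti : j != tau (tau i) by rewrite tK.
have xy := ybr_cross ji jti; have wy := ybr_cross jti jtti.
have X0 := ro_X0 (RO i).
have right k : j != k -> j != tau k -> c (tau k) j = 0 ->
    (forall n, ybr (twist k / 2%:R) (bseq (tau k)) (bseq k) 0 n
      + (2%:R * (-1) ^+ 0) *: hseq k (0 + n).+2 = 0) ->
    hb_step (c k j) (c (tau k) j) (hseq k) (bseq j) 1.
  move=> jk jtk e0 X; have := hb_any0 k j; rewrite e0 => hb0.
  apply: (cross_hb_step1_right (ybr_cross jk jtk) _ _ _ _ hb0 (X 0%N) (X 1%N)) => //.
    by apply: lie_cross => //; rewrite tK.
  by move=> s; rewrite (h0_bseq) e0 subr0.
(* The roles of i and tau i are exchanged, with [sgn_seq] for the g's. *)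
have left : c i j = 0 -> hb_step (c i j) (c (tau i) j) (hseq i) (bseq j) 1.
  move=> ci0; rewrite ci0; apply/hb_step_sgn.
  have hb0 : hb_step (c (tau i) j) 0 (sgn_seq (hseq i)) (bseq j) 0.
    by apply/hb_step_sgn; have := hb_any0 i j; rewrite ci0.
  have X1 := bb_upto2 (RO i).
  apply: (@cross_hb_step1_right _ _ (twist i) (c (tau i) j) 0
    (bseq (tau i)) (bseq i) (sgn_seq (hseq i)) (bseq j) wy _ _ _ _ hb0) => //.
  - exact: lie_cross.
  - by move=> s; rewrite /sgn_seq expr1 scaleN1r lieC lieN -lieC (h0_bseq) ci0 sub0r scaleNr opprK.
  - by rewrite /sgn_seq expr0 scale1r.
  - by have := X1 0%N 0%N isT; rewrite ybr_sym /sgn_seq !add0n expr0 sqrrN expr1n !scale1r.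
  - have := X1 1%N 0%N isT; rewrite ybr_sym /sgn_seq add0n addn0 expr0 expr1 => E.
    by nc E.
have [[_ e0]|[_ e0 _]|[ci0 _ _]|[ci ce E]] := cK_cross ji jti.
- exact: right.
- exact: right.
- exact: left.
have [ti|ti] : twist i = 2%:R \/ twist i = 0 by tauto.
  have [g1 _ D] := split_data ti.
  by move=> s; rewrite (split_g3 D) g1 ci ce; nc (erefl (0 : A)).
have [z0 z1 z1' _ [z2' _]] := disjoint_lie ti.
exact: cross_hb_step1_disjoint xy wy z0 z1 z1' z2'.
Qed.

Lemma hb_cross i j n : j != i -> j != tau i ->
  bb_upto (twist i) (bseq i) (bseq (tau i)) (hseq i) n.+1 ->
  hb_step (c i j) (c (tau i) j) (hseq i) (bseq j) n.
Proof.
move=> ji jti bbn; case: n bbn => [|[|m]] bbn; first exact: hb_any0.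
  exact: hb_cross1.
apply: (cross_hb_step (d := twist i)).
- exact: ybr_cross.
- by apply: ybr_cross; rewrite ?tK.
- by move=> a e a2 e2; apply: bbn; lia.
Qed.

(** The combination of [ht j] and [ht i] for which the shifts cancel commutes with b_i, b_{tau i}
    and the h's of i, hence with everything built from them. *)
Lemma ht_hseq_across i j n :
  ⁅ht j, hseq i n⁆ = (across i j / lam i) *: ⁅ht i, hseq i n⁆.
Proof.
have l0 := lam_neq0 i; pose u := ht j - (across i j / lam i) *: ht i.
suff u0 : ⁅u, hseq i n⁆ = 0 by rewrite /u in u0; nc u0.
have ux s : ⁅u, bseq i s⁆ = 0.
  have E := ht_bseq i i s; have F := ht_bseq j i s.
  rewrite (across_sym) in F; rewrite (across_diag) in E.
  rewrite /u.
  by nc (eqD F (eqZ (- (across i j / lam i)) E)).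
have uw s : ⁅u, bseq (tau i) s⁆ = 0.
  have E := ht_bseq i (tau i) s; have F := ht_bseq j (tau i) s.
  rewrite (across_tau) (across_diag) in E.
  rewrite (across_tau) (across_sym) in F.
  rewrite /u.
  by nc (eqD F (eqZ (- (across i j / lam i)) E)).
have uh r : ⁅u, h i r⁆ = 0.
  have E := ht_h j i r; have F := ht_h i i r; rewrite /u.
  by nc (eqD E (eqZ (- (across i j / lam i)) F)).
case: n => [|[|n]].
- by rewrite /= /lie mulr1 mul1r subrr.
- exact: uh.
rewrite hseqSS; move: (bseq i) (bseq (tau i)) ux uw => x w ux uw.
by rewrite lieZ /ybr !(lieE u) !ux !uw; nc (erefl (0 : A)).
Qed.

Lemma h0_hseq i j n : ⁅h i 0, hseq j n⁆ = 0.
Proof.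
case: n => [|[|n]]; [by rewrite /= /lie mulr1 mul1r subrr | exact: m_hh M _ _ _ _ |].
have E := h0_bseq i j; have F := h0_bseq i (tau j).
rewrite (cK_tau) -(cK_tauC) in F.
rewrite hseqSS; move: (bseq j) (bseq (tau j)) E F => x w E F.
by rewrite lieZ /ybr !(lieE (h i 0)) !E !F; nc (erefl (0 : A)).
Qed.

Lemma hseq2_hseq i j n : ⁅hseq i 2, hseq j n⁆ = ⁅ht i, hseq j n⁆.
Proof.
rewrite (hseq2) /ht1 expr2; have E := h0_hseq i j n.
nc (eqD (eqZ (1 / 2) (eqMl (h i 0) E)) (eqZ (1 / 2) (eqMr (h i 0) E))).
Qed.

Lemma hseq_low i j m : (m < 3)%N -> ⁅hseq i 2, hseq j m⁆ = 0.
Proof.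
move=> m3; rewrite hseq2_hseq; case: m m3 => [|[|[|]]] // _.
- by rewrite /= /lie mulr1 mul1r subrr.
- exact: ht_h _ _ _.
- by rewrite (hseq2); exact: ht_h _ _ _.
Qed.

Lemma hh_upto4 i : hh_upto (hseq i) 4.
Proof.
have g1 m : ⁅hseq i 1, hseq i m⁆ = 0 by exact: h0_hseq.
have g0 m : ⁅hseq i 0, hseq i m⁆ = 0 by rewrite /= /lie mulr1 mul1r subrr.
move=> [|[|[|[|[|]]]]] [|[|[|[|[|]]]]] // _; rewrite ?lie_self //;
  by rewrite lieC ?g1 ?g0 oppr0.
Qed.

Lemma bb_upto_le i m n : (m <= n)%N -> bbu i n -> bbu i m.
Proof. by move=> mn bbn r s rs; apply: bbn; apply: leq_trans mn. Qed.

Lemma newton_across j i N p : i != j -> i != tau j -> newton (hseq j) p ->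
  hh_upto (hseq j) N -> bbu j N.-1 -> forall n s, (n <= N)%N ->
  ⁅p n, bseq i s⁆ = shift_act (psum (c j i) (c (tau j) i) n) (bseq i) s.
Proof.
move=> ij itj gp hhN bbN n s nN; apply: (newton_action _ gp hhN) => //.
  by move=> _ r; exact: h0_bseq _ _ _.
move=> m mN; apply: (hb_cross ij itj); apply: bb_upto_le bbN; lia.
Qed.

(** These are the elements [t, g_{N+1}] of [row_defect] for N = 2 and N = 3, which the induction
    inside the orbit cannot remove by itself. *)
Definition defect3 i := ⁅ht i, hseq i 3⁆.
Definition defect4 i := ⁅ht i, hseq i 4⁆.

Lemma across_neq i j : j != i -> j != tau i -> i != j /\ i != tau j.
Proof.
move=> ji jti; rewrite eq_sym; split=> //.
by rewrite -(inj_eq (inv_inj tK)) tK eq_sym.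
Qed.

Lemma single_action i j : j != i -> j != tau i -> c i j = -1 -> c (tau i) j = 0 ->
  exists2 p, newton (hseq j) p &
    (forall s, ⁅p 3%N, bseq i s⁆ = shift_act (psum (-1) 0 3) (bseq i) s) /\
    (forall s, ⁅p 3%N, bseq (tau i) s⁆ = shift_act (psum 0 (-1) 3) (bseq (tau i)) s).
Proof.
move=> ji jti cij ctij; have [ij itj] := across_neq ji jti.
have [p gp] := newton_exists (ro_g0 (RO j)); exists p => //.
have bb2 := bb_upto2 (RO j).
have hh3 : hh_upto (hseq j) 3 by move=> a e ae; apply: (@hh_upto4 j); lia.
have cji : c j i = -1 by rewrite cK_sym.
have ctji : c (tau j) i = 0 by rewrite (cK_tauC) cK_sym.
split=> s; first by rewrite (newton_across ij itj gp hh3 bb2) // cji ctji.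
rewrite (newton_across _ _ gp hh3 bb2) ?(inj_eq (inv_inj tK)) //.
  by rewrite (cK_tau) -(cK_tauC) cji ctji.
by rewrite -(inj_eq (inv_inj tK)) tK.
Qed.

(** p_3 of the orbit of j is applied to the relation (0, 0) in the orbit of i. On g_2 it gives
    [defect3 j]; on the b's the X^2 coefficient -3 meets the entry (2, 0), which is 4/[lam i] times
    [defect3 i]. *)
Lemma pair_nonsplit i j : j != i -> j != tau i -> c i j = -1 -> c (tau i) j = 0 ->
  (2%:R / lam i) *: defect3 i + (lam j)^-1 *: defect3 j = 0.
Proof.
move=> ji jti cij ctij; have [ij itj] := across_neq ji jti.
have D := RO i; have bb2i := bb_upto2 D.
have [p gp [px pw]] := single_action ji jti cij ctij.
have cji : c j i = -1 by rewrite cK_sym.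
have ctji : c (tau j) i = 0 by rewrite (cK_tauC) cK_sym.
have E := ybr_psum_action (twist i / 2%:R) 0 0 px pw.
have pg : ⁅p 3%N, hseq i 2⁆ = - (3%:R *: ((across j i / lam j) *: defect3 j)).
  rewrite lieC (newton_comm (ro_g0 (RO j)) gp).
    by rewrite hseq2_hseq (ht_hseq_across).
  by move=> m; exact: hseq_low.
have x00 := ro_X0 D 0%N; have x01 := ro_X0 D 1%N; have x02 := ro_X0 D 2%N.
have x10 := bb2i 1%N 0%N isT; have x20 := row_defect D bb2i isT (isT : (2 <= 2)%N).
have f2 : (psum (-1) 0 3)`_2 = - 3%:R :> K by rewrite psum_lead; ring.
rewrite !big_ord_recr big_ord0 /= f2 ?add0n ?addn0 in E.
rewrite (_ : across j i = -1) in pg; last by rewrite /across cji ctji addr0.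
rewrite subnn in x20; rewrite ?add0n ?addn0 ?expr0 ?expr1 in x00 x01 x02 x10 x20.
have {x00} x00 : ybr (twist i / 2%:R) (bseq (tau i)) (bseq i) 0 0 = - (2%:R *: hseq i 2).
  by nc x00.
rewrite x00 in E.
rewrite lieN lieZ pg -/(defect3 i) in E x20 *.
have l1 := lam_neq0 i; have l2 := lam_neq0 j.
have E2 : (-1) ^+ 2 = 1 :> K by ring.
rewrite E2 expr0 expr1 in E x20.
rewrite -/(lam i) in x20; move: ((psum (-1) 0 3)`_1) E => f1 E.
nc (eqD (eqZ (- (1 / 6%:R)) E) (eqD (eqD (eqZ (- (f1 / 6%:R)) x01)
  (eqZ (- (f1 / 6%:R)) x10)) (eqD (eqZ (1 / 2%:R) x02) (eqZ (- (1 / 2%:R)) x20)))).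
Qed.

Lemma split_across i j : twist i = 2%:R -> c i j = -1 -> c (tau i) j = -1.
Proof. by move=> /split_tau ->. Qed.

Lemma split_row i : twist i = 2%:R ->
  [/\ ybr 1 (bseq i) (bseq i) 0 0 = - (2%:R *: hseq i 2),
      ybr 1 (bseq i) (bseq i) 0 1 = 0,
      ybr 1 (bseq i) (bseq i) 0 3 = - (2%:R *: hseq i 5) &
      ybr 1 (bseq i) (bseq i) 3 0 = 2%:R *: hseq i 5 - (3%:R / 2%:R) *: defect4 i].
Proof.
move=> ti; have [g1 tE D] := split_data ti.
have x0 := ro_X0 D 0%N; have x1 := ro_X0 D 1%N; have x3 := ro_X0 D 3%N.
have x30 := row_defect D (split_bb_upto3 D) isT (isT : (3 <= 3)%N).
rewrite (split_g3 D) in x1; rewrite /defect4 tE.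
rewrite subnn ?expr0 ?add0n ?addn0 in x0 x1 x3 x30.
rewrite /ybr in x0 x1 x3 x30 *.
split; [nc x0 | nc x1 | nc x3 |].
have E3 : (-1) ^+ 3 = -1 :> K by ring.
by rewrite E3 in x30; nc x30.
Qed.

(** Here p_3 acts by zero, so p_4 is used. Since [ybr] is symmetric for tau i = i and its entry (0,
    1) vanishes, only the X^3 coefficient -8 survives; it meets the defect of the entry (3, 0). *)
Lemma split_pair i j : twist i = 2%:R -> j != i -> j != tau i -> c i j = -1 ->
  defect3 j = 0 -> bbu j 3 -> 12%:R *: defect4 i = 8%:R *: ⁅ht i, hseq j 4⁆.
Proof.
move=> ti ji jti cij d3 bb3; have [ij itj] := across_neq ji jti.
have ctij := split_across ti cij.
have [p gp] := newton_exists (ro_g0 (RO j)).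
have cji : c j i = -1 by rewrite cK_sym.
have ctji : c (tau j) i = -1 by rewrite (cK_tauC) cK_sym.
have px s : ⁅p 4%N, bseq i s⁆ = shift_act (psum (-1) (-1) 4) (bseq i) s.
  by rewrite (newton_across ij itj gp (@hh_upto4 j) bb3) // cji ctji.
have E := ybr_psum_action 1 0 0 px px.
have pg : ⁅p 4%N, hseq i 2⁆ = - (4%:R *: ⁅ht i, hseq j 4⁆).
  rewrite lieC (newton_comm (ro_g0 (RO j)) gp).
    by rewrite hseq2_hseq.
  move=> m m4; case: (ltnP m 3) => m3; first exact: hseq_low.
  have -> : m = 3%N by lia.
  by rewrite hseq2_hseq (ht_hseq_across) -/(defect3 j) d3 scaler0.
have f3 : (psum (-1) (-1) 4)`_3 = - 8%:R :> K by rewrite psum_lead; ring.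
have [y0 y1 y3 y30] := split_row ti.
rewrite !big_ord_recr big_ord0 /= f3 ?add0n ?addn0 y0 y1 y3 y30 lieN lieZ pg in E.
rewrite (ybr_sym _ _ _ 0 1) y1 (ybr_sym _ _ _ 0 2) in E.
have E2 : (-1) ^+ 2 = 1 :> K by ring.
have E3 : (-1) ^+ 3 = -1 :> K by ring.
rewrite E2 E3 expr0 expr1 in E.
by nc (eqZ (-1) E).
Qed.

(** p_3 of j commutes with b_i because [psum (-1) (-1) 3] is zero, hence with g_2 of i. That
    commutator is also a nonzero multiple of [defect3 j]. *)
Lemma split_disjoint i j : twist i = 2%:R -> j != i -> j != tau i ->
  c i j = -1 -> defect3 j = 0.
Proof.
move=> ti ji jti cij; have [ij itj] := across_neq ji jti.
have ctij := split_across ti cij.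
have [p gp] := newton_exists (ro_g0 (RO j)).
have cji : c j i = -1 by rewrite cK_sym.
have ctji : c (tau j) i = -1 by rewrite (cK_tauC) cK_sym.
have bb2 := bb_upto2 (RO j).
have hh3 : hh_upto (hseq j) 3 by move=> a e ae; apply: (@hh_upto4 j); lia.
have px s : ⁅p 3%N, bseq i s⁆ = 0.
  rewrite (newton_across ij itj gp hh3 bb2) // cji ctji.
  have -> : psum (-1) (-1) 3 = 0 :> {poly K} by rewrite /psum; ring.
  by rewrite /shift_act size_poly0 big_ord0.
have [y0 _ _ _] := split_row ti.
have E := congr1 (lie (p 3%N)) y0; rewrite lieN lieZ in E.
rewrite lie_ybr0 // in E.
have {}E : ⁅p 3%N, hseq i 2⁆ = 0 by nc (eqZ (1 / 2%:R) E).
move: E; rewrite lieC (newton_comm (ro_g0 (RO j)) gp); last first.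
  by move=> m; exact: hseq_low.
rewrite hseq2_hseq (ht_hseq_across) -/(defect3 j) /across cji ctji.
have l2 := lam_neq0 j => E.
by nc (eqZ (lam j / 6%:R) E).
Qed.

Record complete i : Prop := {
  cp_bb : forall r s, ybr (twist i / 2%:R) (bseq (tau i)) (bseq i) r s
    + (2%:R * (-1) ^+ r) *: hseq i (r + s).+2 = 0;
  cp_hh : forall a e, ⁅hseq i a, hseq i e⁆ = 0;
  cp_hbx : forall n, hb_step 2%:R (twist i) (hseq i) (bseq i) n;
  cp_hbw : forall n, hb_step (twist i) 2%:R (hseq i) (bseq (tau i)) n }.

Lemma ybr_self i : tau i != i -> ybr 1 (bseq i) (bseq i) 0 0 = 0.
Proof.
move=> ti; have E := m_bb M i i; rewrite (negbTE ti) cK_diag mulr0 scale0r in E.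
rewrite /ybr (bseq1) bseq0; nc E.
Qed.

Lemma ybr_self1 i : tau i != i -> ybr 1 (bseq i) (bseq i) 1 0 = 0.
Proof.
move=> ti; have D := RO i; have E := congr1 (lie (ht i)) (ybr_self ti).
rewrite lie0 (lie_ybr_shift _ _ _ (ro_tx D) (ro_tx D)) (ybr_sym _ _ _ 1) in E.
have l0 := ro_d2 D; nc (eqZ (1 / (2%:R * (2%:R + twist i))) E).
Qed.

(** The bound reflects that only [bb_upto2] is available so far; [hseq_tau] removes it once the
    orbit is complete. *)
Lemma hseq_tau3 i n : (n <= 3)%N -> hseq (tau i) n = sgn_seq (hseq i) n.
Proof.
case: n => [|[|[|[|]]]] // _; rewrite /sgn_seq.
- by rewrite expr0 scale1r.
- by rewrite expr1 scaleN1r; exact: m_h0 M i.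
- rewrite sqrrN expr1n scale1r !hseqSS !tK ybr_sym.
  by rewrite (twist_tau).
have E := bb_upto2 (RO i) (isT : (1 + 0 < 2)%N).
have E3 : (-1) ^+ 3 = -1 :> K by ring.
rewrite E3 [hseq (tau i) 3]hseqSS tK ybr_sym (twist_tau).
by rewrite expr1 addn0 in E; nc (eqZ (- (1 / 2%:R)) E).
Qed.

Lemma hb_rel_tau i c1 c2 y :
  hb_rel c1 c2 (hseq (tau i)) y 1 = hb_rel c1 c2 (sgn_seq (hseq i)) y 1.
Proof. by rewrite /hb_rel !hseq_tau3. Qed.

Lemma complete_nonsplit i : tau i != i -> defect3 i = 0 ->
  hb_rel 2%:R (twist i) (hseq i) (bseq i) 1 = 0 ->
  hb_rel 2%:R (twist i) (hseq (tau i)) (bseq (tau i)) 1 = 0 -> complete i.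
Proof.
move=> ti d3 hbx; rewrite hb_rel_tau => hbw.
have tti : tau (tau i) != tau i by rewrite tK eq_sym.
have tw : twist i = 0 \/ twist i = -1.
  have [[/eqP]|[_ ->]|[_ ->]] := twist_cases i; [by rewrite (negbTE ti) | by left | by right].
have d2' : 2%:R - twist i != 0.
  case: tw => ->; first by rewrite subr0 pnatr_eq0.
  by rewrite opprK -(natrD _ 2 1) pnatr_eq0.
have [bb hh hb] := nonsplit_rank_one (RO i) d2' d3 (ybr_self ti) (ybr_self tti) hbx hbw tw.
by split=> // n; have [] := hb n.
Qed.

Lemma disjoint_complete i : twist i = 0 -> defect3 i = 0 -> complete i.
Proof.
move=> tw d3.
have ti : tau i != i.
  apply/eqP => E; move: tw; rewrite /twist E cK_diag => /eqP.
  by rewrite pnatr_eq0.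
have tti : tau (tau i) != tau i by rewrite tK eq_sym.
have rel k : tau k != k -> twist k = 0 -> hb_rel 2%:R (twist k) (hseq k) (bseq k) 1 = 0.
  move=> tk twk; have [z0 z1 _ z2 _] := disjoint_lie twk.
  by rewrite twk; apply: hb_rel_disjoint z0 z1 z2 (ybr_self1 tk).
apply: complete_nonsplit => //; first exact: rel.
by have := rel _ tti; rewrite (twist_tau); apply.
Qed.

Section Linked.
Variable i : I.
Hypothesis tw : twist i = -1.

Lemma linked_tau : tau i != i.
Proof.
apply/eqP => E; move: tw; rewrite /twist E cK_diag => /eqP.
by rewrite -addr_eq0 -(natrD _ 2 1) pnatr_eq0.
Qed.

Lemma linked_data :
  [/\ [/\ ybr (-1 / 2%:R) (bseq (tau i)) (bseq i) 0 0 = - 2%:R *: hseq i 2,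
          ybr (-1 / 2%:R) (bseq (tau i)) (bseq i) 0 1 = - 2%:R *: hseq i 3 &
          ybr (-1 / 2%:R) (bseq (tau i)) (bseq i) 1 0 = 2%:R *: hseq i 3],
      ybr 1 (bseq i) (bseq i) 0 0 = 0 /\ ybr 1 (bseq i) (bseq i) 0 1 = 0,
      (forall s, ⁅hseq i 1, bseq i s⁆ = 3%:R *: bseq i s) /\
      (forall s, ⁅hseq i 2, bseq i s⁆ =
         bseq i s.+1 + (3%:R / 2%:R) *: ⦃hseq i 1, bseq i s⦄) &
      [/\ ⁅bseq i 0, ⁅bseq i 0, bseq (tau i) 0⁆⁆ = 4%:R *: bseq i 0,
          forall s, ⁅ht i, bseq i s⁆ = bseq i s.+1 &
          forall s, ⁅ht i, bseq (tau i) s⁆ = bseq (tau i) s.+1]].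
Proof.
have D := RO i; have bb2 := bb_upto2 D.
have E0 := ro_X0 D 0%N; have E1 := ro_X0 D 1%N; have E2 := bb2 1%N 0%N isT.
have g1 s := ro_g1x D s; have hb0 := (hb_step0 D).1.
have tx s := ro_tx D s; have tw' s := ro_tw D s.
have l1 : 2%:R + twist i = 1 by rewrite tw; ring.
have l3 : 2%:R - twist i = 3%:R by rewrite tw; ring.
rewrite tw ?expr0 ?expr1 ?add0n ?addn0 in E0 E1 E2.
split; [split | split | split | split].
- by move: (ybr _ _ _ _ _) E0 => z E0; nc E0.
- by move: (ybr _ _ _ _ _) E1 => z E1; nc E1.
- by move: (ybr _ _ _ _ _) E2 => z E2; nc E2.
- exact: ybr_self linked_tau.
- by rewrite -ybr_sym; exact: ybr_self1 linked_tau.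
- by move=> s; rewrite g1 l3.
- move=> s; have E := hb0 s; rewrite l3 l1 (ro_g0 D) in E.
  by move: (hseq i) (bseq i) E => g x E; nc E.
- rewrite !bseq0; apply: (m_serre M); apply: (serre_tau (h^~ 0) (b^~ 0)).
  apply/eqP; rewrite -subr_eq0 -(intr_eq0 K) intrD -/(cK K i (tau i)).
  by rewrite -/(twist i) tw addNr.
- by move=> s; rewrite tx l1 scale1r.
- by move=> s; rewrite tw' l1 scale1r.
Qed.

Lemma linked_hb_rel : hb_rel 2%:R (twist i) (hseq i) (bseq i) 1 =
  - (3%:R / 2%:R) *: (⁅bseq i 1, ⁅bseq i 1, bseq (tau i) 0⁆⁆
                      - 2%:R *: ⦃hseq i 1, bseq i 1⦄).
Proof.
have [[X0 X1 X2] [Y0 Y1] [g1 g2] [sx tx tw']] := linked_data.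
by rewrite tw (hb_rel_linked X0 X1 X2 Y0 Y1 g1 g2 sx tx tw').
Qed.

Lemma linked_neighbour j : j != i -> j != tau i -> c i j = -1 -> c (tau i) j = 0 ->
  ⁅bseq i 1, ⁅bseq i 1, bseq (tau i) 0⁆⁆ = 2%:R *: ⦃hseq i 1, bseq i 1⦄.
Proof.
move=> ji jti cij ctij.
have [[X0 X1 X2] [Y0 Y1] [g1 g2] [sx tx tw']] := linked_data.
have [p _ [px pw]] := single_action ji jti cij ctij.
have f2 : (psum (-1) 0 3)`_2 = - 3%:R :> K by rewrite psum_lead; ring.
apply: (@linked_serre_shift _ _ _ _ _ X0 X1 X2 Y0 Y1 g2 sx _ tx tw' (p 3%N)
  (psum (-1) 0 3)`_0 (psum (-1) 0 3)`_1 (psum (-1) 0 3)`_2).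
- by rewrite f2 oppr_eq0 pnatr_eq0.
- by move=> s; rewrite px shift_act3 ?size_psum.
move=> s; rewrite pw shift_act3 ?size_psum // !(psum_swap (-1) 0).
by move: (bseq (tau i)) => w; nc (erefl (0 : A)).
Qed.
End Linked.

Hypothesis wf : wf_dynkin t.

Lemma complete_ybr i : tau i != i -> complete i ->
  forall r s, ybr 1 (bseq i) (bseq i) r s = 0.
Proof.
move=> ti C; have D := RO i; have [p gp] := newton_exists (ro_g0 D).
have px s : ⁅p 3%N, bseq i s⁆ = shift_act (psum 2%:R (twist i) 3) (bseq i) s.
  apply: (@newton_action _ _ _ _ 3 _ _ _ (ro_g0 D) gp) => //.
  - by move=> a e _; exact: cp_hh C a e.
  - by move=> _; exact: ro_g1x D.
  - by move=> n _; exact: cp_hbx C n.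
apply: (@ybr_all _ _ _ _ _ _ _ D (bseq i) (2%:R + twist i) (p 3%N)
   (psum 2%:R (twist i) 3)`_2 (psum 2%:R (twist i) 3)`_1 (psum 2%:R (twist i) 3)`_0).
- exact: ro_d2 D.
- rewrite psum_lead mulf_neq0 ?pnatr_eq0 //.
  have [[/eqP]|[_ ->]|[_ ->]] := twist_cases i; first by rewrite (negbTE ti).
    by rewrite mulr0 addr0 pnatr_eq0.
  have -> : 2%:R + (-1) ^+ 3 * -1 = 3%:R :> K by ring.
  by rewrite pnatr_eq0.
- exact: ro_tx D.
- by move=> s; rewrite px shift_act3 ?size_psum.
- exact: (ybr_self ti).
Qed.

Lemma split_complete i : twist i = 2%:R -> defect4 i = 0 -> complete i.
Proof.
move=> ti d4; have [g1 tE D] := split_data ti.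
rewrite /defect4 tE in d4; have [bb hh hb] := split_rank_one D g1 d4.
by split; rewrite ?ti ?(split_tau ti).
Qed.

Lemma split_defect3 i : twist i = 2%:R -> defect3 i = 0.
Proof.
by move=> ti; have [_ _ D] := split_data ti; rewrite /defect3 (split_g3 D) lie0.
Qed.

Lemma split_bb3 i : twist i = 2%:R -> bbu i 3.
Proof.
move=> ti; have [_ _ D] := split_data ti.
by rewrite ti (split_tau ti); exact: split_bb_upto3 D.
Qed.

Lemma defect3_tau i : defect3 (tau i) = - defect3 i.
Proof.
have E3 : (-1) ^+ 3 = -1 :> K by ring.
rewrite /defect3 (hseq_tau3) // /sgn_seq E3 scaleN1r lieN; congr (- ⁅_, _⁆).
have E2 := hseq_tau3 i (isT : (2 <= 3)%N).
rewrite /sgn_seq !(hseq2) sqrrN expr1n scale1r in E2.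
by rewrite /ht1 E2 (m_h0 M) sqrrN.
Qed.

Lemma linked_complete i : twist i = -1 -> defect3 i = 0 ->
  ⁅bseq i 1, ⁅bseq i 1, bseq (tau i) 0⁆⁆ = 2%:R *: ⦃hseq i 1, bseq i 1⦄ ->
  ⁅bseq (tau i) 1, ⁅bseq (tau i) 1, bseq i 0⁆⁆
    = 2%:R *: ⦃hseq (tau i) 1, bseq (tau i) 1⦄ -> complete i.
Proof.
move=> ti d3 s1 s2; have tti : twist (tau i) = -1 by rewrite (twist_tau).
apply: (complete_nonsplit (linked_tau ti) d3).
  by rewrite (linked_hb_rel ti) s1 subrr scaler0.
have := linked_hb_rel tti; rewrite (twist_tau) tK => ->.
by rewrite s2 subrr scaler0.
Qed.

(** * Types with a neighbouring orbit *)

Section Neighbours.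
Hypotheses (t1 : t <> DynA 1) (t2 : t <> DynA 2).

Let neighbour i : exists j, [/\ j != i, j != tau i & c i j = -1].
Proof.
have [j [ji jti cij]] := neighbour_exists wf dtau t1 t2 i.
by exists j; rewrite /cK cij.
Qed.

(** If j is joined to i only, [pair_nonsplit] for (i, j) and for (j, i) is a nonsingular linear
    system in the two defects. If j is joined to tau i as well, then tau j = j and [split_disjoint]
    applies. *)
Lemma defect3_zero i : tau i != i -> defect3 i = 0.
Proof.
move=> ti; have [j [ji jti cij]] := neighbour i.
have [ij itj] := across_neq ji jti.
have cji : c j i = -1 by rewrite cK_sym.
have ctE : c (tau j) i = c (tau i) j by rewrite (cK_tauC) cK_sym.
have [[c0 _]|[_ ct _]|[c0 _ _]|[_ _ E]] := cK_cross ji jti.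
- by move: cij; rewrite c0 => /eqP; rewrite eq_sym oppr_eq0 oner_eq0.
- have E1 := pair_nonsplit ji jti cij ct.
  have E2 := pair_nonsplit ij itj cji (etrans ctE ct).
  have l1 := lam_neq0 i; have l2 := lam_neq0 j.
  by nc (eqZ (lam i / 3%:R) (eqD (eqZ 2%:R E1) (eqZ (-1) E2))).
- by move: cij; rewrite c0 => /eqP; rewrite eq_sym oppr_eq0 oner_eq0.
have tj : twist j = 2%:R.
  by case: E => [[/split_tau/eqP]|[[/split_tau/eqP]|[]]] //; rewrite (negbTE ti).
exact: (split_disjoint tj ij itj cji).
Qed.

Lemma all_complete_generic i : complete i.
Proof.
have [j [ji jti cij]] := neighbour i.
have [ij itj] := across_neq ji jti.
have cji : c j i = -1 by rewrite cK_sym.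
have [[ti twi]|[ti twi]|[ti twi]] := twist_cases i; first last.
- have tti : tau (tau i) != tau i by rewrite tK eq_sym.
  have ct : c (tau i) j = 0.
    have n1 : (-1 : K) <> 0 by move/eqP; rewrite oppr_eq0 oner_eq0.
    have n2 : (-1 : K) <> 2%:R.
      by move/eqP; rewrite eq_sym -addr_eq0 -(natrD _ 2 1) pnatr_eq0.
    have [[c0 _]|[_ ct _]|[c0 _ _]|[_ _]] := cK_cross ji jti => //.
    - by move: cij; rewrite c0 => /esym/n1.
    - by move: cij; rewrite c0 => /esym/n1.
    by rewrite twi => -[[/n2]|[[/n2]|[/n1]]].
  apply: linked_complete => //; first exact: defect3_zero.
    exact: (linked_neighbour twi ji jti cij ct).
  have twti : twist (tau i) = -1 by rewrite (twist_tau).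
  have := linked_neighbour twti (j := tau j); rewrite !tK; apply.
  + by rewrite (inj_eq (inv_inj tK)).
  + by rewrite -(inj_eq (inv_inj tK)) tK.
  + by rewrite (cK_tau).
  + by rewrite -(cK_tauC).
- by apply: (disjoint_complete) => //; exact: defect3_zero.
apply: split_complete => //.
have ctij := split_across twi cij.
have l1 : lam i = 4%:R by rewrite /lam twi -natrD.
have cti : c (tau j) i = -1 by rewrite (cK_tauC) cK_sym.
have a2 : across j i = - 2%:R by rewrite /across cji cti; ring.
have [[twj0 tj]|[tj twj]|[tj twj]] := twist_cases j; first last.
- have [[c0 _]|[_ ct _]|[c0 _ _]|[_ _ E]] := cK_cross ji jti.
  + by move: cij; rewrite c0 => /eqP; rewrite eq_sym oppr_eq0 oner_eq0.
  + by move: ct; rewrite ctij => /eqP; rewrite oppr_eq0 oner_eq0.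
  + by move: cij; rewrite c0 => /eqP; rewrite eq_sym oppr_eq0 oner_eq0.
  have n1 : (-1 : K) <> 0 by move/eqP; rewrite oppr_eq0 oner_eq0.
  have n2 : (-1 : K) <> 2%:R.
    by move/eqP; rewrite eq_sym -addr_eq0 -(natrD _ 2 1) pnatr_eq0.
  by move: E; rewrite twj => -[[_ /n2]|[[_ /n1]|[_ /n2]]].
- have d3 := defect3_zero tj; have C := disjoint_complete twj d3.
  have bb3 : bbu j 3 by move=> r s _; exact: cp_bb C r s.
  have E := split_pair twi ji jti cij d3 bb3.
  rewrite (ht_hseq_across) -(hseq2_hseq) (cp_hh C) scaler0 scaler0 in E.
  by nc (eqZ (1 / 12%:R) E).
have l2 : lam j = 4%:R by rewrite /lam tj -natrD.
have a2' : across i j = - 2%:R by rewrite (across_sym).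
(* With both vertices fixed, the two [defect4] satisfy 12 D_i = -4 D_j and 12 D_j = -4 D_i, a system
   of determinant 128. *)
have E1 := split_pair twi ji jti cij (split_defect3 tj) (split_bb3 tj).
have E2 := split_pair tj ij itj cji (split_defect3 twi) (split_bb3 twi).
rewrite (ht_hseq_across) a2 l2 -/(defect4 _) in E1.
rewrite (ht_hseq_across) a2' l1 -/(defect4 _) in E2.
by nc (eqD (eqZ (3%:R / 32%:R) E1) (eqZ (- (1 / 32%:R)) E2)).
Qed.
End Neighbours.

(** By the relation at (1, 1), g_4 is a combination of [x_1, x_2] and x_1^2. The extra relation says
    exactly that g_2 commutes with it, that is, [h_{1,1}, h_{1,3}] = 0. *)
Lemma complete_A1 i : t = DynA 1 -> complete i.
Proof.
move=> t1; have rk1 : rank t = 1%N by rewrite t1.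
have lt1 (k : I) : (k < 1)%N := leq_trans (ltn_ord k) (eq_leq rk1).
have ti : tau i = i.
  by apply: val_inj; have := lt1 i; have := lt1 (tau i); rewrite /=; lia.
have tw : twist i = 2%:R by rewrite /twist ti cK_diag.
have [g1 tE D] := split_data tw.
apply: (split_complete tw); rewrite /defect4 tE.
have E := m_A1 M i t1.
have [y0 y1 y11] := split_ybr D.
have tx := ro_tx D 1%N; rewrite -(hseq2) -(bseq1) tx lieZ in E.
rewrite expr2 in E; move: (bseq i) (hseq i) E y11 => x g E y11.
have F := congr1 (lie (g 2%N)) y11; rewrite lieZ in F.
rewrite /ybr in F.
nc (eqD (eqZ (- (1 / 2%:R)) F) (eqZ (- (1 / 4%:R)) E)).
Qed.

Section RankTwo.
Hypothesis t2 : t = DynA 2.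

Lemma A2_twist i : tau i != i /\ twist i = -1.
Proof.
have rk2 : rank t = 2%N by rewrite t2.
have lt2 (k : I) : (k < 2)%N := leq_trans (ltn_ord k) (eq_leq rk2).
have ti : tau i != i.
  apply/eqP => ti; have [_ _ ntriv] := dtau; apply: ntriv; first by rewrite t2.
  move=> k; case: (eqVneq k i) => [->//|ki].
  have tki : tau k != i by rewrite -ti (inj_eq (inv_inj tK)).
  apply: val_inj; move: ki tki (lt2 k) (lt2 i) (lt2 (tau k)).
  by rewrite -!val_eqE /=; lia.
split=> //; rewrite /twist /cK.
suff -> : cartan t i (tau i) = -1 by [].
have adj2 (m n : nat) : (m < 2)%N -> (n < 2)%N -> m != n -> adj t m n.
  by rewrite t2 /adj /=; lia.
by apply/eqP; rewrite cartan_adj adj2 // val_eqE eq_sym.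
Qed.

(** The second extra relation is a sum of two relations between b_k and b_{tau k} in which h_3
    cancels; by [row_defect] these fail by -2 and 4 times [defect3], which must therefore vanish.
    The first one is the sum of the cubic identities for k and tau k. *)
Lemma complete_A2 i : complete i.
Proof.
have tw k := (A2_twist k).2.
have rk2 : rank t = 2%N by rewrite t2.
have lt2 (k : I) : (k < 2)%N := leq_trans (ltn_ord k) (eq_leq rk2).
have key k : val k = 0%N -> [/\ defect3 k = 0,
    ⁅bseq k 1, ⁅bseq k 1, bseq (tau k) 0⁆⁆ = 2%:R *: ⦃hseq k 1, bseq k 1⦄ &
    ⁅bseq (tau k) 1, ⁅bseq (tau k) 1, bseq k 0⁆⁆
      = 2%:R *: ⦃hseq (tau k) 1, bseq (tau k) 1⦄].
  move=> k0; have tk1 : val (tau k) = 1%N.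
    have := (A2_twist k).1; move: (lt2 (tau k)) (lt2 k) k0.
    by rewrite -val_eqE /=; lia.
  have [[X0 X1 X2] [Y0 Y1] [g1x g2x] [sx tx tw']] := linked_data (tw k).
  have D := RO k.
  have Eb := m_A2b M t2 k0 tk1.
  have Ea := m_A2a M t2 k0 tk1.
  have R1 := row_defect D (bb_upto2 D) isT (isT : (1 <= 2)%N).
  have R2 := row_defect D (bb_upto2 D) isT (isT : (2 <= 2)%N).
  have E2 : (-1) ^+ 2 = 1 :> K by ring.
  rewrite -!(bseq1) in Ea Eb; rewrite -!(bseq0) in Ea Eb.
  rewrite !tx !tw' lie_anti !tx !tw' in Eb.
  rewrite tw subnn ?expr1 ?E2 ?addn0 -[(1 + (2 - 1))%N]/2%N in R1 R2.
  have g1w s : ⁅hseq k 1, bseq (tau k) s⁆ = - 3%:R *: bseq (tau k) s.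
    by rewrite (ro_g1w D) tw; congr (_ *: _); ring.
  rewrite -/(defect3 k) -[(2 - 1)%N]/1%N in R1 R2.
  have g1w' : hseq (tau k) 1 = - hseq k 1 by exact: m_h0 M k.
  rewrite -[h k 0]/(hseq k 1) -[h (tau k) 0]/(hseq (tau k) 1) in Ea.
  rewrite !g1w' in Ea *.
  (* The two cubic identities have weights 3 and -3 under h_{k,0}, so this bracket separates
     them. *)
  have F := congr1 (lie (hseq k 1)) Ea.
  move: (defect3 k) (bseq k) (bseq (tau k)) (hseq k) g1x g1w R1 R2 Eb Ea F.
  move=> e x w g g1x g1w R1 R2 Eb Ea F; rewrite /ybr in R1 R2.
  rewrite lie0 !(lieE (g 1%N)) !g1x !g1w lie_self in F.
  split.
  - by nc (eqD (eqZ (- (1 / 2%:R)) (eqD R1 R2)) (eqZ (1 / 2%:R) Eb)).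
  - by nc (eqD (eqZ (1 / 6%:R) F) (eqZ (1 / 2%:R) Ea)).
  - by nc (eqD (eqZ (- (1 / 6%:R)) F) (eqZ (1 / 2%:R) Ea)).
have [k0|k1] : val i = 0%N \/ val i = 1%N by move: (lt2 i) => /=; lia.
  by have [d s1 s2] := key i k0; apply: (linked_complete (tw i)).
have ti0 : val (tau i) = 0%N.
  by have := (A2_twist i).1; move: (lt2 (tau i)) k1; rewrite -val_eqE /=; lia.
have [d s1 s2] := key (tau i) ti0; rewrite tK in s1 s2.
apply: (linked_complete (tw i)) => //.
by have := defect3_tau (tau i); rewrite d tK oppr0.
Qed.
End RankTwo.

Theorem all_complete i : complete i.
Proof.
have [t1|t1] := pselect (t = DynA 1); first exact: complete_A1.
have [t2|t2] := pselect (t = DynA 2); first exact: complete_A2.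
exact: all_complete_generic.
Qed.

Section FullDefinition.
Variables hf bf : I -> nat -> A.

Record iY_relations (R : A -> A -> Prop) : Prop := {
  f_hh : forall i j r s, R ⁅hf i r, hf j s⁆ 0;
  f_h0 : forall i, R (hf (tau i) 0%N) (- hf i 0%N);
  f_h0b : forall i j r, R ⁅hf i 0%N, bf j r⁆ ((c i j - c (tau i) j) *: bf j r);
  f_h1b : forall i j r, R ⁅hf i 1%N, bf j r⁆
    ((c i j + c (tau i) j) *: bf j r.+1
     + ((c i j - c (tau i) j) / 2%:R) *: ⦃hf i 0%N, bf j r⦄);
  f_hb : forall i j r s, R (⁅hf i r.+2, bf j s⁆ - ⁅hf i r, bf j s.+2⁆)
    (((c i j - c (tau i) j) / 2%:R) *: ⦃hf i r.+1, bf j s⦄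
     + ((c i j + c (tau i) j) / 2%:R) *: ⦃hf i r, bf j s.+1⦄
     + ((c i j * c (tau i) j) / 4%:R) *: ⁅hf i r, bf j s⁆);
  f_bb : forall i j r s, R (⁅bf i r.+1, bf j s⁆ - ⁅bf i r, bf j s.+1⁆)
    ((c i j / 2%:R) *: ⦃bf i r, bf j s⦄
     - (2%:R * (tau i == j)%:R * (-1) ^+ r) *: hf j (r + s).+1);
  f_serre : forall u v, serre tau (hf^~ 0%N) (bf^~ 0%N) u v -> R u v }.
Definition iY_model := iY_relations eq.
End FullDefinition.

(** * Commutation of all h's and the full list of relations *)

Section Extension.
Let C i : complete i := all_complete i.

Lemma hseq_tau i n : hseq (tau i) n = sgn_seq (hseq i) n.
Proof.
case: n => [|[|n]]; try exact: (hseq_tau3).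
have E := cp_bb (C i) n 0; rewrite addn0 in E.
rewrite hseqSS tK ybr_sym (twist_tau) /sgn_seq !exprS.
by move: (ybr _ _ _ _ _) E => z E; nc (eqZ (- (1 / 2%:R)) E).
Qed.

(** Now that the orbit of j is complete, its [ybr] at (r, s) is -2 (-1)^r g_{r+s+2}, and the
    alternating sums in [ybr_psum_action] cancel term by term. *)
Lemma newton_hseq i j p n m : j != i -> j != tau i -> newton (hseq i) p ->
  ⁅p n, hseq j m⁆ = 0.
Proof.
move=> ji jti gp.
have tji : tau j != i by rewrite -(inj_eq (inv_inj tK)) tK.
have tjti : tau j != tau i by rewrite (inj_eq (inv_inj tK)).
have hh : hh_upto (hseq i) n by move=> a e _; exact: cp_hh (C i) a e.
have bb : bbu i n.-1 by move=> r s _; exact: cp_bb (C i) r s.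
have px s : ⁅p n, bseq j s⁆ = shift_act (psum (c i j) (c (tau i) j) n) (bseq j) s.
  by rewrite (newton_across ji jti gp hh bb).
have pw s : ⁅p n, bseq (tau j) s⁆
    = shift_act (psum (c (tau i) j) (c i j) n) (bseq (tau j)) s.
  by rewrite (newton_across tji tjti gp hh bb) // (cK_tau) -(cK_tauC).
have h0 : ⁅p n, hseq j 1⁆ = 0.
  rewrite lieC (newton_comm (ro_g0 (RO i)) gp) ?(h0_hseq) ?scaler0 ?oppr0 //.
  by move=> *; exact: (h0_hseq).
case: m => [|[|m]] //; first by rewrite /= /lie mulr1 mul1r subrr.
rewrite hseqSS lieZ (ybr_psum_action _ _ _ px pw) big1 ?scaler0 // => k _.
have E r s : ybr (twist j / 2%:R) (bseq (tau j)) (bseq j) r s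
    = - ((2%:R * (-1) ^+ r) *: hseq j (r + s).+2).
  by apply/eqP; rewrite -addr_eq0 (cp_bb (C j)).
rewrite !E !add0n [(k + m)%N]addnC; move: (hseq j _) => z.
by rewrite scalerN opprK scalerA [X in _ + X *: _]mulrCA -expr2 sqrr_sign !mulr1 addNr scaler0.
Qed.

(** Newton's identity writes a g_a as a sum of p_k g_{a-k}: the p's commute with the g's of j by
    [newton_hseq], the shorter g's by induction, and k = 0 contributes nothing. *)
Lemma hseq_comm i j a e : ⁅hseq i a, hseq j e⁆ = 0.
Proof.
have [->|ji] := eqVneq j i; first exact: cp_hh (C i) a e.
have [->|jti] := eqVneq j (tau i).
  by rewrite hseq_tau lieZ (cp_hh (C i)) scaler0.
have [p gp] := newton_exists (ro_g0 (RO i)).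
elim/ltn_ind: a => a IH; case: a IH => [|a] IH; first by rewrite /= /lie mulr1 mul1r subrr.
have a0 : a.+1%:R != 0 :> K by rewrite pnatr_eq0.
apply: (scalerI a0); rewrite scaler0 lieC scalerN -lieZ gp.2 raddf_sum big1 ?oppr0 // => k _ /=.
rewrite lieM lieC (newton_hseq _ _ ji jti gp) oppr0 mul0r add0r.
case: (posnP k) => [->|k0]; first by rewrite gp.1 mul0r.
by rewrite lieC IH ?oppr0 ?mulr0 //; have := ltn_ord k; lia.
Qed.

Lemma hb_all i j n : hb_step (c i j) (c (tau i) j) (hseq i) (bseq j) n.
Proof.
have [->|ji] := eqVneq j i.
  by rewrite cK_diag (cK_tauC); exact: cp_hbx (C i) n.
have [->|jti] := eqVneq j (tau i).
  by rewrite cK_diag; exact: cp_hbw (C i) n.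
by apply: (hb_cross ji jti) => r s _; exact: cp_bb (C i) r s.
Qed.

Theorem iY_model_of_iY01 : iY_model (fun i r => hseq i r.+1) bseq.
Proof.
split.
- by move=> *; exact: hseq_comm.
- by move=> i; exact: m_h0 M i.
- by move=> i j r; exact: h0_bseq i j r.
- move=> i j r; have E := hb_all i j 0 r; rewrite [hseq i 0]/= in E.
  by move: (hseq i) (bseq j) E => g y E; nc E.
- by move=> i j r s; exact: hb_all.
- move=> i j r s; have [->|jti] := eqVneq j (tau i).
    rewrite mulr1; have E := cp_bb (C (tau i)) r s.
    rewrite tK (twist_tau) /twist in E.
    by move: (hseq _) (bseq _) (bseq _) E => g y z E; rewrite /ybr in E; nc E.
  rewrite mulr0 mul0r scale0r subr0.
  suff E : ybr (c i j / 2%:R) (bseq i) (bseq j) r s = 0 by rewrite /ybr in E; nc E.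
  have [ji|ji] := eqVneq j i; last exact: ybr_cross.
  rewrite ji eq_sym in jti *; rewrite cK_diag divff ?pnatr_eq0 //.
  exact: (complete_ybr).
- exact (m_serre M).
Qed.
End Extension.
End FinitePresentation.

(** * The full presentation implies the finite one *)

Section Restriction.
Variables (K : numFieldType) (A : algType K) (t : dynkin).
Local Notation I := 'I_(rank t).
Variable tau : I -> I.
Hypotheses (wf : wf_dynkin t) (dtau : diagram_involution tau).
Local Notation c := (@cK K t).
Variables (hf bf : I -> nat -> A).
Hypothesis F : iY_model tau hf bf.
Let tK := tauK dtau.
Local Notation twist := (@twist K t tau).
Local Notation ht i := (hf i 1%N - 2%:R^-1 *: hf i 0%N ^+ 2).

Lemma ht_bf i j s : ⁅ht i, bf j s⁆ = (c i j + c (tau i) j) *: bf j s.+1.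
Proof.
have E := f_h1b F i j s; have E0 := f_h0b F i j s.
nc (eqD E (eqD (eqZ (- (1 / 2)) (eqMl (hf i 0%N) E0)) (eqZ (- (1 / 2)) (eqMr (hf i 0%N) E0)))).
Qed.

(** The bracket of h_{1,1} with the relation at (1, 1), combined with [h_{1,1}, h_{1,3}] = 0. *)
Lemma restrict_A1 i : t = DynA 1 ->
  ⁅hf i 1%N, ⁅bf i 1%N, ⁅hf i 1%N, bf i 1%N⁆⁆⁆ = 4%:R *: ⁅bf i 1%N ^+ 2, hf i 1%N⁆.
Proof.
move=> t1; have ti : tau i = i.
  have rk1 : rank t = 1%N by rewrite t1.
  have lt1 (k : I) : (k < 1)%N := leq_trans (ltn_ord k) (eq_leq rk1).
  by apply: val_inj; have := lt1 i; have := lt1 (tau i); rewrite /=; lia.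
have h0 := f_h0 F i; rewrite ti in h0.
have {}h0 : hf i 0%N = 0 by nc (eqZ (1 / 2) h0).
have tx s := f_h1b F i i s; have B := f_bb F i i 1 1; have H := f_hh F i i 1 3.
rewrite ti cK_diag eqxx mulr1 expr1 -[(1 + 1).+1]/3%N in tx B.
have {}tx s : ⁅hf i 1%N, bf i s⁆ = 4%:R *: bf i s.+1.
  by rewrite tx h0 subrr mul0r scale0r addr0 -natrD.
have G := congr1 (lie (hf i 1%N)) B; rewrite tx expr2.
nc (eqD (eqZ (- 2) G) (eqZ (- 4) H)).
Qed.

Hypothesis t2 : t = DynA 2.

(** The sum of the relations at (0, 2) and (1, 1), whose h_3 terms have opposite signs. *)
Lemma restrict_A2b i :
  ⁅⁅ht i, bf i 1%N⁆, bf (tau i) 1%N⁆ - ⁅bf i 0%N, ⁅ht i, ⁅ht i, bf (tau i) 1%N⁆⁆⁆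
    + 2%:R^-1 *: ⁅ht i, ⦃bf i 0%N, bf (tau i) 1%N⦄⁆ = 0.
Proof.
have tw := (A2_twist K dtau wf t2 i).2.
have l1 : 2%:R + (-1) = 1 :> K by ring.
have tx s : ⁅ht i, bf i s⁆ = bf i s.+1.
  by rewrite ht_bf cK_diag (cK_tauC K dtau) -/(twist i) tw l1 scale1r.
have tw' s : ⁅ht i, bf (tau i) s⁆ = bf (tau i) s.+1.
  by rewrite ht_bf cK_diag -/(twist i) tw addrC l1 scale1r.
have B0 := f_bb F i (tau i) 0 2; have B1 := f_bb F i (tau i) 1 1.
move: (ht i) tx tw' => T tx tw'.
rewrite lie_anti !tx !tw'.
rewrite -/(twist i) tw eqxx !mulr1 expr1 in B0 B1.
rewrite -[(0 + 2).+1]/3%N -[(1 + 1).+1]/3%N in B0 B1.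
nc (eqD B0 B1).
Qed.

(** [hb_rel_linked] read backwards: its left side vanishes because the relation n = 1 belongs to the
    full presentation. The first extra relation of A_2 is the sum of this identity over the two
    vertices. *)
Lemma restrict_A2s i :
  ⁅bf i 1%N, ⁅bf i 1%N, bf (tau i) 0%N⁆⁆ = 2%:R *: ⦃hf i 0%N, bf i 1%N⦄.
Proof.
have tw := (A2_twist K dtau wf t2 i).2.
have l1 : 2%:R + (-1) = 1 :> K by ring.
have l3 : 2%:R - (-1) = 3%:R :> K by ring.
pose g n := if n is m.+1 then hf i m else 1.
have cti : c (tau i) i = -1 by rewrite (cK_tauC K dtau) -/(twist i) tw.
have B r s : ybr (-1 / 2%:R) (bf (tau i)) (bf i) r s
    = - (2%:R * (-1) ^+ r) *: hf i (r + s).+1.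
  have := f_bb F (tau i) i r s; rewrite tK eqxx cti mulr1 /ybr => E; nc E.
have BB r s : ybr 1 (bf i) (bf i) r s = 0.
  have := f_bb F i i r s.
  rewrite (negbTE (A2_twist K dtau wf t2 i).1) cK_diag mulr0 mul0r scale0r /ybr => E; nc E.
have g1 s : ⁅g 1%N, bf i s⁆ = 3%:R *: bf i s.
  by rewrite (f_h0b F) cK_diag cti l3.
have := @hb_rel_linked K A (bf i) (bf (tau i)) g.
move=> /(_ _ _ _ (BB 0 0)%N (BB 0 1)%N g1).
have -> : hb_rel 2%:R (-1) g (bf i) 1 = 0.
  have := f_hb F i i 0 0; rewrite cK_diag cti /hb_rel /= => E; nc E.
move=> E; apply/eqP; rewrite -subr_eq0; apply/eqP.
have n0 : - (3%:R / 2%:R) != 0 :> K by rewrite oppr_eq0 mulf_neq0 ?invr_eq0 ?pnatr_eq0.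
apply: (scalerI n0); rewrite scaler0; symmetry.
apply: (E _ _ _ _ _ (ht i)).
- by rewrite B expr0 mulr1.
- by rewrite B expr0 mulr1.
- by rewrite B expr1 mulrN1 opprK.
- by move=> s; rewrite /= (f_h1b F) cK_diag cti l1 l3 scale1r.
- by apply: (f_serre F); apply: serre_tau; move: tw; rewrite /twist /cK => /(@intr_inj _ _ (-1)).
- by move=> s; rewrite ht_bf cK_diag cti l1 scale1r.
- by move=> s; rewrite ht_bf cK_diag -/(twist i) tw addrC l1 scale1r.
Qed.
End Restriction.

Theorem iY01_model_of_iY (K : numFieldType) (A : algType K) t
    (tau : 'I_(rank t) -> 'I_(rank t)) (hf bf : 'I_(rank t) -> nat -> A) :
  wf_dynkin t -> diagram_involution tau -> iY_model tau hf bf ->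
  iY01_model tau (fun i (r : 'I_2) => hf i r) (fun i (r : 'I_2) => bf i r).
Proof.
move=> wf dtau F.
have tau2 i j : t = DynA 2 -> val i = 0%N -> val j = 1%N -> j = tau i.
  move=> t2 i0 j1; have [ti _] := A2_twist K dtau wf t2 i.
  have lt2 : (tau i < 2)%N by apply: leq_trans (ltn_ord _) _; rewrite t2.
  by apply: val_inj; move: ti lt2; rewrite -val_eqE /= j1 /= i0; lia.
split.
- by move=> *; exact: f_hh F _ _ _ _.
- exact (f_h0 F).
- by move=> *; exact: f_h0b F _ _ _.
- by move=> *; exact: f_h1b F _ _ _.
- by move=> i j; have := f_bb F i j 0 0; rewrite expr0 mulr1.
- exact (f_serre F).
- exact (restrict_A1 wf F).
- move=> i j t2 i0 j1; rewrite (tau2 i j t2 i0 j1).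
  have S := restrict_A2s wf dtau F t2 i; have S' := restrict_A2s wf dtau F t2 (tau i).
  rewrite (tauK dtau) in S'.
  suff E x y x' y' z z' : ⁅x, y⁆ = 2%:R *: z -> ⁅x', y'⁆ = 2%:R *: z' ->
    ⁅x, y⁆ + ⁅x', y'⁆ - 2%:R *: z - 2%:R *: z' = 0 :> A by exact (E _ _ _ _ _ _ S S').
  by move=> -> ->; rewrite addrAC addrK subrr.
- by move=> i j t2 i0 j1; rewrite (tau2 i j t2 i0 j1); exact (restrict_A2b wf dtau F t2 i).
Qed.

(** * Universal properties and the isomorphism *)

Section Evaluation.
Variables (K : fieldType) (G : choiceType) (B : algType K) (phi : G -> B).
Local Notation FA := (free_alg K G).

Definition word_eval (m : {fmonom G}) : B := \prod_(g <- (m : seq G)) phi g.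

Fact word_eval_morph : mmorphism word_eval.
Proof.
split=> [m m'|]; last by rewrite /word_eval fm1 big_nil.
by rewrite /word_eval fmM big_cat.
Qed.
HB.instance Definition _ := isMultiplicative.Build _ _ word_eval word_eval_morph.

Definition free_eval (x : FA) : B :=
  mmap (in_alg B) word_eval (x : {malg K[{fmonom G}]}).

Lemma free_eval_gen g : free_eval (free_gen K g) = phi g.
Proof. by rewrite /free_eval mmapU /= scale1r mul1r /word_eval fmU big_seq1. Qed.

Fact free_eval_additive : {morph free_eval : x y / x - y}.
Proof. by move=> x y; exact: mmapB. Qed.

Fact free_eval_multiplicative : monoid_morphism free_eval.
Proof.
split=> [|x y]; first exact: mmap1.
rewrite -[x * y]/(free_mul x y) free_mulE.
apply: (commr_mmap_is_multiplicative _).1 => g m m'.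
by rewrite /GRing.comm /= mulr_algl mulr_algr.
Qed.

Fact free_eval_scalable : scalable free_eval.
Proof.
move=> a x; rewrite -[a *: x]/(free_scale a x) free_scaleE.
by rewrite /free_eval mmapZ /= mulr_algl.
Qed.

HB.instance Definition _ :=
  GRing.isZmodMorphism.Build FA B free_eval free_eval_additive.
HB.instance Definition _ :=
  GRing.isMonoidMorphism.Build FA B free_eval free_eval_multiplicative.
HB.instance Definition _ :=
  GRing.isScalable.Build K FA B *:%R free_eval free_eval_scalable.
End Evaluation.

Lemma free_eval_unique (K : fieldType) (G : choiceType) (B : algType K)
    (f : {lrmorphism free_alg K G -> B}) :
  f =1 free_eval (f \o @free_gen K G).
Proof.
have f_mon (k : {fmonom G}) : f (<< k >> : {malg K[{fmonom G}]})
    = word_eval (f \o @free_gen K G) k.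
  case: k => s; elim: s => [|g s IH].
    by rewrite -(fmoneE G) [RHS]mmorph1 [LHS]rmorph1.
  have E : FMonom (g :: s) = mmul (fmu g) (FMonom s).
    by rewrite fmuE /mmul /= fmmulE.
  rewrite E [RHS]mmorphM /= -IH /word_eval fmU big_seq1 /= -rmorphM.
  rewrite -[X in _ = f X]/(free_mul _ _) free_mulE; congr (f _).
  by rewrite [RHS]malgM_def fgmulUU mulr1.
move=> x; rewrite /free_eval mmapE [in LHS](monalgE (x : {malg K[{fmonom G}]})).
rewrite [LHS]raddf_sum; apply: eq_bigr => k _ /=.
rewrite mulr_algl -f_mon -linearZ; congr (f _).
rewrite -[RHS]/(free_scale _ _) free_scaleE.
by apply/malgP => m; rewrite mcoeffZ !mcoeffU mulr_natr.
Qed.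

Section UniversalProperty.
Variables (K : fieldType) (G : choiceType) (rel : free_alg K G -> free_alg K G -> Prop).
Variables (B : algType K) (phi : G -> B).
Hypothesis sat : forall u v, rel u v -> free_eval phi u = free_eval phi v.

Definition pres_eval (x : pres_alg rel) : B := free_eval phi (pres_repr x).

Lemma free_eval_ideal x : in_ideal rel x -> free_eval phi x = 0.
Proof.
elim=> [|y z _ y0 _ z0|a u v b /sat uv]; first exact: raddf0.
  by rewrite raddfD /= y0 z0 addr0.
by rewrite !rmorphM rmorphB /= uv subrr mulr0 mul0r.
Qed.

Lemma pres_eval_pi x : pres_eval (pres_pi rel x) = free_eval phi x.
Proof.
apply/eqP; rewrite -subr_eq0 -raddfB; apply/eqP.
exact/free_eval_ideal/in_ideal_repr.
Qed.
Lemma pres_eval_additive : {morph pres_eval : x y / x - y}.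
Proof.
move=> x y; rewrite -[x]pres_reprK -[y]pres_reprK -pres_piB !pres_eval_pi.
exact: raddfB.
Qed.
Lemma pres_eval_multiplicative : pres_eval (pres_one rel) = 1 /\
  {morph pres_eval : x y / pres_mul x y >-> x * y}.
Proof.
split=> [|x y]; first by rewrite pres_eval_pi rmorph1.
by rewrite -[x]pres_reprK -[y]pres_reprK -pres_piM !pres_eval_pi rmorphM.
Qed.
Lemma pres_eval_scalable a : {morph pres_eval : x / pres_scale a x >-> a *: x}.
Proof. by move=> x; rewrite -[x]pres_reprK -pres_piZ !pres_eval_pi linearZ. Qed.

End UniversalProperty.

Section Morphisms.
Variables (K : numFieldType) (A B : algType K) (f : {lrmorphism A -> B}).

Lemma morph_lie x y : f ⁅x, y⁆ = ⁅f x, f y⁆.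
Proof. by rewrite rmorphB !rmorphM. Qed.
Lemma morph_anti x y : f ⦃x, y⦄ = ⦃f x, f y⦄.
Proof. by rewrite rmorphD !rmorphM. Qed.

Lemma morphD x y : f (x + y) = f x + f y. Proof. exact: rmorphD. Qed.
Lemma morphN x : f (- x) = - f x. Proof. exact: rmorphN. Qed.
Lemma morphZ a x : f (a *: x) = a *: f x. Proof. exact: linearZ. Qed.
Lemma morphX x n : f (x ^+ n) = f x ^+ n. Proof. exact: rmorphXn. Qed.
Lemma morph0 : f 0 = 0. Proof. exact: rmorph0. Qed.

Definition morphE := (morph_lie, morph_anti, morphD, morphN, morphZ, morphX, morph0).

Lemma serre_morph t (tau : 'I_(rank t) -> 'I_(rank t)) (h b : 'I_(rank t) -> A) u v :
  serre tau h b u v -> serre tau (f \o h) (f \o b) (f u) (f v).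
Proof.
case=> [i j c0|i c1|i j c1 ti tj|i j c1 ti]; rewrite !morphE.
- exact (@serre_0 K t tau B (f \o h) (f \o b) i j c0).
- exact (@serre_tau K t tau B (f \o h) (f \o b) i c1).
- exact (@serre_split K t tau B (f \o h) (f \o b) i j c1 ti tj).
- exact (@serre_fixed K t tau B (f \o h) (f \o b) i j c1 ti).
Qed.

(** No injectivity of f is involved: each constructor applied to the images has a lift given by the
    same constructor. *)
Lemma serre_morph_inv t (tau : 'I_(rank t) -> 'I_(rank t)) (h b : 'I_(rank t) -> A) u v :
  serre tau (f \o h) (f \o b) u v -> exists u' v', [/\ serre tau h b u' v', f u' = u & f v' = v].
Proof.
case=> [i j c0|i c1|i j c1 ti tj|i j c1 ti].
- by eexists; eexists; split; first exact: serre_0 c0; rewrite !morphE.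
- by eexists; eexists; split; first exact: serre_tau c1; rewrite !morphE.
- by eexists; eexists; split; first exact: serre_split c1 ti tj; rewrite !morphE.
- by eexists; eexists; split; first exact: serre_fixed c1 ti; rewrite !morphE.
Qed.

Variables (t : dynkin) (tau : 'I_(rank t) -> 'I_(rank t)).

Lemma iY_relations_morph (h b : 'I_(rank t) -> nat -> A) :
  iY_relations tau h b (fun u v => f u = f v) <->
  iY_model tau (fun i r => f (h i r)) (fun i r => f (b i r)).
Proof.
split=> M; split.
- by move=> i j r s; have := f_hh M i j r s; rewrite !morphE.
- by move=> i; have := f_h0 M i; rewrite !morphE.
- by move=> i j r; have := f_h0b M i j r; rewrite !morphE.
- by move=> i j r; have := f_h1b M i j r; rewrite !morphE.
- by move=> i j r s; have := f_hb M i j r s; rewrite !morphE.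
- by move=> i j r s; have := f_bb M i j r s; rewrite !morphE.
- move=> u v uv; have [u' [v' [uv' <- <-]]] := serre_morph_inv uv.
  exact: f_serre M _ _ uv'.
- by move=> i j r s; rewrite !morphE; exact: f_hh M i j r s.
- by move=> i; rewrite !morphE; exact: f_h0 M i.
- by move=> i j r; rewrite !morphE; exact: f_h0b M i j r.
- by move=> i j r; rewrite !morphE; exact: f_h1b M i j r.
- by move=> i j r s; rewrite !morphE; exact: f_hb M i j r s.
- by move=> i j r s; rewrite !morphE; exact: f_bb M i j r s.
- by move=> u v uv; exact: f_serre M _ _ (serre_morph uv).
Qed.

Lemma iY01_relations_morph (h b : 'I_(rank t) -> 'I_2 -> A) :
  iY01_relations tau h b (fun u v => f u = f v) <->
  iY01_model tau (fun i r => f (h i r)) (fun i r => f (b i r)).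
Proof.
split=> M; split.
- by move=> i j r s; have := m_hh M i j r s; rewrite !morphE.
- by move=> i; have := m_h0 M i; rewrite !morphE.
- by move=> i j r; have := m_h0b M i j r; rewrite !morphE.
- by move=> i j; have := m_h1b M i j; rewrite !morphE.
- by move=> i j; have := m_bb M i j; rewrite !morphE.
- move=> u v uv; have [u' [v' [uv' <- <-]]] := serre_morph_inv uv.
  exact: m_serre M _ _ uv'.
- by move=> i t1; have := m_A1 M i t1; rewrite !morphE.
- by move=> i j t2 i0 j1; have := m_A2a M t2 i0 j1; rewrite !morphE.
- by move=> i j t2 i0 j1; have := m_A2b M t2 i0 j1; rewrite /ht1 !morphE.
- by move=> i j r s; rewrite !morphE; exact: m_hh M i j r s.
- by move=> i; rewrite !morphE; exact: m_h0 M i.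
- by move=> i j r; rewrite !morphE; exact: m_h0b M i j r.
- by move=> i j; rewrite !morphE; exact: m_h1b M i j.
- by move=> i j; rewrite !morphE; exact: m_bb M i j.
- by move=> u v uv; exact: m_serre M _ _ (serre_morph uv).
- by move=> i t1; rewrite !morphE; exact: m_A1 M i t1.
- by move=> i j t2 i0 j1; rewrite !morphE; exact: m_A2a M i j t2 i0 j1.
- by move=> i j t2 i0 j1; rewrite /ht1 !morphE; exact: m_A2b M i j t2 i0 j1.
Qed.
End Morphisms.

Section Presentations.
Variables (K : numFieldType) (t : dynkin).
Local Notation I := 'I_(rank t).
Variable tau : I -> I.
Local Notation c := (@cK K t).
Local Notation iY := (iYangian K tau).
Local Notation iY01 := (iYangian01 K tau).
Local Notation FA := (free_alg K (iY_gen t nat)).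
Local Notation FA01 := (free_alg K (iY_gen t 'I_2)).

Definition iY_pi : FA -> iY := pres_pi (@iY_rel K t tau).
Definition iY01_pi : FA01 -> iY01 := pres_pi (@iY01_rel K t tau).

Fact iY_pi_multiplicative : monoid_morphism iY_pi.
Proof. by split=> [|x y] //; exact: pres_piM. Qed.
HB.instance Definition _ := GRing.isZmodMorphism.Build FA iY iY_pi
  (@pres_piB _ _ (@iY_rel K t tau)).
HB.instance Definition _ := GRing.isMonoidMorphism.Build FA iY iY_pi
  iY_pi_multiplicative.
HB.instance Definition _ := GRing.isScalable.Build K FA iY *:%R iY_pi
  (@pres_piZ _ _ (@iY_rel K t tau)).

Fact iY01_pi_multiplicative : monoid_morphism iY01_pi.
Proof. by split=> [|x y] //; exact: pres_piM. Qed.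
HB.instance Definition _ := GRing.isZmodMorphism.Build FA01 iY01 iY01_pi
  (@pres_piB _ _ (@iY01_rel K t tau)).
HB.instance Definition _ := GRing.isMonoidMorphism.Build FA01 iY01 iY01_pi
  iY01_pi_multiplicative.
HB.instance Definition _ := GRing.isScalable.Build K FA01 iY01 *:%R iY01_pi
  (@pres_piZ _ _ (@iY01_rel K t tau)).

Lemma iY_pi_rel u v : iY_rel tau u v -> iY_pi u = iY_pi v.
Proof.
move=> uv; apply/pres_pi_eq; rewrite -[_ - _]mul1r -[_ * _]mulr1.
exact: in_ideal_rel.
Qed.

Lemma iY01_pi_rel u v : iY01_rel tau u v -> iY01_pi u = iY01_pi v.
Proof.
move=> uv; apply/pres_pi_eq; rewrite -[_ - _]mul1r -[_ * _]mulr1.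
exact: in_ideal_rel.
Qed.

Lemma iY_generators : iY_model tau (iY_h K tau) (iY_b K tau).
Proof.
refine (proj1 (iY_relations_morph iY_pi tau (@free_h K t nat) (@free_b K t nat)) _).
split.
- exact (fun i j r s => iY_pi_rel (iY_hh K tau i j r s)).
- exact (fun i => iY_pi_rel (iY_h0 K tau i)).
- exact (fun i j r => iY_pi_rel (iY_h0b K tau i j r)).
- exact (fun i j r => iY_pi_rel (iY_h1b K tau i j r)).
- exact (fun i j r s => iY_pi_rel (iY_hb K tau i j r s)).
- exact (fun i j r s => iY_pi_rel (iY_bb K tau i j r s)).
- exact (fun u v uv => iY_pi_rel (iY_serre uv)).
Qed.

Lemma iY01_generators : iY01_model tau (iY01_h K tau) (iY01_b K tau).
Proof.
refine (proj1 (iY01_relations_morph iY01_pi tau (@free_h K t 'I_2) (@free_b K t 'I_2)) _).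
split.
- exact (fun i j r s => iY01_pi_rel (iY01_hh K tau i j r s)).
- exact (fun i => iY01_pi_rel (iY01_h0 K tau i)).
- exact (fun i j r => iY01_pi_rel (iY01_h0b K tau i j r)).
- exact (fun i j => iY01_pi_rel (iY01_h1b K tau i j)).
- exact (fun i j => iY01_pi_rel (iY01_bb K tau i j)).
- exact (fun u v uv => iY01_pi_rel (iY01_serre uv)).
- exact (fun i t1 => iY01_pi_rel (iY01_A1 K tau i t1)).
- exact (fun i j t2 i0 j1 => iY01_pi_rel (iY01_A2a K tau t2 i0 j1)).
- exact (fun i j t2 i0 j1 => iY01_pi_rel (iY01_A2b K tau t2 i0 j1)).
Qed.

Section Evaluations.
Variable B : algType K.

Definition gen_image (L : choiceType) (h b : I -> L -> B) (g : iY_gen t L) : B :=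
  match g with inl p => h p.1 p.2 | inr p => b p.1 p.2 end.

Lemma iY_sat (hf bf : I -> nat -> B) : iY_model tau hf bf ->
  forall u v, iY_rel tau u v ->
    free_eval (gen_image hf bf) u = free_eval (gen_image hf bf) v.
Proof.
move=> F; set f := free_eval _.
have M : iY_relations tau (@free_h K t nat) (@free_b K t nat)
    (fun u v => f u = f v).
  apply/iY_relations_morph.
  have -> : (fun i r => f (free_h K i r)) = hf.
    by apply: funext => i; apply: funext => r; exact: free_eval_gen.
  suff -> : (fun i r => f (free_b K i r)) = bf by [].
  by apply: funext => i; apply: funext => r; exact: free_eval_gen.
move=> u v; case=> [i j r s|i|i j r|i j r|i j r s|i j r s|{}u {}v uv].
- exact: f_hh M _ _ _ _.
- exact: f_h0 M _.
- exact: f_h0b M _ _ _.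
- exact: f_h1b M _ _ _.
- exact: f_hb M _ _ _ _.
- exact: f_bb M _ _ _ _.
- exact: f_serre M _ _ uv.
Qed.

Lemma iY01_sat (h b : I -> 'I_2 -> B) : iY01_model tau h b ->
  forall u v, iY01_rel tau u v ->
    free_eval (gen_image h b) u = free_eval (gen_image h b) v.
Proof.
move=> F; set f := free_eval _.
have M : iY01_relations tau (@free_h K t 'I_2) (@free_b K t 'I_2)
    (fun u v => f u = f v).
  apply/iY01_relations_morph.
  have -> : (fun i r => f (free_h K i r)) = h.
    by apply: funext => i; apply: funext => r; exact: free_eval_gen.
  suff -> : (fun i r => f (free_b K i r)) = b by [].
  by apply: funext => i; apply: funext => r; exact: free_eval_gen.
move=> u v; case=> [i j r s|i|i j r|i j|i j|{}u {}v uv|i t1|i j t2 i0 j1|i j t2 i0 j1].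
- exact: m_hh M _ _ _ _.
- exact: m_h0 M _.
- exact: m_h0b M _ _ _.
- exact: m_h1b M _ _.
- exact: m_bb M _ _.
- exact: m_serre M _ _ uv.
- exact: m_A1 M _ t1.
- exact: m_A2a M _ _ t2 i0 j1.
- exact: m_A2b M _ _ t2 i0 j1.
Qed.
End Evaluations.
End Presentations.

Section Universal.
Variables (K : numFieldType) (t : dynkin).
Local Notation I := 'I_(rank t).
Variable tau : I -> I.
Local Notation iY := (iYangian K tau).
Local Notation iY01 := (iYangian01 K tau).
Variable B : algType K.

Section Full.
Variables hf bf : I -> nat -> B.

(* The unused argument lets the morphism instances below depend on the relations. *)
Definition iY_eval of iY_model tau hf bf : iY -> B :=
  @pres_eval K _ (@iY_rel K t tau) B (gen_image hf bf).

Variable F : iY_model tau hf bf.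
HB.instance Definition _ := GRing.isZmodMorphism.Build iY B (iY_eval F)
  (pres_eval_additive (iY_sat F)).
HB.instance Definition _ := GRing.isMonoidMorphism.Build iY B (iY_eval F)
  (pres_eval_multiplicative (iY_sat F)).
HB.instance Definition _ := GRing.isScalable.Build K iY B *:%R (iY_eval F)
  (pres_eval_scalable (iY_sat F)).

Lemma iY_eval_h i r : iY_eval F (iY_h K tau i r) = hf i r.
Proof.
by rewrite /iY_eval /iY_h /pres_gen (pres_eval_pi (iY_sat F)) free_eval_gen.
Qed.
Lemma iY_eval_b i r : iY_eval F (iY_b K tau i r) = bf i r.
Proof.
by rewrite /iY_eval /iY_b /pres_gen (pres_eval_pi (iY_sat F)) free_eval_gen.
Qed.
End Full.

Section Finite.
Variables h b : I -> 'I_2 -> B.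

Definition iY01_eval of iY01_model tau h b : iY01 -> B :=
  @pres_eval K _ (@iY01_rel K t tau) B (gen_image h b).

Variable F : iY01_model tau h b.
HB.instance Definition _ := GRing.isZmodMorphism.Build iY01 B (iY01_eval F)
  (pres_eval_additive (iY01_sat F)).
HB.instance Definition _ := GRing.isMonoidMorphism.Build iY01 B (iY01_eval F)
  (pres_eval_multiplicative (iY01_sat F)).
HB.instance Definition _ := GRing.isScalable.Build K iY01 B *:%R (iY01_eval F)
  (pres_eval_scalable (iY01_sat F)).

Lemma iY01_eval_h i r : iY01_eval F (iY01_h K tau i r) = h i r.
Proof.
by rewrite /iY01_eval /iY01_h /pres_gen (pres_eval_pi (iY01_sat F)) free_eval_gen.
Qed.
Lemma iY01_eval_b i r : iY01_eval F (iY01_b K tau i r) = b i r.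
Proof.
by rewrite /iY01_eval /iY01_b /pres_gen (pres_eval_pi (iY01_sat F)) free_eval_gen.
Qed.
End Finite.

Lemma iY_morph_ext (f g : {lrmorphism iY -> B}) :
  (forall i r, f (iY_h K tau i r) = g (iY_h K tau i r)) ->
  (forall i r, f (iY_b K tau i r) = g (iY_b K tau i r)) -> f =1 g.
Proof.
move=> eh eb x.
pose E (k : {lrmorphism iY -> B}) := free_eval_unique (k \o iY_pi tau).
rewrite -[x]pres_reprK; apply: etrans (E f _) _; apply: etrans _ (esym (E g _)).
congr (free_eval _ _); apply: funext => [] [] [i r]; [exact (eh i r)|exact (eb i r)].
Qed.

Lemma iY01_morph_ext (f g : {lrmorphism iY01 -> B}) :
  (forall i r, f (iY01_h K tau i r) = g (iY01_h K tau i r)) ->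
  (forall i r, f (iY01_b K tau i r) = g (iY01_b K tau i r)) -> f =1 g.
Proof.
move=> eh eb x.
pose E (k : {lrmorphism iY01 -> B}) := free_eval_unique (k \o iY01_pi tau).
rewrite -[x]pres_reprK; apply: etrans (E f _) _; apply: etrans _ (esym (E g _)).
congr (free_eval _ _); apply: funext => [] [] [i r]; [exact (eh i r)|exact (eb i r)].
Qed.

End Universal.

(** * The constructed elements are mapped to the generators *)

Section Comparison.
Variables (K : numFieldType) (A B : algType K) (t : dynkin).
Local Notation I := 'I_(rank t).
Variable tau : I -> I.
Hypothesis dtau : diagram_involution tau.
Variables (h b : I -> 'I_2 -> A) (hf bf : I -> nat -> B).
Hypothesis N : iY_model tau hf bf.
Variable f : {lrmorphism A -> B}.
Hypotheses (fh : forall i r, f (h i r) = hf i r) (fb : forall i r, f (b i r) = bf i r).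

(** A morphism that is right on the indices 0 and 1 is right on all of them: in the full
    presentation [ht_bf] is the recursion by which [bseq] is defined. *)
Lemma morph_bseq i n : f (bseq tau h b i n) = bf i n.
Proof.
elim: n => [|n IH]; first exact: fb.
rewrite [bseq _ _ _ _ _]/= !morphE IH !fh (ht_bf N) -/(across K tau i i).
by rewrite (across_diag K dtau) scalerA mulVf ?scale1r ?lam_neq0.
Qed.

Lemma morph_hseq i n : f (hseq tau h b i n.+1) = hf i n.
Proof.
case: n => [|n]; first exact: fh.
have E := f_bb N (tau i) i 0 n.
rewrite hseqSS /ybr; move: (morph_bseq i) (morph_bseq (tau i)).
move: (bseq _ _ _ i) (bseq _ _ _ (tau i)) => x y ex ey; rewrite !morphE !ex !ey.
rewrite (tauK dtau) eqxx (cK_tauC K dtau) expr0 !mulr1 add0n in E.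
by rewrite -/(twist K tau i) in E; nc (eqZ (- (1 / 2%:R)) E).
Qed.
End Comparison.

Section Isomorphism.
Variables (K : numFieldType) (t : dynkin) (tau : 'I_(rank t) -> 'I_(rank t)).
Hypotheses (wf : wf_dynkin t) (dtau : diagram_involution tau).
Local Notation iY := (iYangian K tau).
Local Notation iY01 := (iYangian01 K tau).
Let M := iY01_generators K tau.
Let N := iY_generators K tau.

Definition iY01_to_iY : iY01 -> iY := iY01_eval (iY01_model_of_iY wf dtau N).
Definition iY_to_iY01 : iY -> iY01 := iY_eval (iY_model_of_iY01 dtau M wf).
HB.instance Definition _ := GRing.LRMorphism.on iY01_to_iY.
HB.instance Definition _ := GRing.LRMorphism.on iY_to_iY01.

Lemma iY01_to_iY_h i r : iY01_to_iY (iY01_h K tau i r) = iY_h K tau i r.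
Proof. exact: iY01_eval_h. Qed.
Lemma iY01_to_iY_b i r : iY01_to_iY (iY01_b K tau i r) = iY_b K tau i r.
Proof. exact: iY01_eval_b. Qed.

Lemma iY01_to_iYK : cancel iY01_to_iY iY_to_iY01.
Proof.
have I2 (r : 'I_2) : r = 0 \/ r = 1.
  by case: r => [[|[|//]] ltr]; [left|right]; exact: val_inj.
apply: (iY01_morph_ext (f := iY_to_iY01 \o iY01_to_iY) (g := idfun)) => i r.
  rewrite /= iY01_to_iY_h [LHS]iY_eval_h.
  by have [->|->] := I2 r => //; exact (hseq2 dtau M i).
rewrite /= iY01_to_iY_b [LHS]iY_eval_b.
by have [->|->] := I2 r => //; exact (bseq1 dtau M i).
Qed.

Lemma iY_to_iY01K : cancel iY_to_iY01 iY01_to_iY.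
Proof.
apply: (iY_morph_ext (f := iY01_to_iY \o iY_to_iY01) (g := idfun)) => i r.
  rewrite /= [iY_to_iY01 _]iY_eval_h.
  exact (morph_hseq dtau N iY01_to_iY_h iY01_to_iY_b i r).
rewrite /= [iY_to_iY01 _]iY_eval_b.
exact (morph_bseq dtau N iY01_to_iY_h iY01_to_iY_b i r).
Qed.
End Isomorphism.

Local Open Scope complex_scope.

Theorem theorem3p1 (R : realType) (t : dynkin)
    (tau : 'I_(rank t) -> 'I_(rank t))
    (ht : wf_dynkin t) (htau : diagram_involution tau) :
  exists f : {lrmorphism iYangian01 R[i] tau -> iYangian R[i] tau},
    bijective f /\
    forall (i : 'I_(rank t)) (r : 'I_2),
      f (iY01_h R[i] tau i r) = iY_h R[i] tau i r /\
      f (iY01_b R[i] tau i r) = iY_b R[i] tau i r.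
Proof.
pose K : numFieldType := (R[i] : numClosedFieldType).
pose f : {lrmorphism iYangian01 K tau -> iYangian K tau} := iY01_to_iY ht htau.
exists f; split.
  by exists (iY_to_iY01 (K := K) ht htau); [exact: iY01_to_iYK|exact: iY_to_iY01K].
by move=> i r; split; [exact: iY01_to_iY_h|exact: iY01_to_iY_b].
Qed.
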